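(* Let $T\in\mathbb{C}^*$ and let $X$ be a singular complex analytic vector field on $\widehat{\mathbb{C}}_z$ arising from a function $\Psi_X$ in the family $$\mathscr{P}_{\tt r}=\left\{\Psi_X(z)=R\big(e^{2\pi i z/T}\big)\ \big|\ R:\widehat{\mathbb{C}}\to\widehat{\mathbb{C}}_t\text{ rational of degree }{\tt r}\ge1\right\},$$ that is, $X=\frac{1}{\Psi_X'(z)}\frac{\partial}{\partial z}$. The following assertions hold. 1) $X$ is periodic of period $T\in\mathbb{C}^*$ with a unique essential singularity at $\infty\in\widehat{\mathbb{C}}_z$. 2) $\Psi_X$ has two asymptotic values $a_1=R(0)$ and $a_2=R(\infty)$, counted with multiplicity. 3) Each of the two transcendental singularities of $\Psi_X^{-1}$ is logarithmic. The corresponding exponential tracts are i) hyperbolic tracts when the asymptotic value is finite, and ii) elliptic tracts when the asymptotic value is $\infty$. 4) If the critical point set $\mathcal{C}_R\subset\widehat{\mathbb{C}}$ of $R$ satisfies $\mathcal{C}_R\backslash\{0,\infty\}\ne\varnothing$, then $X$ has an infinite number of poles accumulating at $\infty\in\widehat{\mathbb{C}}_z$. 5) If $\infty\in\widehat{\mathbb{C}}_t$ is not an asymptotic value, then $X$ has an infinite number of zeros of multiplicity $2$ and residue zero accumulating at $\infty\in\widehat{\mathbb{C}}_z$. 6) The behaviour in 4) or 5) depends on the configuration of the two asymptotic values and infinity: i) (generic case) three distinct points $\{a_1,a_2,\infty\}\subset\widehat{\mathbb{C}}_t$; ii) two distinct points $\{a_1=a_2,\infty\}$; iii) two distinct points $\{a_1,a_2=\infty\}$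 or $\{a_1=\infty,a_2\}$; iv) one distinct point $\{a_1=a_2=\infty\}$. This provides a complete decomposition of the family $\mathscr{P}_{\tt r}$ into four subfamilies.
   Context: $\widehat{\mathbb{C}}_z,\widehat{\mathbb{C}}_t$ are Riemann spheres with coordinates $z,t$. For $X=\frac{1}{\Psi_X'}\frac{\partial}{\partial z}$ the 1-form of time is $\omega_X=d\Psi_X$, and the residue of $X$ at a point is the residue of $\omega_X$ there. ''Singular complex analytic'' means analytic apart from singularities that may be zeros, poles, essential singularities and accumulation points of these; essential singularities may be nonisolated. ''Generic'' means an open and dense set in the space of parameters of $\mathscr{P}_{\tt r}$ (the rational functions of degree ${\tt r}$ form a Zariski open set in $\mathbb{CP}^{2{\tt r}+1}$). **Singularities of $\Psi_X^{-1}$.** Let $D(a,\rho)\subset\widehat{\mathbb{C}}_t$ be the disk of spherical radius $\rho$ centered at $a$. For every $\rho>0$ choose a connected component $U_a(\rho)$ of $\Psi_X^{-1}(D(a,\rho))$ so that $\rho_1<\rho_2$ implies $U_a(\rho_1)\subset U_a(\rho_2)$. If $\bigcap_\rho U_a(\rho)=\varnothing$, the germ $U_a$ of $\rho\mapsto U_a(\rho)$ at $0$ is a *transcendental singularity* of $\Psi_X^{-1}$ over $a$, and $a$ is an *asymptotic value* (equivalently, $a=\lim\Psi_X(\alpha({\tt t}))$ along a path $\alpha({\tt t})$ tending to the essential singularity, contained eventually in each $U_a(\rho)$). Asymptotic values are counted with multiplicity, one for each transcendental singularity. $U_a$ is *logarithmic* if $\Psi_X:U_a(\rho)\to D(a,\rho)\backslash\{a\}$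 is a universal covering for small $\rho$; then $U_a(\rho)$ is called an exponential tract. $(U_a(\rho),X)$ is a *hyperbolic tract* (resp. *elliptic tract*, with $a=\infty$) if it is biholomorphic, as a domain with vector field, to $(\{\mathfrak{Re}(z)>0\},e^z\frac{\partial}{\partial z})$ (resp. $(\{\mathfrak{Re}(z)<0\},e^z\frac{\partial}{\partial z})$).
   Formalization: In 3) tracts are half-plane models up to translation (hyperbolic: only as germs, nested between the U_a(ρ)); in 4) the critical point must not be a pole of R; in 5) zeros have multiplicity ≥ 2, and exactly 2 if R has a simple pole. *)

(* Defs.v *)
From HB Require Import structures.
From mathcomp Require Import all_boot all_order all_algebra.
From mathcomp Require Import generic_quotient.
From mathcomp Require Import all_classical all_reals all_analysis.
From mathcomp Require Import complex.

Set Implicit Arguments.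
Unset Strict Implicit.
Unset Printing Implicit Defensive.

Import Order.TTheory GRing.Theory Num.Theory.
Import numFieldNormedType.Exports.

Local Open Scope classical_set_scope.
Local Open Scope ring_scope.

HB.instance Definition _ (R : rcfType) :=
  PseudoPointedMetric.copy R[i] (R[i]^o).
HB.instance Definition _ (R : rcfType) := NormedModule.copy R[i] (R[i]^o).

Section RiemannSphere.
Variable R : realType.
Local Notation C := R[i].
Local Notation normc := ComplexField.Normc.normc.

Definition sphere : Type := one_point_compactification C.
HB.instance Definition _ := Topological.copy sphere
  (one_point_compactification C).

Definition infty : sphere := None.
Definition fin (z : C) : sphere := Some z.

(* A parametrization s of a neighbourhood of w, centred at s = 0, and
   conversely a coordinate near b, centred at 0 when b = oo. The coordinate is
   meaningful only near b. *)
Definition chart_inv (w : sphere) (s : C) : sphere :=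
  match w with
  | Some w0 => fin (w0 + s)
  | None => if s == 0 then infty else fin s^-1
  end.

Definition chart (b x : sphere) : C :=
  match b, x with
  | Some _, Some y => y
  | None, Some y => y^-1
  | _, None => 0
  end.

(* Half of the Euclidean distance in the unit sphere of R^3 between the
   inverse stereographic projections of a and b. *)
Definition half_chord (a b : sphere) : R :=
  match a, b with
  | Some x, Some y =>
      normc (x - y) / (Num.sqrt (1 + normc x ^+ 2) * Num.sqrt (1 + normc y ^+ 2))
  | Some x, None | None, Some x => (Num.sqrt (1 + normc x ^+ 2))^-1
  | None, None => 0
  end.

Definition spherical_dist (a b : sphere) : R := 2 * asin (half_chord a b).

Definition spherical_disk (a : sphere) (rho : R) : set sphere :=
  [set b | spherical_dist a b < rho].

Definition cexp (z : C) : C :=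
  ((expR (complex.Re z) * cos (complex.Im z))
    +i* (expR (complex.Re z) * sin (complex.Im z)))%C.

(* p/q in lowest terms; at oo the quotient of the coefficients of degree
   max(deg p, deg q), which do not both vanish. *)
Definition ratfun (p q : {poly C}) (w : sphere) : sphere :=
  match w with
  | Some x => if q.[x] == 0 then infty else fin (p.[x] / q.[x])
  | None => let d := (maxn (size p) (size q)).-1 in
            if q`_d == 0 then infty else fin (p`_d / q`_d)
  end.

(* For r >= 1 this forces q != 0. *)
Definition degree_pair (r : nat) (p q : {poly C}) : Prop :=
  coprimep p q /\ maxn (size p) (size q) = r.+1.

Definition rational_of_degree (r : nat) (F : sphere -> sphere) : Prop :=
  exists p q : {poly C}, degree_pair r p q /\ F = ratfun p q.

Definition critical_points (F : sphere -> sphere) : set sphere :=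
  [set w | is_derive (0 : C) (1 : C) (chart (F w) \o F \o chart_inv w) 0].

Definition exp_pullback (T : C) (F : sphere -> sphere) (z : C) : sphere :=
  F (fin (cexp ((2 * pi)%:C%C * 'i%C * z / T))).

Definition exp_family (r : nat) (T : C) : set (C -> sphere) :=
  [set Psi | exists2 F, rational_of_degree r F & Psi = exp_pullback T F].

Section Meromorphic.

Definition holomorphic_on (U : set C) (f : C -> C) : Prop :=
  forall z, U z -> derivable f z 1.

(* Meromorphic functions on a plane domain are handled as total functions
   C -> C whose values at the (isolated) singular points are irrelevant: the
   notions below only look at punctured neighbourhoods. *)
Definition order_at (f : C -> C) (p : C) (n : int) : Prop :=
  exists h : C -> C, [/\ \forall z \near p, derivable h z 1, h p != 0 &
    \forall z \near p^', f z = (z - p) ^ n * h z].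

Definition meromorphic_at (f : C -> C) (p : C) : Prop :=
  exists (n : int) (h : C -> C), (\forall z \near p, derivable h z 1) /\
    \forall z \near p^', f z = (z - p) ^ n * h z.

(* c is the coefficient of (z - p)^-1 in the Laurent expansion at p of the
   meromorphic 1-form f(z) dz. *)
Definition residue_at (f : C -> C) (p : C) (c : C) : Prop :=
  exists (m : nat) (a : nat -> C) (h : C -> C),
    [/\ \forall z \near p, derivable h z 1, a 0%N = c &
        \forall z \near p^',
          f z = h z + \sum_(k < m.+1) a k * (z - p) ^- k.+1].

End Meromorphic.

Section VectorField.

(* omega_X = dPsi = time_form Psi dz and X = vfield Psi d/dz. *)
Definition time_form (Psi : C -> sphere) : C -> C :=
  derive1 (chart (fin 0) \o Psi : C -> C).

Definition vfield (Psi : C -> sphere) (z : C) : C := (time_form Psi z)^-1.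

(* The coefficient of X d/dz in a coordinate u centred at p; at oo, u = 1/z
   and d/dz = - u^2 d/du. *)
Definition local_coef (X : C -> C) (p : sphere) (u : C) : C :=
  match p with
  | Some z => X (z + u)
  | None => - u ^+ 2 * X u^-1
  end.

(* Possibly nonisolated (an accumulation point of poles, say): X is not
   meromorphic in any neighbourhood of p. *)
Definition essential_singularity (X : C -> C) (p : sphere) : Prop :=
  ~ meromorphic_at (local_coef X p) 0.

Definition poles (X : C -> C) : set C :=
  [set p | exists2 n : nat, (0 < n)%N & order_at X p (- n%:Z)].

Definition zeros_of_mult (X : C -> C) (k : nat) : set C :=
  [set p | (0 < k)%N /\ order_at X p k%:Z].

Definition infinitely_many_accumulating_at (S : set C) (p : sphere) : Prop :=
  infinite_set S /\ limit_point (fin @` S) p.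

Definition vf_biholomorphic (U : set C) (X : C -> C) (V : set C) (Y : C -> C) :
    Prop :=
  exists phi psi : C -> C,
    [/\ holomorphic_on U phi, holomorphic_on V psi,
        set_fun U V phi, set_fun V U psi &
        [/\ {in U, cancel phi psi}, {in V, cancel psi phi} &
            forall z, U z -> derive1 phi z * X z = Y (phi z)]].

End VectorField.

End RiemannSphere.

Arguments fin {R} z.
Arguments infty R : clear implicits.
Arguments cexp {R} z.

Section Coverings.
Variables (R : realType) (E B : topologicalType).

Definition homeomorphism_on (U : set E) (V : set B) (f : E -> B) : Prop :=
  exists g : B -> E,
    [/\ {within U, continuous f}, {within V, continuous g},
        set_fun U V f, set_fun V U g &
        {in U, cancel f g} /\ {in V, cancel g f}].

Definition covering_map (A : set E) (D : set B) (f : E -> B) : Prop :=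
  [/\ {within A, continuous f}, f @` A = D &
      forall b, D b -> exists N : set B, exists sheets : set (set E),
        [/\ (exists2 O, open O & N = D `&` O), N b,
            A `&` f @^-1` N = \bigcup_(V in sheets) V,
            trivIset sheets id &
            forall V, sheets V ->
              (exists2 O, open O & V = A `&` O) /\ homeomorphism_on V N f]].

Definition simply_connected (A : set E) : Prop :=
  [/\ A !=set0,
      forall x y, A x -> A y -> exists gamma : R -> E,
        [/\ {within `[0, 1], continuous gamma}, set_fun `[0, 1] A gamma,
            gamma 0 = x & gamma 1 = y] &
      forall gamma : R -> E,
        {within `[0, 1], continuous gamma} -> set_fun `[0, 1] A gamma ->
        gamma 0 = gamma 1 ->
        exists H : R * R -> E,
          [/\ {within `[0, 1] `*` `[0, 1], continuous H},
              set_fun (`[0, 1] `*` `[0, 1]) A H,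
              {in `[0, 1], forall s, H (s, 0) = gamma s},
              {in `[0, 1], forall s, H (s, 1) = gamma 0} &
              {in `[0, 1], forall t, H (0, t) = gamma 0 /\
                                     H (1, t) = gamma 0}]].

Definition universal_covering (A : set E) (D : set B) (f : E -> B) : Prop :=
  covering_map A D f /\ simply_connected A.

End Coverings.

Section InverseSingularities.
Variable R : realType.
Local Notation C := R[i].

Definition is_component (A U : set C) : Prop :=
  exists2 x, A x & U = connected_component A x.

(* Only the values U rho for rho > 0 matter. *)
Definition transcendental_singularity
    (Psi : C -> sphere R) (a : sphere R) (U : R -> set C) : Prop :=
  [/\ forall rho, 0 < rho -> is_component (Psi @^-1` spherical_disk a rho) (U rho),
      forall rho1 rho2, 0 < rho1 -> rho1 < rho2 -> U rho1 `<=` U rho2 &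
      \bigcap_(rho in [set rho | 0 < rho]) U rho = set0].

Definition same_germ (U V : R -> set C) : Prop :=
  \forall rho \near 0^'+, U rho = V rho.

Definition asymptotic_value (Psi : C -> sphere R) (a : sphere R) : Prop :=
  exists U, transcendental_singularity Psi a U.

Definition logarithmic (Psi : C -> sphere R) (a : sphere R) (U : R -> set C) :
    Prop :=
  \forall rho \near 0^'+,
    universal_covering R (U rho) (spherical_disk a rho `\ a) Psi.

(* The tract is a germ at rho = 0, so its half-plane model is a germ at
   Re z = +oo: the abscissa h is free, the translation by h carrying
   ({Re z > h}, e^z d/dz) to ({Re z > 0}, e^h e^z d/dz). As a spherical disk
   about a finite a != 0 is a Euclidean disk with another centre, U rho itself
   is never exactly a half-plane; it contains one, which contains in turn all
   the U rho' for rho' small. *)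
Definition hyperbolic_tract (U : R -> set C) (X : C -> C) : Prop :=
  \forall rho \near 0^'+, exists (h : R) (V : set C),
    [/\ V `<=` U rho, \forall rho' \near 0^'+, U rho' `<=` V &
        vf_biholomorphic V X [set z | h < complex.Re z] cexp].

Definition elliptic_tract (U : R -> set C) (X : C -> C) : Prop :=
  \forall rho \near 0^'+, exists h : R,
    vf_biholomorphic (U rho) X [set z | complex.Re z < h] cexp.

End InverseSingularities.

Section ParameterSpace.
Variables (R : realType) (n : nat).
Local Notation C := R[i].

Definition nonzero_row : Type := [set v : 'rV[C]_n | v != 0].
HB.instance Definition _ := Topological.on nonzero_row.
HB.instance Definition _ := Choice.on nonzero_row.

Definition proportional (u v : nonzero_row) : bool := (\val u == \val v)%MS.

Lemma proportional_refl : reflexive proportional.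
Proof. by move=> u; rewrite /proportional submx_refl. Qed.

Lemma proportional_sym : symmetric proportional.
Proof. by move=> u v; rewrite /proportional andbC. Qed.

Lemma proportional_trans : transitive proportional.
Proof.
move=> v u w /andP[uv vu] /andP[vw wv]; apply/andP.
by split; [exact: submx_trans uv vw | exact: submx_trans wv vu].
Qed.

Definition proportional_equiv :=
  EquivRel proportional proportional_refl proportional_sym proportional_trans.

(* CP^(n-1), with the quotient topology. *)
Definition projective_space : Type := {eq_quot proportional_equiv}%qT.
HB.instance Definition _ :=
  Topological.copy projective_space (quotient_topology projective_space).
HB.instance Definition _ := Quotient.on projective_space.

End ParameterSpace.

Section Configurations.
Variable R : realType.
Local Notation C := R[i].

Inductive configuration :=
  | ThreePoints
  | EqualFinite
  | OneInfinite
  | BothInfinite.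

Definition has_configuration (c : configuration) (a1 a2 : sphere R) : Prop :=
  match c with
  | ThreePoints => [/\ a1 <> a2, a1 <> infty R & a2 <> infty R]
  | EqualFinite => a1 = a2 /\ a1 <> infty R
  | OneInfinite => (a1 <> infty R /\ a2 = infty R) \/
                   (a1 = infty R /\ a2 <> infty R)
  | BothInfinite => a1 = infty R /\ a2 = infty R
  end.

Definition subfamily (r : nat) (T : C) (c : configuration) :
    set (C -> sphere R) :=
  [set Psi | exists F, [/\ rational_of_degree r F, Psi = exp_pullback T F &
                           has_configuration c (F (fin 0)) (F (infty R))]].

Definition numerator r (v : 'rV[C]_(r.+1 + r.+1)) : {poly C} := rVpoly (lsubmx v).
Definition denominator r (v : 'rV[C]_(r.+1 + r.+1)) : {poly C} := rVpoly (rsubmx v).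

(* The points of CP^(2r+1) whose rational function lies in P; by homogeneity
   this does not depend on the representative. *)
Definition parameters (r : nat) (P : (sphere R -> sphere R) -> Prop) :
    set (projective_space R (r.+1 + r.+1)) :=
  [set x | let v := \val (repr x) in
           degree_pair r (numerator v) (denominator v) /\
           P (ratfun (numerator v) (denominator v))].

Arguments parameters r P : clear implicits.

(* Openness and density in the space of rational functions of degree r. *)
Definition generic (r : nat) (P : (sphere R -> sphere R) -> Prop) : Prop :=
  let all_params := parameters r (fun _ => True) in
  (exists2 O, open O & parameters r P = all_params `&` O) /\
  all_params `<=` closure (parameters r P).

End Configurations.

Arguments subfamily {R} r T c _.
Arguments parameters {R} r P _.

(* Main.v *)
(* Write E(z) = exp(2 pi i z / T), so that Psi = R o E, and R = p/q.

   The zeros and poles of X are the E-fibres of the nonzero poles and of the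
   nonzero critical points of R; such a fibre is a translation orbit of T and
   therefore accumulates at oo. At each of its points the local orders are read
   off the factorizations of q and of the Wronskian p' q - p q', and dPsi, being
   exact, has no residue. If X were meromorphic at oo it would grow at most like a
   power of |z|; but either R is finite at one of 0, oo, and X grows exponentially
   in that direction, or R has poles at both and then a nonzero critical
   point, and X has poles accumulating at oo.

   A rotation of the sphere turns the preimage of a spherical disk about a into
   {|P(E)| < tau |Q(E)|} for polynomials P, Q. For small tau a connected subset
   of it is bounded or lies far to the left or far to the right, where E tends to
   0 or to oo. In a nested family with empty intersection the bounded case is
   excluded by compactness and discreteness of the zeros of P(E). On the left,
   P/Q vanishes at 0 to some order m >= 1, and L = log((P/Q) o E) is a bounded
   perturbation of m 2 pi i z / T, inverted by the contraction principle. In the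
   coordinate L the tract is a half-plane and the rotated Psi is exp, which gives
   uniqueness, the universal covering property and the models of X. The right
   end follows by exchanging w and 1/w. *)

Require Import Defs.
From HB Require Import structures.
From mathcomp Require Import all_boot all_order all_algebra.
From mathcomp Require Import generic_quotient.
From mathcomp Require Import all_classical all_reals all_analysis.
From mathcomp Require Import complex.
From mathcomp Require Import ring lra zify.
Import Order.TTheory GRing.Theory Num.Theory.
Import numFieldNormedType.Exports.

Set Implicit Arguments.
Unset Strict Implicit.
Unset Printing Implicit Defensive.

Local Open Scope classical_set_scope.
Local Open Scope ring_scope.

(** A pole of order k of R gives zeros of X of multiplicity k + 1, so multiplicity 2 is exactly the
    case of a simple, that is noncritical, pole: hence the two clauses of assertion 5. Assertion 4
    asks for a critical point with finite value because a multiple pole is critical too but produces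
    zeros of X.

    A singularity is an arbitrary nested choice of components, so it is located on one side by a
    separation argument before it is identified with an explicit set in a chart. For a finite value
    a two charts are compared: the logarithm of the rotated function describes the component
    exactly, while X is linearized by the logarithm of Psi - a. Each differs from a positive
    multiple of c z by a bounded amount, so their half-planes interlace.

    The subfamilies are sets of functions Psi, not of maps R, so that R(0) and R(oo) must be
    recovered from Psi, namely as the values of the singularities on the left and on the right.

    When R has poles at both 0 and oo the growth of X along the two ends gives nothing, and the
    critical point replacing it comes from a degree count on the Wronskian. *)

Local Notation normc := ComplexField.Normc.normc.
Local Notation Re := complex.Re.
Local Notation Im := complex.Im.

(** * Moduli, limits and derivatives in the complex plane *)

Section ComplexBasics.
Variable R : realType.
Local Notation C := R[i].

Lemma normCE (z : C) : `|z| = (normc z)%:C%C.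
Proof. by []. Qed.

Lemma normc_ge0 (z : C) : 0 <= normc z.
Proof. by case: z => a b; rewrite /= sqrtr_ge0. Qed.

Lemma normc_sub_sym (z w : C) : normc (z - w) = normc (w - z).
Proof. by rewrite -opprB normcN. Qed.

Lemma normcM (z w : C) : normc (z * w) = normc z * normc w.
Proof. exact: ComplexField.Normc.normcM. Qed.

Lemma normcD (z w : C) : normc (z + w) <= normc z + normc w.
Proof. exact: complex.le_normcD. Qed.

Lemma normcB (z w : C) : normc (z - w) <= normc z + normc w.
Proof. by rewrite -(normcN w) normcD. Qed.

Lemma normcV (z : C) : normc z^-1 = (normc z)^-1.
Proof. exact: ComplexField.Normc.normcV. Qed.

Lemma normc0 : normc (0 : C) = 0. Proof. exact: ComplexField.Normc.normc0. Qed.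
Lemma normc1 : normc (1 : C) = 1. Proof. exact: ComplexField.Normc.normc1. Qed.

Lemma normc_eq0 (z : C) : (normc z == 0) = (z == 0).
Proof.
by apply/eqP/eqP => [/ComplexField.Normc.eq0_normc//|->]; rewrite normc0.
Qed.

Lemma normc_gt0 (z : C) : (0 < normc z) = (z != 0).
Proof. by rewrite lt_def normc_ge0 andbT normc_eq0. Qed.

Lemma normc_real (x : R) : normc x%:C%C = `|x|.
Proof. by rewrite /= expr0n /= addr0 sqrtr_sqr. Qed.

Lemma normcX (z : C) n : normc (z ^+ n) = normc z ^+ n.
Proof. by elim: n => [|n IH]; rewrite ?expr0 ?normc1// !exprS normcM IH. Qed.

Lemma normc_dist (z w : C) : `|normc z - normc w| <= normc (z - w).
Proof.
rewrite ler_norml lerBlDr -normc_sub_sym lerNl opprB lerBlDr.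
by rewrite -{1}(subrK z w) normcD normc_sub_sym -{1}(subrK w z) normcD.
Qed.

Lemma normc_sqr (z : C) : normc z ^+ 2 = Re z ^+ 2 + Im z ^+ 2.
Proof. by case: z => a b; rewrite /= sqr_sqrtr// addr_ge0// sqr_ge0. Qed.

Lemma Re_le_normc (z : C) : `|Re z| <= normc z.
Proof.
rewrite -(ler_pXn2r (ltn0Sn 1)) ?nnegrE ?normc_ge0// normc_sqr real_normK ?num_real//.
by rewrite lerDl sqr_ge0.
Qed.

Lemma Im_le_normc (z : C) : `|Im z| <= normc z.
Proof.
rewrite -(ler_pXn2r (ltn0Sn 1)) ?nnegrE ?normc_ge0// normc_sqr real_normK ?num_real//.
by rewrite lerDr sqr_ge0.
Qed.

Lemma normc_le_Re_Im (z : C) : normc z <= `|Re z| + `|Im z|.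
Proof.
rewrite -(ler_pXn2r (ltn0Sn 1)) ?nnegrE ?normc_ge0 ?addr_ge0// normc_sqr.
rewrite sqrrD !real_normK ?num_real// lerD2r lerDl.
by rewrite mulrn_wge0// mulr_ge0.
Qed.

Lemma ReD (z w : C) : Re (z + w) = Re z + Re w.
Proof. by case: z w => a b []. Qed.
Lemma ImD (z w : C) : Im (z + w) = Im z + Im w.
Proof. by case: z w => a b []. Qed.
Lemma ReN (z : C) : Re (- z) = - Re z.
Proof. by case: z. Qed.
Lemma ImN (z : C) : Im (- z) = - Im z.
Proof. by case: z. Qed.
Lemma ReZ (x : R) (z : C) : Re (x%:C%C * z) = x * Re z.
Proof. by case: z => a b /=; rewrite mul0r subr0. Qed.
Lemma gt0C (e : C) : 0 < e -> exists2 x : R, 0 < x & e = x%:C%C.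
Proof. by case: e => a b; rewrite ltcE/= => /andP[/eqP -> h]; exists a. Qed.

(** Balls of C have radii in C itself, and an element that is positive for the partial order of C is
    real; real radii therefore suffice. *)
Lemma nbhsCP (z : C) (A : set C) :
  nbhs z A <-> exists2 e : R, 0 < e & forall w, normc (w - z) < e -> A w.
Proof.
split.
  move/nbhs_ballP => [e /= /gt0C[x x0 ->] H]; exists x => // w wz.
  by apply: H; rewrite -ball_normE/= normCE ltcR normc_sub_sym.
move=> [e e0 H]; apply/nbhs_ballP; exists e%:C%C => /=; first by rewrite ltcR.
by move=> w; rewrite -ball_normE/= normCE ltcR normc_sub_sym; exact: H.
Qed.

Lemma near_dnbhsCP (z : C) (A : set C) :
  nbhs z^' A <->
  exists2 e : R, 0 < e & forall w, w != z -> normc (w - z) < e -> A w.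
Proof.
rewrite /dnbhs /= /within /=; split.
  by move/nbhsCP => [e e0 H]; exists e => // w wz we; exact: H.
by move=> [e e0 H]; apply/nbhsCP; exists e => // w we wz; exact: H.
Qed.

(* Limits of complex-valued functions, stated with the real-valued modulus. *)
Definition clim (T : Type) (F : set_system T) (f : T -> C) (l : C) : Prop :=
  forall e : R, 0 < e -> F [set x | normc (f x - l) < e].

Lemma climP (T : Type) (F : set_system T) {FF : Filter F} (f : T -> C) (l : C) :
  clim F f l <-> f x @[x --> F] --> l.
Proof.
split=> [H A /nbhsCP[e e0 hA]|H e e0].
  by apply: filterS (H e e0) => x; exact: hA.
by have := H [set y | normc (y - l) < e]; apply; apply/nbhsCP; exists e.
Qed.

Section Clim.
Context (T : Type) (F : set_system T) {FF : Filter F}.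
Implicit Types (f g : T -> C) (a b : C).

Lemma climD f g a b : clim F f a -> clim F g b -> clim F (fun x => f x + g x) (a + b).
Proof. by move=> /climP x /climP y; apply/climP; exact: (@cvgD C C^o T F FF f g a b x y). Qed.

Lemma climM f g a b : clim F f a -> clim F g b -> clim F (fun x => f x * g x) (a * b).
Proof. by move=> /climP x /climP y; apply/climP; exact: (@cvgM C T F FF f g a b x y). Qed.

Lemma climV f a : a != 0 -> clim F f a -> clim F (fun x => (f x)^-1) a^-1.
Proof. by move=> x /climP y; apply/climP; exact: (@cvgV C T F FF f a x y). Qed.

Lemma clim_cst a : clim F (fun=> a) a.
Proof. by move=> e e0; apply: filterE => x /=; rewrite subrr normc0. Qed.

Lemma clim_near f g a : (\forall x \near F, f x = g x) -> clim F f a -> clim F g a.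
Proof. by move=> fg H e /H; apply: filterS2 fg => x /= ->. Qed.

Lemma clim_comp f (g : C -> C) a b :
  clim F f a -> clim (nbhs a) g b -> clim F (fun x => g (f x)) b.
Proof.
move=> fa ga e /ga /nbhsCP[d d0 H]; apply: filterS (fa _ d0) => x; exact: H.
Qed.

Lemma clim_neq0 f a : clim F f a -> a != 0 -> \forall x \near F, f x != 0.
Proof.
move=> H a0; have := H (normc a); rewrite normc_gt0 => /(_ a0).
apply: filterS => x /=; apply: contraTneq => ->.
by rewrite sub0r normcN ltxx.
Qed.

Lemma clim_normc f a : clim F f a -> normc (f x) @[x --> F] --> normc a.
Proof.
move=> H; apply/cvgrPdist_lt => e /H; apply: filterS => x /=.
by apply: le_lt_trans; rewrite distrC; exact: normc_dist.
Qed.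

Lemma clim_Re f a : clim F f a -> Re (f x) @[x --> F] --> Re a.
Proof.
move=> H; apply/cvgrPdist_lt => e /H; apply: filterS => x /=.
by apply: le_lt_trans; rewrite distrC -ReN -ReD; exact: Re_le_normc.
Qed.

Lemma clim_Im f a : clim F f a -> Im (f x) @[x --> F] --> Im a.
Proof.
move=> H; apply/cvgrPdist_lt => e /H; apply: filterS => x /=.
by apply: le_lt_trans; rewrite distrC -ImN -ImD; exact: Im_le_normc.
Qed.

Lemma clim_Complex (f g : T -> R) (a b : R) :
  f x @[x --> F] --> a -> g x @[x --> F] --> b ->
  clim F (fun x => Complex (f x) (g x)) (Complex a b).
Proof.
move=> /cvgrPdist_lt Hf /cvgrPdist_lt Hg e e0.
have e2 : 0 < e / 2 by rewrite divr_gt0.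
apply: filterS2 (Hf _ e2) (Hg _ e2) => x h1 h2.
apply: (le_lt_trans (normc_le_Re_Im (Complex (f x - a) (g x - b)))).
by rewrite (splitr e) ltrD// distrC.
Qed.

End Clim.

Lemma clim_id (z : C) : clim (nbhs z) id z.
Proof. by move=> e e0; apply/nbhsCP; exists e. Qed.

Lemma nearCW (P : C -> Prop) (z : C) : (forall w, P w) -> \forall w \near z, P w.
Proof. by move=> H; apply: filterE. Qed.

(** Caratheodory's form of differentiability: the slope is defined at the base point as well, so the
    product, chain and inverse rules become algebra of limits with no separate case for a vanishing
    increment. *)
Lemma is_deriveCP (f : C -> C) (z d : C) :
  is_derive z 1 f d <->
  exists phi : C -> C, [/\ forall w, f w - f z = phi w * (w - z), phi z = d &
    clim (nbhs z) phi d].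
Proof.
split.
  move=> [dv de].
  exists (fun w => if w == z then d else (f w - f z) / (w - z)); split.
  - move=> w; have [->|wz] := eqVneq w z; first by rewrite !subrr mulr0.
    by rewrite divfK// subr_eq0.
  - by rewrite eqxx.
  move=> e e0.
  move: dv; rewrite /derivable => /cvg_ex[l /= hl].
  have : l = d by rewrite -de; apply/esym/cvg_lim.
  move=> ld; subst l; move/climP : hl => /(_ e e0) /near_dnbhsCP [r r0 H].
  apply/nbhsCP; exists r => // w wr /=; case: eqVneq => wz; first by rewrite subrr normc0.
  have := H (w - z); rewrite subr_eq0 wz subr0 => /(_ isT wr).
  by rewrite /= -[(w - z)%:A]/((w - z) * 1) mulr1 subrK -[_ *: _]/(_ * _) mulrC.
move=> [phi [h1 h2 h3]].
suff H : h^-1 *: (f (h *: (1 : C) + z) - f z) @[h --> (0 : C)^'] --> d.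
  split; last by apply: cvg_lim => //.
  by apply/cvg_ex; exists d.
apply/climP => e e0; move: h3 => /(_ e e0) /nbhsCP[r r0 H].
apply/near_dnbhsCP; exists r => // h h0; rewrite subr0 => hr /=.
rewrite h1 -[h%:A]/(h * 1) mulr1 addrK -[_ *: _]/(h^-1 * _) mulrCA mulVf// mulr1.
by apply: H; rewrite addrK.
Qed.

Lemma derivableC_ex (f : C -> C) (z : C) :
  derivable f z 1 <-> exists d, is_derive z 1 f d.
Proof.
split=> [df|[d []//]]; exists ('D_1 f z); exact: DeriveDef.
Qed.

Lemma is_derive1C (f : C -> C) (z d : C) : is_derive z 1 f d -> derive1 f z = d.
Proof. by move=> [_ <-]; rewrite derive1E. Qed.

Lemma is_deriveC_uniq (f : C -> C) (z d e : C) :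
  is_derive z 1 f d -> is_derive z 1 f e -> d = e.
Proof. by move=> [_ <-] [_ <-]. Qed.

Lemma is_deriveC_cvg (f : C -> C) (z d : C) :
  is_derive z 1 f d -> clim (nbhs z) f (f z).
Proof.
move=> /is_deriveCP[phi [h1 h2 h3]].
have : clim (nbhs z) (fun w => f z + phi w * (w + - z)) (f z + d * (z + - z)).
  apply: climD; first exact: clim_cst.
  apply: climM h3 _; apply: climD; [exact: clim_id|exact: clim_cst].
rewrite subrr mulr0 addr0; apply: clim_near; apply: nearCW => w.
by rewrite -h1 addrC subrK.
Qed.

Lemma is_deriveC_near (f g : C -> C) (z d : C) :
  (\forall w \near z, f w = g w) -> is_derive z 1 f d -> is_derive z 1 g d.
Proof.
move=> fg /is_deriveCP[phi [h1 h2 h3]]; have fgz := nbhs_singleton fg.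
apply/is_deriveCP.
exists (fun w => if w == z then d else (g w - g z) / (w - z)); split.
- move=> w; have [->|wz] := eqVneq w z; first by rewrite !subrr mulr0.
  by rewrite divfK// subr_eq0.
- by rewrite eqxx.
apply: clim_near h3; apply: filterS fg => w e; case: eqVneq => [->//|wz].
by rewrite -e -fgz h1 mulfK// subr_eq0.
Qed.

Lemma is_deriveC_eq (f : C -> C) (z d e : C) :
  is_derive z 1 f d -> d = e -> is_derive z 1 f e.
Proof. by move=> h <-. Qed.

Lemma is_deriveC_id (z : C) : is_derive z 1 (fun w : C => w) (1 : C).
Proof.
apply/is_deriveCP; exists (fun=> 1); split => //; first by move=> w; rewrite mul1r.
exact: clim_cst.
Qed.

Lemma is_deriveC_cst (z a : C) : is_derive z 1 (fun _ : C => a) (0 : C).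
Proof.
apply/is_deriveCP; exists (fun=> 0); split => //; first by move=> w; rewrite mul0r subrr.
exact: clim_cst.
Qed.

Lemma is_deriveC_D (f g : C -> C) (z a b : C) :
  is_derive z 1 f a -> is_derive z 1 g b -> is_derive z 1 (fun w => f w + g w) (a + b).
Proof.
move=> /is_deriveCP[p [p1 p2 p3]] /is_deriveCP[q [q1 q2 q3]].
apply/is_deriveCP; exists (fun w => p w + q w); split; last exact: climD.
  by move=> w; rewrite mulrDl -p1 -q1; ring.
by rewrite p2 q2.
Qed.

Lemma is_deriveC_M (f g : C -> C) (z a b : C) :
  is_derive z 1 f a -> is_derive z 1 g b ->
  is_derive z 1 (fun w => f w * g w) (a * g z + f z * b).
Proof.
move=> /[dup] hf /is_deriveCP[p [p1 p2 p3]] /[dup] hg /is_deriveCP[q [q1 q2 q3]].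
apply/is_deriveCP; exists (fun w => p w * g w + f z * q w); split.
- by move=> w; rewrite mulrDl mulrAC -p1 -mulrA -q1; ring.
- by rewrite p2 q2.
apply: climD; apply: climM => //; last exact: clim_cst.
exact: is_deriveC_cvg hg.
Qed.

Lemma is_deriveC_comp (f g : C -> C) (z a b : C) :
  is_derive z 1 f a -> is_derive (f z) 1 g b ->
  is_derive z 1 (fun w => g (f w)) (b * a).
Proof.
move=> /[dup] hf /is_deriveCP[p [p1 p2 p3]] /is_deriveCP[q [q1 q2 q3]].
apply/is_deriveCP; exists (fun w => q (f w) * p w); split.
- by move=> w; rewrite q1 p1 mulrA.
- by rewrite p2 q2.
by apply: climM => //; apply: clim_comp q3; exact: is_deriveC_cvg hf.
Qed.

Lemma is_deriveC_inv (z : C) : z != 0 -> is_derive z 1 (fun w : C => w^-1) (- (z ^+ 2)^-1).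
Proof.
move=> z0.
(* Since [0^-1 = 0], the slope [- (w^-1 * z^-1)] fails at [w = 0]; the function is altered there,
   away from [z], so that the identity holds for all [w]. *)
have H : is_derive z 1 (fun w : C => if w == 0 then z^-1 - (w - z) / z ^+ 2 else w^-1)
    (- (z ^+ 2)^-1).
  apply/is_deriveCP; exists (fun w => if w == 0 then - (z ^+ 2)^-1 else - (w^-1 * z^-1)); split.
  - move=> w; rewrite (negbTE z0); case: eqVneq => w0; first by ring.
    by field; rewrite w0 z0.
  - by rewrite (negbTE z0) expr2 invfM.
  have : clim (nbhs z) (fun w => - 1 * (w^-1 * z^-1)) (- 1 * (z^-1 * z^-1)).
    apply: climM; first exact: clim_cst.
    apply: climM; last exact: clim_cst.
    apply: climV => //; exact: clim_id.
  rewrite mulN1r -invfM -expr2; apply: clim_near.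
  apply: filterS (clim_neq0 (clim_id z) z0) => w w0.
  by rewrite (negbTE w0) mulN1r.
apply: is_deriveC_near H; apply: filterS (clim_neq0 (clim_id z) z0) => w w0.
by rewrite (negbTE w0).
Qed.

Lemma is_deriveC_V (f : C -> C) (z a : C) : f z != 0 ->
  is_derive z 1 f a -> is_derive z 1 (fun w => (f w)^-1) (- a / f z ^+ 2).
Proof.
move=> f0 hf; have := is_deriveC_comp hf (is_deriveC_inv f0).
by rewrite mulNr mulrC -mulNr.
Qed.

Lemma is_deriveC_poly (p : {poly C}) (z : C) :
  is_derive z 1 (fun w => p.[w]) (p^`().[z]).
Proof.
elim/poly_ind: p => [|p c IH].
  rewrite linear0 horner0; apply: is_deriveC_near (is_deriveC_cst _ (0 : C)).
  by apply: nearCW => w; rewrite horner0.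
rewrite derivD derivM derivC derivX addr0 mulr1 hornerD hornerM hornerX.
have := is_deriveC_D (is_deriveC_M IH (is_deriveC_id z)) (is_deriveC_cst z c).
rewrite addr0 mulr1; apply: is_deriveC_near; apply: nearCW => w.
by rewrite hornerD hornerM hornerX hornerC.
Qed.

Lemma is_deriveC_Z (k : C) (f : C -> C) (z a : C) :
  is_derive z 1 f a -> is_derive z 1 (fun w => k * f w) (k * a).
Proof.
move=> hf; apply: is_deriveC_eq (is_deriveC_M (is_deriveC_cst z k) hf) _.
by rewrite mul0r add0r.
Qed.

(** A right inverse that is continuous at z is differentiable there: with p the slope of f, w - z =
    p (g w) (g w - g z), and p (g w) tends to d != 0. *)
Lemma is_deriveC_rinv (f g : C -> C) (z d : C) :
  is_derive (g z) 1 f d -> d != 0 -> (\forall w \near z, f (g w) = w) ->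
  clim (nbhs z) g (g z) -> is_derive z 1 g d^-1.
Proof.
move=> /is_deriveCP[p [p1 p2 p3]] d0 fg gz.
have fgz := nbhs_singleton fg.
have pg : clim (nbhs z) (fun w => p (g w)) d.
  exact: clim_comp gz p3.
apply/is_deriveCP.
exists (fun w => if w == z then d^-1 else (g w - g z) / (w - z)); split.
- move=> w; have [->|wz] := eqVneq w z; first by rewrite !subrr mulr0.
  by rewrite divfK// subr_eq0.
- by rewrite eqxx.
apply: clim_near (climV d0 pg).
apply: filterS2 fg (clim_neq0 pg d0) => w fgw pw.
case: eqVneq => [->|wz]; first by rewrite p2.
have e : w - z = p (g w) * (g w - g z) by rewrite -p1 fgw fgz.
have : g w - g z != 0.
  by apply: contra_neq wz => /eqP e0; apply/eqP; rewrite -subr_eq0 e (eqP e0) mulr0.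
by move=> g0; rewrite e; field; rewrite g0 pw.
Qed.

End ComplexBasics.

(** * Mean value inequality, complex exponential, a branch of the logarithm *)

Section ComplexExp.
Variable R : realType.
Local Notation C := R[i].

Lemma is_deriveRP (f : R -> R) (x d : R) :
  is_derive x 1 f d <->
  exists phi : R -> R, [/\ forall y, f y - f x = phi y * (y - x), phi x = d &
    phi y @[y --> x] --> d].
Proof.
split.
  move=> [dv de].
  exists (fun y => if y == x then d else (f y - f x) / (y - x)); split.
  - move=> y; have [->|yx] := eqVneq y x; first by rewrite !subrr mulr0.
    by rewrite divfK// subr_eq0.
  - by rewrite eqxx.
  apply/cvgrPdist_lt => e e0.
  move: dv; rewrite /derivable => /cvg_ex[l /= hl].
  have : l = d by rewrite -de; apply/esym/cvg_lim.
  move=> ld; subst l; move/cvgrPdist_lt : hl => /(_ e e0) /nbhs_ballP[r /= r0 H].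
  apply/nbhs_ballP; exists r => //= y yr; case: eqVneq => yx; first by rewrite subrr normr0.
  have := H (y - x); rewrite /ball /= sub0r normrN distrC subr_eq0 yx => /(_ yr isT).
  by rewrite -[(y - x)%:A]/((y - x) * 1) mulr1 subrK -[_ *: _]/(_ * _) mulrC.
move=> [phi [h1 h2 h3]].
suff H : h^-1 *: (f (h *: (1 : R) + x) - f x) @[h --> (0 : R)^'] --> d.
  split; last by apply: cvg_lim => //.
  by apply/cvg_ex; exists d.
apply/cvgrPdist_lt => e e0; move/cvgrPdist_lt: h3 => /(_ e e0) /nbhs_ballP[r /= r0 H].
apply/nbhs_ballP; exists r => //= h; rewrite /ball /= sub0r normrN => hr h0.
rewrite h1 -[h%:A]/(h * 1) mulr1 addrK -[_ *: _]/(h^-1 * _) mulrCA mulVf// mulr1.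
by apply: H; rewrite /ball /= opprD addrCA subrr addr0 normrN.
Qed.

Lemma is_deriveR_eps (f : R -> R) (x d e : R) : is_derive x 1 f d -> 0 < e ->
  exists2 r : R, 0 < r & forall h, `|h| < r -> `|f (x + h) - f x - d * h| <= e * `|h|.
Proof.
move=> /is_deriveRP[phi [h1 h2 h3]] e0.
move/cvgrPdist_lt: h3 => /(_ e e0) /nbhs_ballP[r /= r0 H].
exists r => // h hr; rewrite h1 (addrC x h) addrK -mulrBl normrM ler_wpM2r//.
by rewrite distrC ltW//; apply: H; rewrite /ball /= opprD addrCA subrr addr0 normrN.
Qed.

Lemma clim_line (a w : C) (t : R) : clim (nbhs t) (fun u : R => a + u%:C%C * w) (a + t%:C%C * w).
Proof.
move=> e e0; apply/nbhs_ballP; exists (e / (1 + normc w)) => /=.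
  by rewrite divr_gt0// ltr_pwDl// normc_ge0.
move=> u; rewrite /ball /= ltr_pdivlMr ?ltr_pwDl ?normc_ge0// => h.
rewrite opprD addrACA subrr add0r -mulrBl -rmorphB normcM normc_real distrC.
by apply: le_lt_trans h; rewrite ler_wpM2l// lerDr.
Qed.

Lemma is_derive_Re_line (f : C -> C) (a w k d : C) (t : R) :
  is_derive (a + t%:C%C * w) 1 f d ->
  is_derive t 1 (fun u : R => Re (k * f (a + u%:C%C * w))) (Re (k * d * w)).
Proof.
move=> /is_deriveCP[p [p1 p2 p3]]; apply/is_deriveRP.
exists (fun u => Re (k * p (a + u%:C%C * w) * w)); split.
- move=> u; rewrite -ReN -ReD -mulrBr p1 [RHS]mulrC -ReZ; congr Re.
  by rewrite [(u - t)%:C%C]rmorphB /=; ring.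
- by rewrite p2.
apply: clim_Re; apply: climM; last exact: clim_cst.
apply: climM; first exact: clim_cst.
exact: clim_comp (clim_line _ _ _) p3.
Qed.

Lemma normc_conjM (v : C) : v^*%C * v = (normc v ^+ 2)%:C%C.
Proof.
rewrite normc_sqr; case: v => a b; apply/eqP; rewrite eq_complex /=.
by apply/andP; split; apply/eqP; ring.
Qed.

Lemma normc_conj (v : C) : normc v^*%C = normc v.
Proof. by case: v => a b /=; rewrite sqrrN. Qed.

(** The mean value theorem fails for complex values. The real one is applied along the segment to
    the real part of conj(v) f with v = f b - f a, whose increment is |v|^2. *)
Lemma mean_value_ineq (f df : C -> C) (a b : C) (K : R) :
  (forall t : R, 0 <= t <= 1 -> is_derive (a + t%:C%C * (b - a)) 1 f (df (a + t%:C%C * (b - a)))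
     /\ normc (df (a + t%:C%C * (b - a))) <= K) ->
  normc (f b - f a) <= K * normc (b - a).
Proof.
move=> H; set v := f b - f a.
have [->|v0] := eqVneq v 0.
  rewrite normc0 mulr_ge0 ?normc_ge0//.
  have [_] := H 0 ltac:(by rewrite lexx ler01).
  by apply: le_trans; exact: normc_ge0.
pose phi (t : R) := Re (v^*%C * f (a + t%:C%C * (b - a))).
pose dphi (t : R) := Re (v^*%C * df (a + t%:C%C * (b - a)) * (b - a)).
have D (t : R) : 0 <= t <= 1 -> is_derive t 1 phi (dphi t).
  by move=> /H[h _]; exact: is_derive_Re_line.
have [||c /= ] := @MVT_segment R phi dphi 0 1 ler01.
- by move=> x; rewrite in_itv /= => /andP[x0 x1]; apply: D; rewrite !ltW.
- apply: derivable_within_continuous => x; rewrite in_itv/= => /D h.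
  exact: ex_derive.
rewrite in_itv /= => c01; rewrite subr0 mulr1.
rewrite /phi mul0r addr0 mul1r (addrC a) subrK -ReN -ReD -mulrBr normc_conjM /= => e.
have : normc v ^+ 2 <= normc v * (K * normc (b - a)).
  rewrite e; apply: le_trans (ler_norm _) _; apply: le_trans (Re_le_normc _) _.
  rewrite !normcM normc_conj -mulrA ler_wpM2l ?normc_ge0// ler_wpM2r ?normc_ge0//.
  by have [] := H c c01.
by rewrite expr2 ler_pM2l// normc_gt0.
Qed.

Lemma cexp0 : cexp (0 : C) = 1.
Proof. by rewrite /cexp /= expR0 cos0 sin0 mulr0 mulr1. Qed.

Lemma cexpD (z w : C) : cexp (z + w) = cexp z * cexp w.
Proof.
case: z w => a b [c d]; apply/eqP; rewrite eq_complex /= expRD cosD sinD.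
by apply/andP; split; apply/eqP; ring.
Qed.

Lemma cexp_neq0 (z : C) : cexp z != 0.
Proof.
apply/eqP => h; have := cexpD z (- z); rewrite subrr cexp0 h mul0r => /eqP.
by rewrite oner_eq0.
Qed.

Lemma cexpN (z : C) : cexp (- z) = (cexp z)^-1.
Proof.
apply: (mulfI (cexp_neq0 z)); rewrite -cexpD subrr cexp0 mulfV//.
exact: cexp_neq0.
Qed.

Lemma cexpB (z w : C) : cexp (z - w) = cexp z / cexp w.
Proof. by rewrite cexpD cexpN. Qed.

Lemma normc_cexp (z : C) : normc (cexp z) = expR (Re z).
Proof.
apply/eqP; rewrite -(eqrXn2 (ltn0Sn 1)) ?normc_ge0 ?expR_ge0//.
rewrite normc_sqr /= !exprMn -mulrDr cos2Dsin2 mulr1//.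
Qed.

(** Here [a], [cc], [d] stand for exp x, cos y, sin y near the origin. With |a| <= 2 the four error
    terms contribute 1 + 2 + 2 + 1 = 6 times e h. *)
Lemma abs_le_prod_bound (e h x y a b cc d : R) : 0 <= e -> e <= 1 -> `|x| <= h -> `|y| <= h ->
  `|a - 1 - x| <= e * `|x| -> `|cc - 1| <= e * `|y| -> `|d - y| <= e * `|y| ->
  `|a - 1| <= e ->
  `|a * cc - 1 - x| + `|a * d - y| <= 6 * e * h.
Proof.
move=> e0 e1 xh yh h1 h2 h3 h4.
have a2 : `|a| <= 2.
  rewrite -(subrK 1 a); apply: le_trans (ler_normD _ _) _; rewrite normr1.
  by move: h4; lra.
have -> : a * cc - 1 - x = (a - 1 - x) + a * (cc - 1) by ring.
have -> : a * d - y = a * (d - y) + (a - 1) * y by ring.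
have := ler_normD (a - 1 - x) (a * (cc - 1)).
have := ler_normD (a * (d - y)) ((a - 1) * y).
rewrite !normrM.
have : `|a| * `|cc - 1| <= 2 * (e * `|y|) by apply: ler_pM.
have : `|a| * `|d - y| <= 2 * (e * `|y|) by apply: ler_pM.
have : `|a - 1| * `|y| <= e * `|y| by apply: ler_wpM2r.
have : e * `|y| <= e * h by apply: ler_wpM2l.
have : e * `|x| <= e * h by apply: ler_wpM2l.
lra.
Qed.

(** Differentiability of [cexp] at 0, from the real derivatives of exp, cos and sin; the addition
    formula carries it to every other point. *)
Lemma cexp_eps (e : R) : 0 < e -> exists2 r : R, 0 < r &
  forall h : C, normc h < r -> normc (cexp h - 1 - h) <= e * normc h.
Proof.
move=> e0; pose e1 := Num.min 1 (e / 6).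
have e10 : 0 < e1 by rewrite lt_min ltr01 divr_gt0.
have [r1 r10 H1] := is_deriveR_eps (is_derive_expR 0) e10.
have [r2 r20 H2] := is_deriveR_eps (is_derive_cos (0:R)) e10.
have [r3 r30 H3] := is_deriveR_eps (is_derive_sin (0:R)) e10.
have := @continuous_expR R 0 => /cvgrPdist_lt /(_ _ e10) /nbhs_ballP[r4 /= r40 H4].
exists (Num.min (Num.min r1 r2) (Num.min r3 r4)) => [|h]; first by rewrite !lt_min r10 r20 r30 r40.
rewrite !lt_min => /andP[/andP[h1 h2] /andP[h3 h4]].
case: h h1 h2 h3 h4 => x y; set h := Complex x y => h1 h2 h3 h4.
have xh : `|x| <= normc h by exact: (Re_le_normc h).
have yh : `|y| <= normc h by exact: (Im_le_normc h).
apply: le_trans (normc_le_Re_Im _) _.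
have -> : Re (cexp h - 1 - h) = expR x * cos y - 1 - x by [].
have -> : Im (cexp h - 1 - h) = expR x * sin y - y.
  by rewrite /= subr0.
apply: (@le_trans _ _ (6 * e1 * normc h)).
  apply: abs_le_prod_bound => //.
  - exact: ltW.
  - by rewrite /e1 ge_min lexx.
  - by have := H1 x (le_lt_trans xh h1); rewrite add0r expR0 mul1r.
  - by have := H2 y (le_lt_trans yh h2); rewrite add0r cos0 sin0 oppr0 mul0r subr0.
  - by have := H3 y (le_lt_trans yh h3); rewrite add0r cos0 sin0 mul1r subr0.
  - have := H4 x; rewrite /ball /= sub0r normrN expR0 distrC => H; apply/ltW/H.
    exact: le_lt_trans h4.
rewrite ler_wpM2r ?normc_ge0// -ler_pdivlMl// mulrC /e1.
by rewrite ge_min lexx orbT.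
Qed.

Lemma is_derive_cexp (z : C) : is_derive z 1 (@cexp R) (cexp z).
Proof.
apply/is_deriveCP.
exists (fun w => if w == z then cexp z else (cexp w - cexp z) / (w - z)); split.
- move=> w; have [->|wz] := eqVneq w z; first by rewrite !subrr mulr0.
  by rewrite divfK// subr_eq0.
- by rewrite eqxx.
move=> e e0; have N0 : 0 < normc (cexp z) by rewrite normc_gt0 cexp_neq0.
have [r r0 H] := cexp_eps (divr_gt0 (divr_gt0 e0 (ltr0Sn R 1)) N0).
apply/nbhsCP; exists r => // w wr /=; case: eqVneq => wz; first by rewrite subrr normc0.
have -> : cexp w = cexp z * cexp (w - z) by rewrite -cexpD addrC subrK.
have wz0 : w - z != 0 by rewrite subr_eq0.
have -> : (cexp z * cexp (w - z) - cexp z) / (w - z) - cexp z =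
   cexp z * (cexp (w - z) - 1 - (w - z)) / (w - z) by field.
rewrite !normcM normcV ltr_pdivrMr ?normc_gt0//.
apply: (@le_lt_trans _ _ (e / 2 * normc (w - z))).
  apply: le_trans (ler_wpM2l (ltW N0) (H _ wr)) _.
  by rewrite mulrA (mulrC (normc (cexp z))) divfK ?gt_eqF.
by rewrite ltr_pM2r ?normc_gt0// ltr_pdivrMr// ltr_pMr// ltr1n.
Qed.

Definition tpi : C := Complex 0 (2 * pi).

Lemma cexp_tpi : cexp tpi = 1.
Proof. by rewrite /cexp /= expR0 !mul1r mulr_natl cos2pi sin2pi. Qed.

Lemma cexp_tpiz (k : int) : cexp (tpi *~ k) = 1.
Proof.
have H n : cexp (tpi *+ n) = 1.
  by elim: n => [|n IH]; rewrite ?mulr0n ?cexp0// mulrS cexpD IH mulr1 cexp_tpi.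
by case: k => n; rewrite ?NegzE ?mulrNz ?cexpN -pmulrn H ?invr1.
Qed.

Lemma tpi_mulz (k : int) : tpi *~ k = Complex 0 (k%:~R * (2 * pi)).
Proof.
have H n : tpi *+ n = Complex 0 (n%:R * (2 * pi)).
  elim: n => [|n IH]; first by rewrite mulr0n mul0r.
  rewrite mulrS IH; apply/eqP; rewrite eq_complex /= addr0 eqxx /= -[n.+1%:R]natr1; apply/eqP; ring.
case: k => n; first by rewrite -pmulrn H.
by rewrite NegzE mulrNz -pmulrn H /= rmorphN /= mulNr [LHS]/GRing.opp /= oppr0.
Qed.

Lemma cexp_eq1 (s : C) : cexp s = 1 -> exists k : int, s = tpi *~ k.
Proof.
move=> h; have sx : Re s = 0.
  by have := normc_cexp s; rewrite h normc1 -expR0 => /expR_inj.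
pose k := Num.floor (Im s / (2 * pi)); exists k.
have p0 : 0 < 2 * pi :> R by rewrite mulr_gt0// pi_gt0.
pose y := Im s - k%:~R * (2 * pi).
have y02 : 0 <= y < 2 * pi.
  have /andP[h1 h2] := real_floor_itv (num_real (Im s / (2 * pi))).
  rewrite /y subr_ge0 -ler_pdivlMr// h1 /= ltrBlDr.
  by move: h2; rewrite ltr_pdivrMr// -/k intrD mulrDl mul1r addrC.
have tk := tpi_mulz k.
have ey : cexp (Complex 0 y) = 1.
  have -> : Complex 0 y = s - tpi *~ k.
    by rewrite tk; apply/eqP; rewrite eq_complex ReD ReN ImD ImN sx /= subr0 !eqxx.
  by rewrite cexpB h cexp_tpiz divr1.
have cy : cos y = 1 by have := congr1 (@complex.Re R) ey; rewrite /= expR0 mul1r.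
have y0 : y = 0.
  case/andP: y02 => ya yb.
  have [yp|yp] := leP y pi.
    by apply: cos_inj; rewrite ?in_itv /= ?ya ?lexx ?pi_ge0// cos0.
  (* Beyond pi the reflection of y to 2 pi - y leads back to [0, pi], where cos is injective. *)
  exfalso; have : 2 * pi - y = 0.
    apply: cos_inj; rewrite ?in_itv /= ?lexx ?pi_ge0//; last first.
      by rewrite cos0 cosB mulr_natl cos2pi sin2pi mul1r mul0r addr0.
    by apply/andP; split; move: ya yb yp; lra.
  by move: yb; lra.
by rewrite tk; apply/eqP; rewrite eq_complex /= sx eqxx /= -subr_eq0 -/y y0.
Qed.

Lemma cexp_inj (s t : C) : cexp s = cexp t -> exists k : int, s = t + tpi *~ k.
Proof.
move=> h; have /cexp_eq1[k e] : cexp (s - t) = 1 by rewrite cexpB h divff// cexp_neq0.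
by exists k; rewrite -e addrC subrK.
Qed.

(** The principal logarithm, correct only for Re z > 0, where [asin] recovers the argument in
    (-pi/2, pi/2). This half-plane is enough for quotients near 1 and for the sheets of the
    coverings. *)
Definition clog (z : C) : C :=
  Complex (ln (normc z)) (asin (Im z / normc z)).

Lemma clog_arg (z : C) : 0 < Re z -> -1 < Im z / normc z < 1.
Proof.
move=> z0; have N0 : 0 < normc z.
  by apply: lt_le_trans (Re_le_normc z); rewrite gtr0_norm.
rewrite ltr_pdivlMr// ltr_pdivrMr// mulN1r mul1r -ltr_norml.
rewrite -(ltr_pXn2r (ltn0Sn 1)) ?nnegrE ?normc_ge0// normc_sqr real_normK ?num_real//.
by rewrite ltrDr exprn_gt0.
Qed.

Lemma clogK (z : C) : 0 < Re z -> cexp (clog z) = z.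
Proof.
move=> z0; have /andP[a1 a2] := clog_arg z0; have N0 : 0 < normc z.
  by apply: lt_le_trans (Re_le_normc z); rewrite gtr0_norm.
rewrite /cexp /clog /= lnK// asinK ?in_itv/= ?ltW// cos_asin ?ltW//.
have -> : Num.sqrt (1 - (Im z / normc z) ^+ 2) = Re z / normc z.
  rewrite -[RHS]ger0_norm ?divr_ge0 ?ltW// -sqrtr_sqr !exprMn !exprVn; congr Num.sqrt.
  have := normc_sqr z => e; rewrite -[1](@divff _ (normc z ^+ 2)) ?sqrf_eq0 ?gt_eqF//.
  by rewrite -mulrBl e addrK.
rewrite !mulrA ![normc z * _]mulrC !mulfK ?gt_eqF//; by case: z {z0 a1 a2 N0}.
Qed.

Lemma Im_clog (z : C) : 0 < Re z -> - (pi / 2) < Im (clog z) < pi / 2.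
Proof.
move=> /clog_arg/andP[h1 h2]; rewrite /= asin_gtNpi2 ?asin_ltpi2// ?h1 ?h2 ?ltW//.
Qed.

Lemma Re_cexp_gt0 (s : C) : - (pi / 2) < Im s < pi / 2 -> 0 < Re (cexp s).
Proof. by move=> h; rewrite /= mulr_gt0 ?expR_gt0// cos_gt0_pihalf. Qed.

Lemma cexpK (s : C) : - (pi / 2) < Im s < pi / 2 -> clog (cexp s) = s.
Proof.
move=> /[dup] /andP[h1 h2] h; rewrite /clog normc_cexp expRK /= mulrC mulKf ?gt_eqF ?expR_gt0//.
by rewrite sinK ?in_itv/= ?ltW//; case: (s).
Qed.

Lemma clim_clog (z : C) : 0 < Re z -> clim (nbhs z) clog (clog z).
Proof.
move=> z0; have N0 : 0 < normc z.
  by apply: lt_le_trans (Re_le_normc z); rewrite gtr0_norm.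
apply: clim_Complex.
  apply: continuous_cvg; first exact: continuous_ln.
  exact: clim_normc (@clim_id R z).
apply: continuous_cvg; first by apply: continuous_asin; exact: clog_arg.
apply: cvgM; first exact: clim_Im (@clim_id R z).
by apply: cvgV; [rewrite gt_eqF|exact: clim_normc (@clim_id R z)].
Qed.

Lemma near_Re_gt0 (z : C) : 0 < Re z -> \forall w \near z, 0 < Re w.
Proof.
move=> z0; apply/nbhsCP; exists (Re z) => // w h.
have := le_lt_trans (Re_le_normc _) h; rewrite ReD ReN ltr_norml => /andP[h1 _].
by move: h1; lra.
Qed.

Lemma is_derive_clog (z : C) : 0 < Re z -> is_derive z 1 clog z^-1.
Proof.
move=> z0; have zn0 : z != 0 by apply: contraTneq z0 => ->; rewrite ltxx.
apply: (@is_deriveC_rinv _ (@cexp R)) => //.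
- by rewrite -{2}(clogK z0); exact: is_derive_cexp.
- by apply: filterS (near_Re_gt0 z0) => w; exact: clogK.
exact: clim_clog.
Qed.

(** Adding i pi or i pi / 2 to a logarithm multiplies by -1 or i, and these rotations reach every
    nonzero number from the right half-plane, where [clog] applies. *)
Lemma cexp_surj (z : C) : z != 0 -> exists s : C, cexp s = z.
Proof.
case: z => a b; rewrite eq_complex /= negb_and.
have H (a' b' : R) : 0 < a' -> exists s : C, cexp s = Complex a' b'.
  by move=> a0; exists (clog (Complex a' b')); rewrite clogK.
have N (a' b' : R) : (exists s : C, cexp s = Complex a' b') -> exists s : C, cexp s = Complex (- a') (- b').
  move=> [s hs]; exists (s + Complex 0 pi); rewrite cexpD hs /cexp /= expR0 cospi sinpi.
  by apply/eqP; rewrite eq_complex /=; apply/andP; split; apply/eqP; ring.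
have I (a' b' : R) : (exists s : C, cexp s = Complex a' b') -> exists s : C, cexp s = Complex (- b') a'.
  move=> [s hs]; exists (s + Complex 0 (pi / 2)); rewrite cexpD hs /cexp /= expR0 cos_pihalf sin_pihalf.
  by apply/eqP; rewrite eq_complex /=; apply/andP; split; apply/eqP; ring.
case: (ltrgtP a 0) => [a0 _|a0 _|->].
- by rewrite -(opprK a) -(opprK b); apply: N; apply: H; rewrite oppr_gt0.
- exact: H.
move=> /= b0; case: (ltrgtP b 0) b0 => [b0 _|b0 _|//].
  by rewrite -oppr0 -(opprK b); apply: N; rewrite -oppr0; apply: I; apply: H; rewrite oppr_gt0.
by rewrite -oppr0; apply: I; exact: H.
Qed.

End ComplexExp.

(** * Connectedness, compactness and the contraction principle in the plane *)

Section ComplexTopology.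
Variable R : realType.
Local Notation C := R[i].

Lemma continuousCP (T : topologicalType) (f : T -> C) (x : T) :
  {for x, continuous f} <-> clim (nbhs x) f (f x).
Proof. by split=> h; [apply/climP|apply/climP]. Qed.

Lemma segment_image_connected (g : R -> C) :
  (forall t : R, clim (nbhs t) g (g t)) -> connected (g @` `[0, 1]).
Proof.
move=> gc; apply: connected_continuous_connected; first exact: segment_connected.
by apply: continuous_subspaceT => t; apply/continuousCP.
Qed.

Lemma convex_connected (A : set C) :
  (forall x y (t : R), A x -> A y -> 0 <= t <= 1 -> A (x + t%:C%C * (y - x))) -> connected A.
Proof.
move=> H; have [->|/set0P[x0 Ax0]] := eqVneq A set0; first exact: connected0.
have -> : A = \bigcup_(y in A) ((fun t : R => x0 + t%:C%C * (y - x0)) @` `[0, 1]).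
  apply/seteqP; split=> [y Ay|y [z Az [t]]].
    exists y => //; exists 1; first by rewrite /= in_itv /= lexx ler01.
    by rewrite mul1r addrC subrK.
  by rewrite /= in_itv /= => t01 <-; exact: H.
apply: bigcup_connected.
  exists x0 => y Ay; exists 0; first by rewrite /= in_itv /= lexx ler01.
  by rewrite mul0r addr0.
move=> y Ay; apply: segment_image_connected => t; exact: clim_line.
Qed.

Lemma ball_connected (z : C) (e : R) : connected [set w | normc (w - z) < e].
Proof.
apply: convex_connected => x y t /= hx hy /andP[t0 t1].
have -> : x + t%:C%C * (y - x) - z = (1 - t)%:C%C * (x - z) + t%:C%C * (y - z).
  by rewrite rmorphB rmorph1; ring.
apply: le_lt_trans (normcD _ _) _; rewrite !normcM !normc_real ger0_norm ?subr_ge0// ger0_norm//.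
have [->|tn1] := eqVneq t 1; first by rewrite subrr mul0r add0r mul1r.
have : (1 - t) * normc (x - z) < (1 - t) * e by rewrite ltr_pM2l// subr_gt0 lt_neqAle tn1.
have : t * normc (y - z) <= t * e by rewrite ler_wpM2l// ltW.
by lra.
Qed.

Lemma connected_avoid (U : set C) (f : C -> R) (m : R) : connected U -> continuous f ->
  (forall z, U z -> f z != m) -> (forall z, U z -> f z < m) \/ (forall z, U z -> m < f z).
Proof.
move=> Uc fc fm.
have /connected_intervalP I : connected (f @` U).
  by apply: connected_continuous_connected => //; exact: continuous_subspaceT.
have [H|/existsNP[z /not_implyP[Uz /negP]]] := pselect (forall z, U z -> f z < m); first by left.
rewrite -leNgt => mz; right => w Uw; rewrite lt_neqAle eq_sym fm//= leNgt; apply/negP => wm.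
have [] := I (f w) (f z) _ _ m; first by exists w.
- by exists z.
- by rewrite (ltW wm) mz.
by move=> u Uu um; have := fm u Uu; rewrite um eqxx.
Qed.

Lemma bounded_cluster (x : nat -> C) (B : R) : (forall n, normc (x n) <= B) ->
  exists z : C, forall e : R, 0 < e -> forall N, exists2 n, (N <= n)%N & normc (x n - z) < e.
Proof.
move=> xB; pose K := `[- B, B] `*` `[- B, B] : set (R * R).
have Kc : compact K by apply: compact_setX; exact: segment_compact.
pose y n : R * R := (Re (x n), Im (x n)).
have yK : (y @ \oo) K.
  exists 0%N => //= n _; split; rewrite /= in_itv /= -ler_norml.
    exact: le_trans (Re_le_normc _) (xB n).
  exact: le_trans (Im_le_normc _) (xB n).
have [[a b] [_ cl]] := Kc (y @ \oo) _ yK.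
exists (Complex a b) => e e0 N.
have e2 : 0 < e / 2 by rewrite divr_gt0.
have h1 : (y @ \oo) (y @` [set n | (N <= n)%N]).
  by exists N => // n Nn; exists n.
have h2 : nbhs (a, b) (ball a (e / 2) `*` ball b (e / 2)).
  exists (ball a (e / 2), ball b (e / 2)) => //; split; exact: nbhsx_ballx.
have [_ [[n Nn <-] [/= ha hb]]] := cl _ _ h1 h2.
exists n => //; apply: le_lt_trans (normc_le_Re_Im _) _.
rewrite ReD ImD ReN ImN /= (splitr e) ltrD// distrC; [exact: ha|exact: hb].
Qed.

(** The orbit is bounded by a geometric sum, so it has a cluster point z. If f z differed from z,
    then for late iterates close to z the three terms |f z - f x|, |f x - x| and |x - z| would sum
    to less than |f z - z|; a quarter of that distance is a sufficient margin. *)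
Lemma contraction_fixpoint (D : set C) (f : C -> C) (x0 : C) :
  (forall z, (forall e : R, 0 < e -> exists2 x, D x & normc (x - z) < e) -> D z) ->
  (forall x, D x -> D (f x)) ->
  (forall x y, D x -> D y -> normc (f x - f y) <= 2^-1 * normc (x - y)) ->
  D x0 -> exists2 z, D z & f z = z.
Proof.
move=> Dc Df fc Dx0; pose x n := iter n f x0; pose d := normc (f x0 - x0).
have Dx n : D (x n) by elim: n => //= n; exact: Df.
have st n : normc (x n.+1 - x n) <= d * 2^-1 ^+ n.
  elim: n => [|n IH]; first by rewrite expr0 mulr1.
  rewrite exprS mulrCA; apply: (@le_trans _ _ (2^-1 * normc (x n.+1 - x n))).
    exact: (fc (x n.+1) (x n) (Dx _) (Dx _)).
  by rewrite ler_wpM2l// invr_ge0.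
have d0 : 0 <= d by exact: normc_ge0.
have sm n : normc (x n - x0) <= d * (2 - 2 * 2^-1 ^+ n).
  elim: n => [|n IH]; first by rewrite subrr normc0 expr0 mulr1 subrr mulr0.
  have -> : x n.+1 - x0 = (x n.+1 - x n) + (x n - x0) by ring.
  apply: le_trans (normcD _ _) _; apply: le_trans (lerD (st n) IH) _.
  by rewrite -mulrDr ler_wpM2l// exprS mulrA divff// mul1r; lra.
have bd n : normc (x n) <= 2 * d + normc x0.
  rewrite -(subrK x0 (x n)); apply: le_trans (normcD _ _) _; rewrite lerD2r.
  apply: le_trans (sm n) _; rewrite mulrC ler_wpM2r// gerBl.
  by rewrite mulr_ge0// exprn_ge0// invr_ge0.
have [z Hz] := bounded_cluster bd.
have Dz : D z.
  by apply: Dc => e e0; have [n _ h] := Hz e e0 0%N; exists (x n).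
exists z => //; apply/eqP; rewrite -subr_eq0 -normc_eq0; apply/negPn/negP => ne.
have p0 : 0 < normc (f z - z) by rewrite lt_def ne normc_ge0.
pose e := normc (f z - z) / 4; have e0 : 0 < e by rewrite divr_gt0.
have [N HN] : exists N, forall n, (N <= n)%N -> d * 2^-1 ^+ n < e.
  have : (d * 2^-1 ^+ n) @[n --> \oo] --> d * 0.
    apply: cvgM; first exact: cvg_cst.
    by apply: cvg_expr; rewrite ger0_norm ?invr_ge0// invf_lt1// ltr1n.
  rewrite mulr0 => /cvgrPdist_lt /(_ _ e0) [N _ h]; exists N => n /h /=.
  by rewrite sub0r normrN ger0_norm// mulr_ge0// exprn_ge0// invr_ge0.
have [n Nn hn] := Hz e e0 N.
have := HN n Nn; have := st n => h1 h2.
have : normc (f z - z) <= normc (f z - f (x n)) + normc (x n.+1 - x n) + normc (x n - z).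
  have -> : f z - z = (f z - f (x n)) + (x n.+1 - x n) + (x n - z).
    by rewrite /x /=; ring.
  by apply: le_trans (normcD _ _) _; rewrite lerD2r normcD.
have := fc z (x n) Dz (Dx n); rewrite normc_sub_sym (normc_sub_sym z).
move: hn h1 h2 p0; rewrite /e normc_sub_sym (normc_sub_sym (f (x n))); lra.
Qed.

(** The threshold is the minimum of |P| / (1 + |Q|) on the compact curve; the added 1 prevents
    division by zero and makes the final inequality strict. *)
Lemma curve_bound (P Q : {poly C}) (g : R -> C) (a b : R) : a <= b ->
  (forall t : R, clim (nbhs t) g (g t)) -> (forall t, a <= t <= b -> P.[g t] != 0) ->
  exists2 tau : R, 0 < tau & forall t, a <= t <= b -> tau * normc Q.[g t] < normc P.[g t].
Proof.
move=> ab gc gP; pose h (t : R) := normc P.[g t] / (1 + normc Q.[g t]).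
have polyc (S : {poly C}) t : clim (nbhs t) (fun t => S.[g t]) S.[g t].
  by apply: clim_comp (gc t) _; exact: is_deriveC_cvg (is_deriveC_poly _ _).
have pos t : 0 < 1 + normc Q.[g t] by rewrite ltr_pwDl// normc_ge0.
have hc : continuous h.
  move=> t; apply: cvgM; first exact: clim_normc (polyc P t).
  by apply: cvgV; rewrite ?gt_eqF//; apply: cvgD; [exact: cvg_cst|exact: clim_normc (polyc Q t)].
have [c cab Hc] := EVT_min ab (continuous_subspaceT hc).
move: cab; rewrite in_itv /= => cab.
have hc0 : 0 < h c by rewrite divr_gt0// normc_gt0 gP.
exists (h c) => // t tab; have := Hc t; rewrite in_itv /= => /(_ tab).
rewrite {2}/h ler_pdivlMr// => H; apply: lt_le_trans H.
by rewrite ltr_pM2l// ltrDr.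
Qed.

End ComplexTopology.

(** * Germs at 0 generated by polynomials, exponential tails and inverses *)

Section AnalyticGerms.
Variable R : realType.
Local Notation C := R[i].

(* [exp_rem n u] is the sum of [u^k / k!] over [k > n], and [exp_tail n u] the
   sum of [u^k / (n + k)!] over [k >= 0]. *)
Fixpoint exp_rem (n : nat) (u : C) : C :=
  if n is k.+1 then exp_rem k u - u ^+ k.+1 / (k.+1)`!%:R else cexp u - 1.

Fixpoint exp_tail (n : nat) (u : C) : C :=
  if n is k.+1 then
    if u == 0 then ((k.+1)`!%:R)^-1 else (exp_tail k u - (k`!%:R)^-1) / u
  else cexp u.

Lemma exp_tail0 n : exp_tail n 0 = (n`!%:R)^-1.
Proof. by case: n => [|n] /=; rewrite ?eqxx// cexp0 invr1. Qed.

Lemma exp_tailS n u : exp_tail n u = (n`!%:R)^-1 + u * exp_tail n.+1 u.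
Proof.
have [->|u0] := eqVneq u 0; first by rewrite exp_tail0 mul0r addr0.
by rewrite /= (negbTE u0) mulrC divfK// addrC subrK.
Qed.

Lemma factC_neq0 n : (n`!%:R : C) != 0.
Proof. by rewrite pnatr_eq0 -lt0n fact_gt0. Qed.

Lemma exp_rem_tail n u : exp_rem n u = u ^+ n.+1 * exp_tail n.+1 u.
Proof.
elim: n => [|n IH]; first by rewrite expr1 [LHS]/= -[cexp u]/(exp_tail 0 u) exp_tailS invr1 addrC addKr.
rewrite [LHS]/= IH exp_tailS mulrDr mulrA -exprSr addrC addKr//.
Qed.

Lemma is_derive_exp_rem n (u : C) :
  is_derive u 1 (exp_rem n) (if n is k.+1 then exp_rem k u else cexp u).
Proof.
elim: n u => [|n IH] u.
  have := is_deriveC_D (is_derive_cexp u) (is_deriveC_cst u (-1)).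
  by rewrite addr0.
have X k : is_derive u 1 (fun w : C => w ^+ k) (u ^+ k.-1 *+ k).
  have := is_deriveC_poly ('X^k : {poly C}) u; rewrite derivXn hornerMn hornerXn.
  by apply: is_deriveC_near; apply: nearCW => w; rewrite hornerXn.
have := is_deriveC_D (IH u) (is_deriveC_Z (- (n.+1`!%:R)^-1) (X n.+1)).
move=> H; apply: is_deriveC_eq (is_deriveC_near _ H) _.
  by apply: nearCW => w /=; rewrite mulrC mulrN mulrC.
have -> : - (n.+1`!%:R)^-1 * (u ^+ n.+1.-1 *+ n.+1) = - (u ^+ n / n`!%:R).
  rewrite mulNr; congr (- _); rewrite -[u ^+ _ *+ _]mulr_natl mulrA mulrC /=.
  by rewrite factS natrM invfM mulrAC mulVf ?mul1r// pnatr_eq0.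
by case: n {IH H} => [|n] //; rewrite expr0 divr1.
Qed.

(** Each remainder vanishes at 0 and has the preceding one as derivative, so the mean value
    inequality on [0, u] gains one power of |u| per step. The constant [expR 1] bounds |exp| on the
    unit disk. *)
Lemma exp_rem_bound n u : normc u <= 1 -> normc (exp_rem n u) <= expR 1 * normc u ^+ n.+1.
Proof.
have seg (v : C) (t : R) : 0 <= t <= 1 -> normc (0 + t%:C%C * (v - 0)) <= normc v.
  move=> /andP[t0 t1]; rewrite add0r subr0 normcM normc_real ger0_norm//.
  by rewrite ler_piMl// normc_ge0.
have z n' : exp_rem n' 0 = 0.
  by elim: n' => [|k IH] /=; rewrite ?cexp0 ?subrr// IH expr0n mul0r subrr.
elim: n u => [|n IH] u u1.
  have := @mean_value_ineq _ (exp_rem 0) (fun w => cexp w) 0 u (expR 1).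
  rewrite z !subr0 expr1; apply=> t t01; split; first exact: is_derive_exp_rem.
  rewrite normc_cexp ler_expR; apply: le_trans (ler_norm _) _.
  apply: le_trans (Re_le_normc _) _.
  have := seg u t t01; rewrite subr0 => h; exact: le_trans h u1.
have := @mean_value_ineq _ (exp_rem n.+1) (exp_rem n) 0 u (expR 1 * normc u ^+ n.+1).
rewrite z !subr0 (exprSr _ n.+1) mulrA; apply=> t t01; split.
  exact: is_derive_exp_rem.
have := seg u t t01; rewrite subr0 => h.
apply: le_trans (IH _ _) _; first exact: le_trans h u1.
by rewrite ler_wpM2l ?expR_ge0// lerXn2r ?nnegrE ?normc_ge0.
Qed.

Lemma exp_tail_cont n : clim (nbhs (0:C)) (exp_tail n) (exp_tail n 0).
Proof.
case: n => [|n]; first exact: is_deriveC_cvg (is_derive_cexp _).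
move=> e e0; apply/nbhsCP; have E0 := expR_gt0 (1 : R).
exists (Num.min 1 (e / expR 1)); first by rewrite lt_min ltr01 divr_gt0.
move=> u; rewrite subr0 lt_min => /andP[u1 ue]; rewrite /mkset.
rewrite exp_tail0 exp_tailS addrC addKr.
have [->|u0] := eqVneq u 0; first by rewrite mul0r normc0.
have N0 : 0 < normc u by rewrite normc_gt0.
(* After cancellation of |u|^(n+2) this bounds the next tail by [expR 1], and the difference to
   estimate is u times that tail. *)
have := exp_rem_bound n.+1 (ltW u1).
rewrite exp_rem_tail (normcM (u ^+ n.+2)) normcX mulrC ler_pM2r ?exprn_gt0// => H.
rewrite normcM; apply: le_lt_trans (ler_wpM2l (ltW N0) H) _.
by rewrite -ltr_pdivlMr.
Qed.

(** This equation expresses the derivative of a tail through tails, which is what closes the class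
    of germs under derivation. At 0 the slope function of a tail is the next tail; elsewhere the
    quotient rule applies by induction. *)
Lemma is_derive_exp_tail n (u : C) :
  is_derive u 1 (exp_tail n) (exp_tail n u - n%:R * exp_tail n.+1 u).
Proof.
have [->|u0] := eqVneq u 0.
  have n1 : n%:R + 1 != 0 :> C by rewrite natr1 pnatr_eq0.
  have n1' : 1 + n%:R != 0 :> C by rewrite addrC.
  apply/is_deriveCP; exists (exp_tail n.+1); split.
  - by move=> w; rewrite exp_tailS subr0 exp_tail0 addrC addKr mulrC.
  - rewrite !exp_tail0 factS natrM invfM.
    by field; rewrite factC_neq0 ?n1 ?n1'.
  have -> : exp_tail n 0 - n%:R * exp_tail n.+1 0 = exp_tail n.+1 0.
    rewrite !exp_tail0 factS natrM invfM -natr1.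
    by field; rewrite factC_neq0 ?n1 ?n1'.
  exact: exp_tail_cont.
elim: n => [|n IH]; first by rewrite mul0r subr0; exact: is_derive_cexp.
have H := is_deriveC_M (is_deriveC_D IH (is_deriveC_cst u (- (n`!%:R)^-1))) (is_deriveC_inv u0).
apply: is_deriveC_eq (is_deriveC_near _ H) _.
  by apply: filterS (clim_neq0 (@clim_id R u) u0) => w w0; rewrite /= (negbTE w0).
rewrite (exp_tailS n.+1) addr0 (exp_tailS n) (exp_tailS n.+1) factS natrM invfM.
have n1 : n%:R + 1 != 0 :> C by rewrite natr1 pnatr_eq0.
rewrite -[n.+1%:R]natr1; field.
by rewrite n1 factC_neq0 u0.
Qed.

(* A class of germs at 0 of analytic functions, closed under division by the
   variable and under derivation, which thus replaces power series. *)
Inductive germ : (C -> C) -> Prop :=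
  | germ_cst a : germ (fun=> a)
  | germ_id : germ (fun u => u)
  | germ_tail n : germ (exp_tail n)
  | germ_D f g : germ f -> germ g -> germ (fun u => f u + g u)
  | germ_M f g : germ f -> germ g -> germ (fun u => f u * g u)
  | germ_V f : germ f -> f 0 != 0 -> germ (fun u => (f u)^-1).

Lemma near0_at (P : C -> Prop) : (\forall u \near (0 : C), P u) -> P 0.
Proof. exact: nbhs_singleton. Qed.

Lemma germ_derive f : germ f ->
  exists2 g, germ g & \forall u \near (0 : C), is_derive (u : C) 1 f (g u : C).
Proof.
elim=> {f} [a||n|f1 f2 G1 [g1 H1 D1] G2 [g2 H2 D2]|f1 f2 G1 [g1 H1 D1] G2 [g2 H2 D2]|f G [g H D] f0].
- by exists (fun=> 0); [exact: germ_cst|apply: nearCW => u; exact: is_deriveC_cst].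
- by exists (fun=> 1); [exact: germ_cst|apply: nearCW => u; exact: is_deriveC_id].
- exists (fun u => exp_tail n u + (- n%:R) * exp_tail n.+1 u).
    apply: germ_D; first exact: germ_tail.
    by apply: germ_M; [exact: germ_cst|exact: germ_tail].
  by apply: nearCW => u; rewrite mulNr; exact: is_derive_exp_tail.
- exists (fun u => g1 u + g2 u); first exact: germ_D.
  by apply: filterS2 D1 D2 => u; exact: is_deriveC_D.
- exists (fun u => g1 u * f2 u + f1 u * g2 u).
    by apply: germ_D; apply: germ_M.
  by apply: filterS2 D1 D2 => u; exact: is_deriveC_M.
exists (fun u => (-1) * g u * ((f u)^-1 * (f u)^-1)).
  by apply: germ_M; apply: germ_M => //; [exact: germ_cst|exact: germ_V|exact: germ_V].
have c0 := is_deriveC_cvg (near0_at D).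
apply: filterS2 D (clim_neq0 c0 f0) => u Du fu.
by rewrite mulN1r -invfM -expr2; exact: is_deriveC_V.
Qed.

Lemma germ_cont f : germ f -> clim (nbhs (0 : C)) f (f 0).
Proof. by move=> /germ_derive[g _ /near0_at D]; exact: is_deriveC_cvg D. Qed.

Lemma germ_neq0 f : germ f -> f 0 != 0 -> \forall u \near (0 : C), f u != 0.
Proof. by move=> /germ_cont fc; exact: clim_neq0 fc. Qed.

Lemma germ_div f : germ f ->
  exists2 g, germ g & \forall u \near (0 : C), f u = f 0 + u * g u.
Proof.
elim=> {f} [a||n|f1 f2 G1 [g1 H1 D1] G2 [g2 H2 D2]|f1 f2 G1 [g1 H1 D1] G2 [g2 H2 D2]|f G [g H D] f0].
- by exists (fun=> 0); [exact: germ_cst|apply: nearCW => u; rewrite mulr0 addr0].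
- by exists (fun=> 1); [exact: germ_cst|apply: nearCW => u; rewrite mulr1 add0r].
- exists (exp_tail n.+1); first exact: germ_tail.
  by apply: nearCW => u; rewrite exp_tailS exp_tail0.
- exists (fun u => g1 u + g2 u); first exact: germ_D.
  by apply: filterS2 D1 D2 => u -> ->; ring.
- exists (fun u => g1 u * f2 u + f1 0 * g2 u).
    by apply: germ_D; apply: germ_M => //; exact: germ_cst.
  by apply: filterS2 D1 D2 => u e1 e2; rewrite {1}e1 {1 2}e2; ring.
exists (fun u => (-1) * g u * ((f u)^-1 * (f 0)^-1)).
  by apply: germ_M; apply: germ_M => //; [exact: germ_cst|exact: germ_V|exact: germ_cst].
apply: filterS2 D (germ_neq0 G f0) => u Du fu.
have -> : (f 0)^-1 + u * (-1 * g u * ((f u)^-1 * (f 0)^-1)) = (f u - u * g u) / f u / f 0.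
  by field; rewrite fu f0.
by rewrite {2}Du addrK mulrAC divff// mul1r.
Qed.

Lemma germ_taylor f n : germ f -> exists (b : nat -> C) (g : C -> C),
  germ g /\ \forall u \near (0 : C), f u = \sum_(k < n) b k * u ^+ k + u ^+ n * g u.
Proof.
move=> Gf; elim: n => [|n [b [g [Gg Hg]]]].
  by exists (fun=> 0), f; split=> //; apply: nearCW => u; rewrite big_ord0 expr0 mul1r add0r.
have [h Gh Hh] := germ_div Gg.
exists (fun k => if k == n then g 0 else b k), h; split=> //.
apply: filterS2 Hg Hh => u e1 e2; rewrite e1 e2 big_ord_recr /= eqxx mulrDr addrA exprSr mulrA.
congr (_ + _ + _); last by rewrite mulrC.
by apply: eq_bigr => k _; rewrite ltn_eqF.
Qed.

Lemma germ_X f n : germ f -> germ (fun u => f u ^+ n).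
Proof.
move=> Gf; elim: n => [|n IH]; first exact: germ_cst.
have -> : (fun u => f u ^+ n.+1) = (fun u => f u * f u ^+ n).
  by apply: funext => u; rewrite exprS.
exact: germ_M.
Qed.

Lemma germ_poly (p : {poly C}) f : germ f -> germ (fun u => p.[f u]).
Proof.
move=> Gf; elim/poly_ind: p => [|p c IH].
  have -> : (fun u => (0 : {poly C}).[f u]) = (fun=> 0) by apply: funext => u; rewrite horner0.
  exact: germ_cst.
have -> : (fun u => (p * 'X + c%:P).[f u]) = (fun u => p.[f u] * f u + c).
  by apply: funext => u; rewrite hornerD hornerM hornerX hornerC.
by apply: germ_D; [exact: germ_M|exact: germ_cst].
Qed.

Lemma germ_exp (w0 : C) : germ (fun u => w0 * cexp u).
Proof. by apply: germ_M; [exact: germ_cst|exact: (germ_tail 0)]. Qed.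

(** Since w0 exp u - w0 = w0 u [exp_tail 1 u], with a tail equal to 1 at 0, a root of order m at w0
    becomes a zero of order m in u. It is applied with u = c (z - z0) and w0 = exp (c z0). *)
Lemma germ_poly_exp (p p1 : {poly C}) (w0 : C) (m : nat) : w0 != 0 ->
  p = ('X - w0%:P) ^+ m * p1 -> p1.[w0] != 0 ->
  exists h, [/\ germ h, h 0 != 0 & forall u, p.[w0 * cexp u] = u ^+ m * h u].
Proof.
move=> w00 -> p10; exists (fun u => (w0 * exp_tail 1 u) ^+ m * p1.[w0 * cexp u]); split.
- apply: germ_M; last exact: germ_poly (germ_exp _).
  by apply: germ_X; apply: germ_M; [exact: germ_cst|exact: germ_tail].
- by rewrite exp_tail0 invr1 mulr1 cexp0 mulr1 mulf_neq0// expf_neq0.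
move=> u; rewrite hornerM horner_exp hornerXsubC mulrA -exprMn; congr (_ ^+ _ * _).
by rewrite -[cexp u]/(exp_tail 0 u) exp_tailS invr1; ring.
Qed.

Lemma near_affine (P : C -> Prop) (c z0 : C) :
  (\forall u \near (0 : C), P u) -> \forall z \near z0, P (c * (z - z0)).
Proof.
move=> /nbhsCP[e e0 H]; apply/nbhsCP; exists (e / (1 + normc c)).
  by rewrite divr_gt0// ltr_pwDl// normc_ge0.
move=> w; rewrite ltr_pdivlMr ?ltr_pwDl ?normc_ge0// => h; apply: H.
rewrite subr0 normcM; apply: le_lt_trans h; rewrite mulrC ler_wpM2l ?normc_ge0//.
by rewrite lerDr.
Qed.

Lemma is_derive_affine (f : C -> C) (c z0 z d : C) :
  is_derive (c * (z - z0)) 1 f d -> is_derive z 1 (fun w => f (c * (w - z0))) (d * c).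
Proof.
move=> h; apply: (@is_deriveC_comp _ (fun w => c * (w - z0)) f z c d _ h).
apply: is_deriveC_eq (is_deriveC_Z c (is_deriveC_D (is_deriveC_id z) (is_deriveC_cst z (- z0)))) _.
by rewrite addr0 mulr1.
Qed.

Lemma germ_affine_derivable f (c z0 : C) : germ f ->
  \forall z \near z0, derivable (fun w => f (c * (w - z0))) z 1.
Proof.
move=> /germ_derive[g _ /(near_affine c z0)]; apply: filterS => z h.
by apply/derivableC_ex; exists (g (c * (z - z0)) * c); exact: is_derive_affine.
Qed.

Lemma germ_order_at (f h : C -> C) (c z0 : C) (n : int) : c != 0 -> germ h -> h 0 != 0 ->
  (\forall z \near z0^', f z = (c * (z - z0)) ^ n * h (c * (z - z0))) -> order_at f z0 n.
Proof.
move=> c0 Gh h0 H; exists (fun z => c ^ n * h (c * (z - z0))); split.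
- have := germ_affine_derivable c z0 (germ_M (germ_cst (c ^ n)) Gh).
  by apply: filterS => z.
- by rewrite subrr mulr0 mulf_neq0// expfz_neq0.
by apply: filterS H => z ->; rewrite expfzMl mulrA [_ ^ n * c ^ n]mulrC.
Qed.

End AnalyticGerms.

(** * Zeros, poles and residues of the vector field *)

Section LocalStructure.
Variable R : realType.
Local Notation C := R[i].

Definition period_coef (T : C) : C := tpi R / T.

Lemma period_coef_neq0 (T : C) : T != 0 -> period_coef T != 0.
Proof.
move=> T0; rewrite mulf_neq0 ?invr_neq0// eq_complex /= eqxx /=.
by rewrite mulf_neq0 ?pnatr_eq0// gt_eqF// pi_gt0.
Qed.

Lemma exp_pullbackE (T : C) (F : sphere R -> sphere R) (z : C) :
  exp_pullback T F z = F (fin (cexp (period_coef T * z))).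
Proof.
have -> : period_coef T * z = (2 * pi)%:C%C * 'i%C * z / T.
  rewrite [RHS]mulrAC /period_coef; congr (_ / _ * _).
  by apply/eqP; rewrite eq_complex /=; apply/andP; split; apply/eqP; ring.
by [].
Qed.

Lemma cexp_period (T z : C) (k : int) : T != 0 ->
  cexp (period_coef T * (z + T *~ k)) = cexp (period_coef T * z).
Proof.
by move=> T0; rewrite mulrDr cexpD mulrzAr /period_coef divfK// cexp_tpiz mulr1.
Qed.

(** True at the poles as well: [chart] sends oo to 0, which is also the value of a quotient with
    zero denominator. *)
Lemma chart_ratfun (p q : {poly C}) (w : C) :
  chart (fin 0) (ratfun p q (fin w)) = p.[w] / q.[w].
Proof. by rewrite /=; case: eqVneq => //= ->; rewrite invr0 mulr0. Qed.

Lemma chart_infty_ratfun (p q : {poly C}) (w : C) :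
  chart (infty R) (ratfun p q (fin w)) = q.[w] / p.[w].
Proof. by rewrite /=; case: eqVneq => [->|_] /=; rewrite ?mul0r// invf_div. Qed.

Definition wronskian (p q : {poly C}) : {poly C} := p^`() * q - p * q^`().

Lemma deriv_eq0_size (p : {poly C}) : p^`() = 0 -> (size p <= 1)%N.
Proof.
move=> p0; rewrite leqNgt; apply/negP => sp.
have := congr1 (fun s : {poly C} => s`_(size p).-2) p0.
rewrite coef_deriv coef0 -[X in p`_X]/((size p).-2.+1).
have -> : (size p).-2.+1 = (size p).-1 by case: (size p) sp => [|[]].
move/eqP; rewrite mulrn_eq0 -[p`_ _]/(lead_coef p) lead_coef_eq0 -size_poly_eq0.
by case: (size p) sp => [|[]].
Qed.

(** If p' q = p q', coprimality makes p divide p' and q divide q'. By comparison of degrees both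
    derivatives vanish, so p and q are constant, against r >= 1. *)
Lemma wronskian_neq0 (p q : {poly C}) (r : nat) : (1 <= r)%N ->
  degree_pair r p q -> wronskian p q != 0.
Proof.
move=> r1 [pq sz]; apply/eqP => W0.
have e : p^`() * q = p * q^`() by apply/eqP; rewrite -subr_eq0 -/(wronskian p q) W0.
have H (s : {poly C}) : s %| s^`() -> (size s <= 1)%N.
  move=> d; have [->|s0] := eqVneq s 0; first by rewrite size_poly0.
  apply: deriv_eq0_size; apply/eqP/negPn/negP => s'0.
  by have := dvdp_leq s'0 d; rewrite leqNgt lt_size_deriv.
have sp : (size p <= 1)%N.
  by apply: H; rewrite -(Gauss_dvdpl _ pq) e dvdp_mulr.
have sq : (size q <= 1)%N.
  by apply: H; rewrite -(@Gauss_dvdpr _ _ p) 1?coprimep_sym// -e dvdp_mull.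
have : (maxn (size p) (size q) <= 1)%N by rewrite geq_max sp.
by rewrite sz ltnS leqn0 => /eqP r0; rewrite r0 in r1.
Qed.

Lemma root_factor (p : {poly C}) (a : C) : p != 0 ->
  exists m p1, p = ('X - a%:P) ^+ m * p1 /\ p1.[a] != 0.
Proof.
move=> p0; have [m [p1 h e]] := multiplicity_XsubC p a.
by exists m, p1; split; [rewrite mulrC|move: h; rewrite p0].
Qed.

(** Differentiating the power of order m + 1 gives the only term of order m; its coefficient -(m +
    1) p q1 does not vanish at a, the characteristic being 0. *)
Lemma wronskian_factor (p q q1 : {poly C}) (a : C) (m : nat) :
  q = ('X - a%:P) ^+ m.+1 * q1 -> p.[a] != 0 -> q1.[a] != 0 ->
  exists W1, wronskian p q = ('X - a%:P) ^+ m * W1 /\ W1.[a] != 0.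
Proof.
move=> -> pa qa.
exists (('X - a%:P) * (p^`() * q1 - p * q1^`()) - p * q1 *+ m.+1); split.
  rewrite /wronskian derivM deriv_exp derivXsubC /= mul1r exprS.
  rewrite -mulr_natr -[p * q1 *+ _]mulr_natr.
  move: ('X - a%:P) p^`() q1^`() (('X - a%:P) ^+ m) (m.+1%:R) => D p' q1' Dm N.
  by ring.
rewrite !hornerE /= subrr mul0r sub0r oppr_eq0 hornerMn mulrn_eq0 /= hornerM.
by rewrite mulf_eq0 negb_or pa qa.
Qed.

Lemma is_derive_cexp_lin (c z : C) : is_derive z 1 (fun w => cexp (c * w)) (c * cexp (c * z)).
Proof.
have h := is_deriveC_Z c (is_deriveC_id z).
by apply: is_deriveC_eq (is_deriveC_comp h (is_derive_cexp _)) _; rewrite mulr1 mulrC.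
Qed.

Lemma is_derive_ratio (p q : {poly C}) (w : C) : q.[w] != 0 ->
  is_derive w 1 (fun x => p.[x] / q.[x]) ((wronskian p q).[w] / q.[w] ^+ 2).
Proof.
move=> qw.
apply: is_deriveC_eq (is_deriveC_M (is_deriveC_poly p w) (is_deriveC_V qw (is_deriveC_poly q w))) _.
by rewrite /wronskian hornerD hornerN !hornerM; field.
Qed.

Lemma is_derive_ratio_exp (p q : {poly C}) (c z : C) : q.[cexp (c * z)] != 0 ->
  is_derive z 1 (fun x => p.[cexp (c * x)] / q.[cexp (c * x)])
   (c * cexp (c * z) * (wronskian p q).[cexp (c * z)] / q.[cexp (c * z)] ^+ 2).
Proof.
move=> qw; have H := is_derive_ratio p qw.
apply: is_deriveC_eq (@is_deriveC_comp _ (fun x => cexp (c * x)) (fun x => p.[x] / q.[x]) z _ _ _ H) _.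
  exact: is_derive_cexp_lin.
by rewrite mulrC mulrA.
Qed.

Section Pullback.
Variables (T c : C) (p q : {poly C}) (r : nat).
Hypotheses (T0 : T != 0) (cE : c = period_coef T) (r1 : (1 <= r)%N) (pq : degree_pair r p q).
Let E z := cexp (c * z).
Let Psi := exp_pullback T (ratfun p q).
Let X := vfield Psi.
Let W := wronskian p q.

Lemma chart_pullback : (chart (fin 0) \o Psi) = (fun z => p.[E z] / q.[E z]).
Proof. by apply: funext => z; rewrite -[LHS]/(chart (fin 0) (Psi z)) /Psi exp_pullbackE -cE chart_ratfun. Qed.

Lemma time_form_pullback : time_form Psi = derive1 (fun z => p.[E z] / q.[E z] : C).
Proof. exact: (congr1 (@derive1 _ _) chart_pullback). Qed.

Lemma is_derive_chart_pullback (z : C) : q.[E z] != 0 ->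
  is_derive z 1 (chart (fin 0) \o Psi : C -> C) (c * E z * W.[E z] / q.[E z] ^+ 2).
Proof. by move=> qz; rewrite chart_pullback; exact: is_derive_ratio_exp. Qed.

Lemma time_formE (z : C) : q.[E z] != 0 ->
  time_form Psi z = c * E z * W.[E z] / q.[E z] ^+ 2.
Proof. by move=> qz; apply: is_derive1C; exact: is_derive_chart_pullback. Qed.

Lemma vfieldE (z : C) : q.[E z] != 0 -> X z = q.[E z] ^+ 2 / (c * E z * W.[E z]).
Proof. by move=> qz; rewrite /X /vfield time_formE// invf_div. Qed.

Lemma vfield_periodic (z : C) (k : int) : X (z + T *~ k) = X z.
Proof.
rewrite /X /vfield time_form_pullback /derive1.
set f := fun h => _ ; set g := fun h => _.
have -> // : f = g; apply: funext => h; rewrite /f /g /E addrA cE !cexp_period//.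
Qed.

Lemma deg_neq0 : q != 0.
Proof.
case: pq => cop sz; apply/eqP => q0; move: cop sz.
rewrite q0 coprimep0 size_poly0 maxn0 => /eqp_size -> ; rewrite size_poly1 => -[r0].
by have := r1; rewrite -r0.
Qed.

Lemma E_shift (z0 z : C) : E z = E z0 * cexp (c * (z - z0)).
Proof. by rewrite /E -cexpD -mulrDr addrC subrK. Qed.

Lemma E_neq0 z : E z != 0. Proof. exact: cexp_neq0. Qed.

Lemma c_neq0 : c != 0. Proof. by rewrite cE; exact: period_coef_neq0. Qed.

Lemma near_affine_punctured (P : C -> Prop) (z0 : C) :
  (\forall u \near (0 : C), P u) -> \forall z \near z0^', P (c * (z - z0)).
Proof. by move=> /(near_affine c z0); apply: filterS. Qed.

Lemma order_vfield (z0 : C) (q1 W1 : {poly C}) (m l : nat) :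
  q = ('X - (E z0)%:P) ^+ m * q1 -> q1.[E z0] != 0 ->
  W = ('X - (E z0)%:P) ^+ l * W1 -> W1.[E z0] != 0 ->
  order_at X z0 ((m.*2)%:Z - l%:Z).
Proof.
move=> qe q10 We W10.
have [hq [Gq q0 Hq]] := germ_poly_exp (E_neq0 z0) qe q10.
have [hW [GW w0 HW]] := germ_poly_exp (E_neq0 z0) We W10.
pose h u := hq u ^+ 2 * (c * (E z0 * cexp u) * hW u)^-1.
apply: (@germ_order_at _ _ h c) => //.
- exact: c_neq0.
- apply: germ_M; first exact: germ_X.
  apply: germ_V; last first.
    by rewrite cexp0 mulr1; exact: mulf_neq0 (mulf_neq0 c_neq0 (E_neq0 z0)) w0.
  apply: germ_M => //; apply: germ_M; [exact: germ_cst|exact: germ_exp].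
- rewrite /h cexp0 mulr1 mulf_neq0 ?expf_neq0// invr_eq0.
  exact: mulf_neq0 (mulf_neq0 c_neq0 (E_neq0 z0)) w0.
have z1 := near_affine_punctured z0 (germ_neq0 Gq q0).
have z2 : \forall z \near z0^', z != z0 by apply/near_dnbhsCP; exists 1.
apply: filterS2 z1 z2 => z hz zz.
have u0 : c * (z - z0) != 0 by rewrite mulf_neq0 ?c_neq0// subr_eq0.
have qz : q.[E z] = (c * (z - z0)) ^+ m * hq (c * (z - z0)) by rewrite -Hq -E_shift.
have Wz : W.[E z] = (c * (z - z0)) ^+ l * hW (c * (z - z0)) by rewrite -HW -E_shift.
rewrite vfieldE; last by rewrite qz mulf_neq0// expf_neq0.
rewrite /h qz Wz -E_shift expfzDr// -exprnN -!exprnP -muln2 exprM.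
set u := c * (z - z0).
by rewrite !invfM exprMn !mulrA; ring.
Qed.

Lemma order_vfield_ex (z0 : C) : exists n : int, order_at X z0 n.
Proof.
have [m [q1 [qe q10]]] := root_factor (E z0) deg_neq0.
have [l [W1 [We W10]]] := root_factor (E z0) (wronskian_neq0 r1 pq).
by exists ((m.*2)%:Z - l%:Z); exact: order_vfield qe q10 We W10.
Qed.

Lemma vfield_meromorphic (z0 : C) : meromorphic_at (local_coef X (fin z0)) 0.
Proof.
have [n [h [h1 h2 h3]]] := order_vfield_ex z0.
(* The argument is z0 + u, written in the affine shape that [is_derive_affine] expects. *)
exists n, (fun u => h (1 * (u - (- z0)))); split.
  have /nbhsCP[e e0 H] := h1; apply/nbhsCP; exists e => // u; rewrite subr0 => ue.
  have /derivableC_ex[d hd] := H (1 * (u - (- z0))) ltac:(by rewrite mul1r opprK addrK).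
  by apply/derivableC_ex; exists (d * 1); exact: is_derive_affine.
have /near_dnbhsCP[e e0 H] := h3; apply/near_dnbhsCP; exists e => // u u0; rewrite !subr0 => ue.
have e1 : z0 + u - z0 = u by rewrite addrC addKr.
by rewrite /= mul1r opprK (addrC u) H ?e1// -subr_eq0 e1.
Qed.

Lemma pole_vfield (w0 : C) : w0 != 0 -> q.[w0] != 0 -> W.[w0] = 0 ->
  exists l, (0 < l)%N /\ forall z, E z = w0 -> order_at X z (- l%:Z).
Proof.
move=> w00 qw Ww; have [l [W1 [We W10]]] := root_factor w0 (wronskian_neq0 r1 pq).
exists l; split.
  rewrite lt0n; apply: contra_eq_neq Ww => l0.
  by rewrite /W We l0 expr0 mul1r.
move=> z Ez; have -> : - l%:Z = (0.*2)%:Z - l%:Z by rewrite double0 sub0r.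
by apply: (@order_vfield z q W1 0 l); rewrite ?Ez ?expr0 ?mul1r.
Qed.

(** In X = q^2 / (c E W) the square contributes 2 (m + 1) and the Wronskian takes away m, whence m +
    2 for a pole of R of order m + 1. *)
Lemma zero_vfield (w0 : C) (m : nat) (q1 : {poly C}) :
  q = ('X - w0%:P) ^+ m.+1 * q1 -> q1.[w0] != 0 ->
  forall z, E z = w0 -> order_at X z (m.+2)%:Z.
Proof.
move=> qe q10 z Ez.
have pw : p.[w0] != 0.
  apply: (@coprimep_root _ q); first by rewrite coprimep_sym; case: pq.
  by rewrite qe /root hornerM horner_exp hornerXsubC subrr exprS !mul0r.
have [W1 [We W10]] := wronskian_factor qe pw q10.
have -> : (m.+2)%:Z = (m.+1.*2)%:Z - m%:Z.
  by rewrite doubleS -addnn -addSn -addSn PoszD addrK.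
by apply: (@order_vfield z q1 W1) => //; rewrite Ez.
Qed.

(** An identity on a punctured disk holds on a full neighbourhood of each of its points, and may
    therefore be differentiated there. *)
Lemma dnbhs_near (P : C -> Prop) (z0 : C) : (\forall z \near z0^', P z) ->
  \forall z \near z0^', \forall w \near z, P w.
Proof.
move=> /near_dnbhsCP[e e0 H]; apply/near_dnbhsCP; exists e => // z zz ze.
apply/nbhsCP; exists (Num.min (normc (z - z0)) (e - normc (z - z0))).
  by rewrite lt_min normc_gt0 subr_eq0 zz subr_gt0.
move=> w; rewrite lt_min => /andP[w1 w2]; apply: H.
  by apply: contraTneq w1 => ->; rewrite -leNgt normc_sub_sym.
have -> : w - z0 = (w - z) + (z - z0) by ring.
by apply: le_lt_trans (normcD _ _) _; rewrite -ltrBrDr.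
Qed.

(** Near z0 the function Psi is a polynomial in 1/(z - z0) plus a germ. The derivative of that
    polynomial part starts at (z - z0)^-2, so no term of exponent -1 occurs. *)
Lemma time_form_residue (z0 : C) : residue_at (time_form Psi) z0 0.
Proof.
have [m [q1 [qe q10]]] := root_factor (E z0) deg_neq0.
have [hq [Gq q0 Hq]] := germ_poly_exp (E_neq0 z0) qe q10.
pose H u := p.[E z0 * cexp u] * (hq u)^-1.
have GH : germ H by apply: germ_M; [exact: germ_poly (germ_exp _)|exact: germ_V].
have [b [K [GK HK]]] := germ_taylor m GH.
have [K' GK' DK] := germ_derive GK.
(* With v = z - z0, the Taylor term b_k u^k divided by u^m = (c v)^m is (b_k / c^(m - k)) v^-(m -
   k). *)
pose P : {poly C} := \sum_(k < m) (b k / c ^+ (m - k)) *: 'X^(m - k).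
have sP : (size P <= m.+1)%N.
  apply: leq_trans (size_sum _ _ _) _; apply/bigmax_leqP => k _.
  by apply: leq_trans (size_scale_leq _ _) _; rewrite size_polyXn ltnS leq_subr.
(* The coefficient of index k belongs to v^-(k+1), and (v^-k)' = - k v^-(k+1); index 0 gives the
   residue 0. *)
exists m, (fun k => - (P`_k *+ k)), (fun z => K' (c * (z - z0)) * c); split.
- have := germ_affine_derivable c z0 (germ_M GK' (germ_cst c)).
  by apply: filterS => z.
- by rewrite mulr0n oppr0.
have z2 : \forall z \near z0^', z != z0 by apply/near_dnbhsCP; exists 1.
have F1 : \forall z \near z0^', p.[E z] / q.[E z] = P.[(z - z0)^-1] + K (c * (z - z0)).
  apply: filterS2 (near_affine_punctured z0 HK) z2 => z e zz.
  have v0 : z - z0 != 0 by rewrite subr_eq0.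
  have u0 : c * (z - z0) != 0 by rewrite mulf_neq0 ?c_neq0.
  rewrite (E_shift z0) Hq invfM mulrCA -/(H _) e mulrDr mulKf ?expf_neq0//.
  congr (_ + _); rewrite horner_sum mulr_sumr; apply: eq_bigr => k _.
  rewrite hornerZ hornerXn mulrCA -[RHS]mulrA; congr (_ * _).
  set u := c * (z - z0).
  have -> : u ^+ m = u ^+ k * u ^+ (m - k) by rewrite -exprD subnKC// ltnW.
  by rewrite invfM mulrAC mulVf ?expf_neq0// mul1r exprMn invfM exprVn.
apply: filterS3 (dnbhs_near F1) z2 (near_affine_punctured z0 DK) => z e zz dK.
have v0 : z - z0 != 0 by rewrite subr_eq0.
have D1 : is_derive z 1 (fun w => w - z0) (1 : C).
  by apply: is_deriveC_eq (is_deriveC_D (is_deriveC_id z) (is_deriveC_cst z (- z0))) _; rewrite addr0.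
have D2 := @is_deriveC_comp _ (fun w => (w - z0)^-1) (horner P) z _ _
  (@is_deriveC_V _ (fun w => w - z0) z _ v0 D1) (is_deriveC_poly P _).
have D3 := is_deriveC_D D2 (is_derive_affine dK).
rewrite time_form_pullback; apply: is_derive1C.
apply: is_deriveC_eq (is_deriveC_near _ D3) _.
  by apply: filterS e => w ->.
rewrite addrC; congr (_ + _).
have sP' : (size P^`() <= m)%N.
  have [->|P0] := eqVneq P 0; first by rewrite linear0 size_poly0.
  by rewrite -ltnS; apply: leq_trans sP; exact: lt_size_deriv.
rewrite big_ord_recl mulr0n oppr0 mul0r add0r (horner_coef_wide _ sP') mulr_suml.
apply: eq_bigr => k _; rewrite coef_deriv /bump /= mulNr mulNr mulrN mul1r; congr (- _).
by rewrite -mulrA; congr (_ * _); rewrite exprVn -invfM -exprD addn2.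
Qed.

End Pullback.

Lemma accumulating_at_infty (T z0 : C) (S : set C) : T != 0 ->
  (forall n : nat, S (z0 + T *~ n%:Z)) -> infinitely_many_accumulating_at S (infty R).
Proof.
move=> T0 H.
have inj : injective (fun n : nat => z0 + T *~ n%:Z).
  move=> n n' /addrI /eqP; rewrite -!pmulrn -subr_eq0 -mulr_natl -[T *+ n']mulr_natl -mulrBl.
  by rewrite mulf_eq0 (negbTE T0) orbF subr_eq0 eqr_nat => /eqP.
split.
  apply: (@sub_infinite_set _ ((fun n : nat => z0 + T *~ n%:Z) @` setT)).
    by move=> _ [n _ <-].
  move=> fin; apply: infinite_nat.
  have := @finite_preimage _ _ _ (fun n : nat => z0 + T *~ n%:Z) _ fin.
  move=> /(_ ltac:(by move=> n n' _ _; exact: inj)); apply: sub_finite_set.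
  by move=> n _; exists n.
move=> U [K [Kc Kcl] KU].
(* Neighbourhoods of oo are complements of compact sets. A compact set containing the whole orbit
   would give it a cluster point, whereas distinct points of the orbit are at least |T| apart. *)
suff [n nK] : exists n : nat, ~ K (z0 + T *~ n%:Z).
  exists (fin (z0 + T *~ n%:Z)); split => //; first by exists (z0 + T *~ n%:Z).
  by apply: KU; left; exists (z0 + T *~ n%:Z).
apply: contrapT => /forallNP HK.
have {}HK n : K (z0 + T *~ n%:Z) by apply: contrapT; exact: HK.
pose x (n : nat) := z0 + T *~ n%:Z.
have xK : (x @ \oo) K by exists 0%N => // n _; exact: HK.
have [a [_ cl]] := Kc (x @ \oo) _ xK.
have T2 : 0 < normc T / 2 by rewrite divr_gt0// normc_gt0.
have B : nbhs a [set w | normc (w - a) < normc T / 2] by apply/nbhsCP; exists (normc T / 2).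
have G N : exists2 n, (N <= n)%N & normc (x n - a) < normc T / 2.
  have h1 : (x @ \oo) (x @` [set n | (N <= n)%N]) by exists N => // n Nn; exists n.
  by have [_ [[n Nn <-] h]] := cl _ _ h1 B; exists n.
have [n _ hn] := G 0%N; have [m nm hm] := G n.+1.
have : normc (x m - x n) < normc T.
  have -> : x m - x n = (x m - a) - (x n - a) by ring.
  by apply: le_lt_trans (normcB _ _) _; rewrite (splitr (normc T)) ltrD.
rewrite /x opprD addrACA subrr add0r -!pmulrn -mulrnBr ?(ltnW nm)// -mulr_natl normcM.
rewrite -(rmorph_nat (real_complex R)) normc_real normr_nat gtr_pMl ?normc_gt0//.
have : (0 < m - n)%N by rewrite subn_gt0.
by case: (m - n)%N => // k _; rewrite ltNge ler1n.
Qed.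

End LocalStructure.

(** * The logarithmic coordinate far to the left *)

Section TractChart.
Variable R : realType.
Local Notation C := R[i].

(* [L] is a branch of the logarithm of [P / Q] at [exp (c z)] on the
   half-plane [Re (c z) < h1], and [M] inverts it over [Re s < h0]. *)
Record tract_chart (P Q : {poly C}) (c : C) (L M : C -> C) (h1 h0 : R) (m : nat) (B : R)
    : Prop := TractChart {
  tc_mult : (0 < m)%N;
  tc_den : forall z, Re (c * z) < h1 -> Q.[cexp (c * z)] != 0;
  tc_exp : forall z, Re (c * z) < h1 ->
    cexp (L z) = P.[cexp (c * z)] / Q.[cexp (c * z)];
  tc_derive : forall z, Re (c * z) < h1 ->
    exists2 d : C, is_derive z 1 L d & d != 0;
  tc_dom : forall s, Re s < h0 -> Re (c * M s) < h1;
  tc_LK : forall s, Re s < h0 -> L (M s) = s;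
  tc_MK : forall z, Re (c * z) < h1 -> Re (L z) < h0 -> M (L z) = z;
  tc_derive_inv : forall s, Re s < h0 -> exists d : C, is_derive s 1 M d;
  tc_asymp : forall z, Re (c * z) < h1 -> normc (L z - m%:R * (c * z)) <= B
}.

Lemma near0_ball (P : C -> Prop) : (\forall w \near (0 : C), P w) ->
  exists h : R, forall z, Re z < h -> P (cexp z).
Proof.
move=> /nbhsCP[e e0 H]; exists (ln e) => z hz; apply: H.
by rewrite subr0 normc_cexp -[ltRHS](lnK (x:=e)) ?ltr_expR// posrE.
Qed.

Lemma halfplane_near (s : C) (h : R) : Re s < h ->
  \forall w \near s, Re w < h.
Proof.
move=> sh; apply/nbhsCP; exists (h - Re s); first by rewrite subr_gt0.
move=> w hw; have := le_lt_trans (Re_le_normc _) hw.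
by rewrite ReD ReN ltr_norml => /andP[_]; rewrite ltrBlDr subrK.
Qed.

Lemma near_Re_gt0_clim (f : C -> C) (a z : C) : clim (nbhs z) f a -> 0 < Re a ->
  \forall w \near z, 0 < Re (f w).
Proof.
move=> fa a0; have /nbhsCP[e e0 H] := near_Re_gt0 a0.
by apply: filterS (fa e e0) => w; exact: H.
Qed.

(** Writing P / Q = a w^m G with G(0) = 1 gives L z = m c z + log a + log G(exp (c z)). The winding
    of w around 0 is absorbed by the linear term, and G stays in the right half-plane, where [clog]
    is a genuine logarithm. *)
Lemma tract_chart_exists (P Q : {poly C}) (c : C) :
  c != 0 -> P != 0 -> P.[0] = 0 -> Q.[0] != 0 ->
  exists L M h1 h0 m B, tract_chart P Q c L M h1 h0 m B.
Proof.
move=> c0 P0 Pr Q0.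
have [m [P1 [Pe P10]]] := root_factor 0 P0.
have m0 : (0 < m)%N.
  rewrite lt0n; apply: contra_eq_neq Pr => m0.
  by rewrite Pe m0 expr0 mul1r.
pose a := P1.[0] / Q.[0].
have a0 : a != 0 by rewrite mulf_neq0// invr_eq0.
have [lam hlam] := cexp_surj a0.
pose P2 := a^-1 *: P1.
pose G w := P2.[w] / Q.[w].
have G0 : G 0 = 1.
  by rewrite /G /P2 hornerZ /a; field; rewrite Q0 P10.
have Gd w : Q.[w] != 0 -> is_derive w 1 G ((wronskian P2 Q).[w] / Q.[w] ^+ 2).
  exact: is_derive_ratio.
have Gc : clim (nbhs (0:C)) G 1 by rewrite -G0; exact: is_deriveC_cvg (Gd _ Q0).
have polyc (S : {poly C}) (z : C) : clim (nbhs z) (horner S) S.[z].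
  exact: is_deriveC_cvg (is_deriveC_poly _ _).
(* This is w G' / G, so that c rho(exp (c z)) is the derivative of log G(exp (c z)). Once |rho| <
   1/2, the inequality |c| <= |m c| makes [l] Lipschitz with at most half the slope of the linear
   term. *)
pose rho w := w * ((wronskian P2 Q).[w] / Q.[w] ^+ 2 * (G w)^-1).
have rho0 : clim (nbhs (0:C)) rho 0.
  rewrite -[X in clim _ _ X](mul0r ((wronskian P2 Q).[0] * (Q.[0] * Q.[0])^-1 * (1:C)^-1)).
  apply: climM; first exact: clim_id.
  apply: climM; last by apply: climV => //; exact: oner_neq0.
  apply: climM; first exact: polyc.
  by apply: climV; [rewrite mulf_neq0|apply: climM; exact: polyc].
have Re1 : 0 < Re (1 : C) by rewrite /= ltr01.
have lc : clim (nbhs (0:C)) (fun w => clog (G w)) (clog 1).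
  exact: clim_comp Gc (clim_clog Re1).
have clog1 : clog (1 : C) = 0.
  have pi2 : 0 < pi / 2 :> R by rewrite divr_gt0// pi_gt0.
  by rewrite -(cexp0 R) cexpK//= oppr_lt0 pi2.
have [h1 H] : exists h1 : R, forall z, Re z < h1 ->
    [/\ Q.[cexp z] != 0, 0 < Re (G (cexp z)), normc (clog (G (cexp z))) < 1 &
     normc (rho (cexp z)) < 2^-1].
  apply: (@near0_ball (fun w => [/\ Q.[w] != 0, 0 < Re (G w), normc (clog (G w)) < 1 &
     normc (rho w) < 2^-1])).
  near=> w; split.
  - by near: w; exact: clim_neq0 (polyc Q 0) Q0.
  - by near: w; exact: near_Re_gt0_clim Gc Re1.
  - near: w; have := lc 1 ltr01; by apply: filterS => w; rewrite /mkset clog1 subr0.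
  - near: w; have h2 : 0 < 2^-1 :> R by rewrite invr_gt0.
    by have := rho0 _ h2; apply: filterS => w /=; rewrite subr0.
pose l z := clog (G (cexp (c * z))).
pose L z := m%:R * c * z + (lam + l z).
pose mc : C := m%:R * c.
have mc0 : mc != 0 by rewrite mulf_neq0// pnatr_eq0 -lt0n.
have N0 : 0 < normc mc by rewrite normc_gt0.
have cN : normc c <= normc mc.
  rewrite normcM ler_peMl ?normc_ge0// -(rmorph_nat (real_complex R)) normc_real.
  by rewrite normr_nat ler1n.
have ld z : Re (c * z) < h1 -> is_derive z 1 l (c * rho (cexp (c * z))).
  move=> /H[qz gz _ _].
  have D1 := @is_deriveC_comp _ (fun w => cexp (c * w)) G z _ _ (is_derive_cexp_lin c z) (Gd _ qz).
  have D2 := @is_deriveC_comp _ (fun w => G (cexp (c * w))) (@clog R) z _ _ D1 (is_derive_clog gz).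
  by apply: is_deriveC_eq D2 _; rewrite /rho; ring.
have seg z w (t : R) : Re (c * z) < h1 -> Re (c * w) < h1 -> 0 <= t <= 1 ->
    Re (c * (z + t%:C%C * (w - z))) < h1.
  move=> hz hw /andP[t0 t1].
  have -> : c * (z + t%:C%C * (w - z)) = (1 - t)%:C%C * (c * z) + t%:C%C * (c * w).
    by rewrite rmorphB rmorph1; ring.
  rewrite ReD !ReZ.
  have [->|tn1] := eqVneq t 1; first by rewrite subrr mul0r add0r mul1r.
  have : (1 - t) * Re (c * z) < (1 - t) * h1 by rewrite ltr_pM2l// subr_gt0 lt_neqAle tn1.
  have : t * Re (c * w) <= t * h1 by rewrite ler_wpM2l// ltW.
  by lra.
have lip z w : Re (c * z) < h1 -> Re (c * w) < h1 ->
    normc (l w - l z) <= 2^-1 * normc mc * normc (w - z).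
  move=> hz hw; apply: (@mean_value_ineq _ l (fun z => c * rho (cexp (c * z)))) => t t01.
  have hs := seg z w t hz hw t01; split; first exact: ld.
  have [_ _ _ /ltW h] := H _ hs; rewrite normcM mulrC.
  by apply: ler_pM => //; exact: normc_ge0.
(* This lower bound yields the injectivity of L and a Lipschitz bound for its inverse, hence the
   continuity asked for by [is_deriveC_rinv]. *)
have Llow z w : Re (c * z) < h1 -> Re (c * w) < h1 ->
    2^-1 * normc mc * normc (w - z) <= normc (L w - L z).
  move=> hz hw; have -> : L w - L z = mc * (w - z) - (l z - l w) by rewrite /L /mc; ring.
  have := normc_dist (mc * (w - z)) (l z - l w); have := lip w z hw hz.
  rewrite [normc (z - w)]normc_sub_sym normcM ler_norml => h /andP[_].
  by move: h; rewrite -mulrA; lra.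
(* Chosen so that z -> (s - lam - l z) / (m c) maps into Re (c z) <= h1 - 1, because |l| < 1. This
   smaller half-plane is closed, as the contraction principle requires. *)
pose h0 := m%:R * (h1 - 1) - normc lam - 1.
have surj s : exists z, Re s < h0 -> Re (c * z) < h1 /\ L z = s.
  have [sh|sh] := ltP (Re s) h0; last by exists 0 => //; rewrite ltNge sh.
  suff [z Dz fz] : exists2 z, Re (c * z) <= h1 - 1 & (s - lam - l z) / mc = z.
    exists z => _; split; first by apply: le_lt_trans Dz _; rewrite gtrDl oppr_lt0.
    by rewrite /L -/mc -{1}fz mulrC divfK//; ring.
  apply: (@contraction_fixpoint _ [set z | Re (c * z) <= h1 - 1] _ ((h1 - 1)%:C%C / c)).
  - move=> z Hz /=; rewrite leNgt; apply/negP => zz.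
    have e0 : 0 < (Re (c * z) - (h1 - 1)) / normc c.
      by rewrite divr_gt0 ?normc_gt0// subr_gt0.
    have [x /= hx] := Hz _ e0; rewrite ltr_pdivlMr ?normc_gt0// mulrC -normcM => h.
    have := le_lt_trans (Re_le_normc _) h.
    rewrite mulrBr ReD ReN ltr_norml => /andP[hh _]; move: hh hx; lra.
  - move=> z /= hz.
    have hz1 : Re (c * z) < h1 by apply: le_lt_trans hz _; rewrite gtrDl oppr_lt0.
    have [_ _ h _] := H _ hz1.
    have -> : c * ((s - lam - l z) / mc) = ((m%:R)^-1 : R)%:C%C * (s - lam - l z).
      rewrite /mc fmorphV rmorph_nat; field.
      by rewrite c0 pnatr_eq0 -lt0n m0.
    rewrite ReZ ler_pdivrMl ?ltr0n//; move: sh; rewrite /h0 => sh.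
    rewrite !ReD !ReN.
    have := Re_le_normc lam; have := le_lt_trans (Re_le_normc _) h.
    by rewrite ltr_norml ler_norml => /andP[g1 g2] /andP[g3 g4]; rewrite /l in g1 g2 *; lra.
  - move=> x y /= hx hy.
    have hx1 : Re (c * x) < h1 by apply: le_lt_trans hx _; rewrite gtrDl oppr_lt0.
    have hy1 : Re (c * y) < h1 by apply: le_lt_trans hy _; rewrite gtrDl oppr_lt0.
    rewrite -mulrBl normcM normcV ler_pdivrMr//.
    have -> : s - lam - l x - (s - lam - l y) = l y - l x by ring.
    by apply: le_trans (lip _ _ hx1 hy1) _; rewrite normc_sub_sym mulrAC.
  by rewrite /= mulrC divfK// lexx.
have [M HM] := choice surj.
have LM s : Re s < h0 -> L (M s) = s by move=> /HM[].
have MD s : Re s < h0 -> Re (c * M s) < h1 by move=> /HM[].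
have inj z w : Re (c * z) < h1 -> Re (c * w) < h1 -> L z = L w -> z = w.
  move=> hz hw e; apply/eqP; rewrite eq_sym -subr_eq0 -normc_eq0.
  have := Llow z w hz hw; rewrite e subrr normc0 => h.
  by rewrite eq_le normc_ge0 andbT -(pmulr_rle0 _ (_ : 0 < 2^-1 * normc mc)) // mulr_gt0 ?invr_gt0.
have Ld z : Re (c * z) < h1 -> exists2 d : C, is_derive z 1 L d & d != 0.
  move=> hz; exists (mc + c * rho (cexp (c * z))).
    have := is_deriveC_D (is_deriveC_Z mc (is_deriveC_id z)) (is_deriveC_D (is_deriveC_cst z lam) (ld z hz)).
    by rewrite mulr1 add0r.
  have [_ _ _ h] := H _ hz.
  apply/eqP => e; have : normc mc <= normc mc * 2^-1.
    rewrite -[X in normc X <= _](addrK (c * rho (cexp (c * z)))) e sub0r normcN normcM.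
    by apply: ler_pM => //; rewrite ?normc_ge0// ltW.
  by move: N0; lra.
exists L, M, h1, h0, m, (normc lam + 1); split => //.
- by move=> z /H[].
- move=> z /H[qz gz _ _]; rewrite /L !cexpD hlam /l clogK// /G /P2 hornerZ Pe hornerM.
  rewrite horner_exp hornerXsubC subr0 /a.
  have -> : cexp (m%:R * c * z) = cexp (c * z) ^+ m.
    elim: (m) => [|k IH]; first by rewrite !mul0r cexp0.
    by rewrite exprS -IH -cexpD -natr1; congr cexp; ring.
  by field; rewrite qz Q0 P10.
- by move=> z hz hl; apply: inj => //; [exact: MD|exact: LM].
- move=> s hs; have [d hd d0] := Ld _ (MD s hs); exists d^-1.
  apply: (@is_deriveC_rinv _ L) => //.
    by apply: filterS (halfplane_near hs) => w; exact: LM.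
  move=> e e0; have k0 : 0 < 2^-1 * normc mc by rewrite mulr_gt0 ?invr_gt0.
  have /nbhsCP[r r0 Hr] := halfplane_near hs.
  apply/nbhsCP; exists (Num.min r (e * (2^-1 * normc mc))); first by rewrite lt_min r0 mulr_gt0.
  move=> w; rewrite lt_min => /andP[w1 w2] /=.
  have hw := Hr _ w1; have := Llow _ _ (MD s hs) (MD w hw); rewrite !LM// => h.
  by rewrite -(ltr_pM2l k0); apply: le_lt_trans h _; rewrite mulrC.
move=> z /H[_ _ h _]; have -> : L z - m%:R * (c * z) = lam + l z by rewrite /L; ring.
by apply: le_trans (normcD _ _) _; rewrite lerD2l ltW.
Unshelve. all: by end_near.
Qed.

End TractChart.

(** * Nested components of sublevel sets of |P / Q| composed with the exponential *)

Section NestedComponents.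
Variable R : realType.
Local Notation C := R[i].

Lemma component_sub (A U : set C) : is_component A U -> U `<=` A.
Proof. by move=> [x _ ->]; exact: connected_component_sub. Qed.

Lemma component_conn (A U : set C) : is_component A U -> connected U.
Proof. by move=> [x _ ->]; exact: component_connected. Qed.

Lemma component_nonempty (A U : set C) : is_component A U -> U !=set0.
Proof. by move=> [x Ax ->]; exists x; exact: connected_component_refl. Qed.

Lemma component_absorb (A U B : set C) (x : C) :
  is_component A U -> connected B -> B `<=` A -> B x -> U x -> B `<=` U.
Proof.
move=> [y Ay ->] Bc BA Bx Ux; rewrite (same_connected_component Ux).
exact: connected_component_max.
Qed.

Lemma component_eq (A U W : set C) : is_component A U -> connected W -> W `<=` A ->
  U `<=` W -> U = W.
Proof.
move=> cU Wc WA UW; apply/seteqP; split => //.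
have [x Ux] := component_nonempty cU.
exact: component_absorb cU Wc WA (UW _ Ux) Ux.
Qed.

(** Convertible to [transcendental_singularity] when A rho is the preimage of a spherical disk; the
    abstraction lets the argument see only sublevel sets. *)
Definition nested_components (A U : R -> set C) : Prop :=
  [/\ forall rho, 0 < rho -> is_component (A rho) (U rho),
      forall rho1 rho2, 0 < rho1 -> rho1 < rho2 -> U rho1 `<=` U rho2 &
      \bigcap_(rho in [set rho | 0 < rho]) U rho = set0].

Lemma continuous_Re_lin (c : C) : continuous (fun z : C => Re (c * z)).
Proof.
by move=> z; exact: clim_Re (climM (clim_cst (F := nbhs z) c) (clim_id z)).
Qed.

Lemma continuous_Im_lin (c : C) : continuous (fun z : C => Im (c * z)).
Proof.
by move=> z; exact: clim_Im (climM (clim_cst (F := nbhs z) c) (clim_id z)).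
Qed.

Lemma poly_exp_cont (S : {poly C}) (c z : C) :
  clim (nbhs z) (fun w => S.[cexp (c * w)]) S.[cexp (c * z)].
Proof.
apply: (@clim_comp _ _ _ _ (fun w => cexp (c * w)) (horner S)).
  exact: is_deriveC_cvg (is_derive_cexp_lin _ _).
exact: is_deriveC_cvg (is_deriveC_poly _ _).
Qed.

Lemma cexp_ray (s : C) (theta : R) (k : int) :
  Im s = theta + k%:~R * (2 * pi) -> cexp s = cexp (Complex (Re s) theta).
Proof.
move=> e; have es : s = Complex (Re s) theta + tpi R *~ k.
  by apply/eqP; rewrite tpi_mulz eq_complex ReD ImD /= addr0 e !eqxx.
by rewrite {1}es cexpD cexp_tpiz mulr1.
Qed.

Lemma floor_mod (y : R) : exists k : int, k%:~R * (2 * pi) <= y < (k + 1)%:~R * (2 * pi).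
Proof.
have p0 : 0 < 2 * pi :> R by rewrite mulr_gt0// pi_gt0.
exists (Num.floor (y / (2 * pi))).
have /andP[h1 h2] := real_floor_itv (num_real (y / (2 * pi))).
by rewrite -ler_pdivlMr// h1 -ltr_pdivrMr.
Qed.

Lemma finite_roots (P : {poly C}) : P != 0 -> exists s : seq C, forall w, root P w -> w \in s.
Proof.
move=> P0; have [s e] := closed_field_poly_normal P.
exists s => w; rewrite e rootZ ?lead_coef_eq0// root_prod_XsubC//.
Qed.

(** P has finitely many roots. M0 exceeds every |ln |w||; a root 0 adds [ln 0 = 0] and is never a
    value of exp. Angles 1/(n+1) lie in (0, 1], so they are distinct modulo 2 pi, and the infinitely
    many rays with these angles cannot all meet the finite set of roots. *)
Lemma root_free_grid (P : {poly C}) : P != 0 ->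
  exists M0 theta : R, [/\ 0 < M0, (forall s : C, M0 <= `|Re s| -> P.[cexp s] != 0) &
    forall t : R, P.[cexp (Complex t theta)] != 0].
Proof.
move=> P0; have [rs Hrs] := finite_roots P0.
exists (1 + \sum_(w <- rs) `|ln (normc w)|).
suff [theta Ht] : exists theta : R, forall t : R, P.[cexp (Complex t theta)] != 0.
  exists theta; split => //; first by rewrite ltr_pwDl// sumr_ge0.
  move=> s hs; apply/negP => /Hrs /(big_rem _) /= => /(_ _ _ _ xpredT (fun w => `|ln (normc w)|)) e.
  move: hs; rewrite e normc_cexp expRK leNgt; apply/negP/negPn.
  by rewrite addrCA ltrDl ltr_pwDl// sumr_ge0.
apply: contrapT => /forallNP H.
pose th (n : nat) : R := n.+1%:R^-1.
have {H} H n : exists t : R, P.[cexp (Complex t (th n))] == 0.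
  by have /existsNP[t /negP] := H (th n); rewrite negbK; exists t.
have [g Hg] := choice H.
pose f n := cexp (Complex (g n) (th n)).
have th01 n : 0 < th n <= 1 by rewrite /th invr_gt0 ltr0n /= invf_le1 ?ltr0n// ler1n.
have finj : injective f.
  move=> n n' /cexp_inj[k /(congr1 (@complex.Im R))].
  rewrite ImD tpi_mulz /=.
  move=> e; have k0 : k = 0.
    have /andP[a1 a2] := th01 n; have /andP[b1 b2] := th01 n'.
    have pi2 := pi_ge2 R.
    have h : `|k%:~R * (2 * pi)| < 1 :> R.
      have -> : k%:~R * (2 * pi) = th n - th n' by rewrite e; ring.
      by rewrite ltr_norml; apply/andP; split; lra.
    have [//|kn] := eqVneq k 0; exfalso; move: h.
    have k1 : 1 <= `|k%:~R| :> R by rewrite -intr_norm ler1z -gtz0_ge1 normr_gt0.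
    rewrite normrM (ger0_norm (_ : 0 <= 2 * pi)); last by rewrite mulr_ge0// pi_ge0.
    by nra.
  move: e; rewrite k0 mul0r addr0 /th => /invr_inj /eqP.
  by rewrite eqr_nat eqSS => /eqP.
have fin : finite_set [set w | w \in rs] by exact: finite_seq.
apply: infinite_nat; apply: sub_finite_set (finite_preimage _ fin) => [n _ /=|].
  exact: (Hrs (f n) (Hg n)).
by move=> n n' _ _; exact: finj.
Qed.

Section Sublevel.
Variables (P Q : {poly C}) (c : C).
Hypotheses (c0 : c != 0) (P0 : P != 0) (PQ : coprimep P Q).
Let E z := cexp (c * z).

Definition sublevel (tau : R) : set C :=
  [set z | normc P.[cexp (c * z)] < tau * normc Q.[cexp (c * z)]].

Lemma sublevel_mono (t1 t2 : R) : t1 <= t2 -> sublevel t1 `<=` sublevel t2.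
Proof.
move=> t12 z; rewrite /sublevel /= => h; apply: lt_le_trans h _.
by rewrite ler_wpM2r ?normc_ge0.
Qed.

Lemma sublevel_root_ball (z : C) (tau : R) : 0 < tau -> P.[E z] = 0 ->
  exists2 e : R, 0 < e & forall w, normc (w - z) < e -> sublevel tau w.
Proof.
move=> t0 Pz; apply/nbhsCP.
have Qz : 0 < normc Q.[E z].
  by rewrite normc_gt0; apply: coprimep_root PQ _; rewrite /root Pz.
have e1 : 0 < tau * (normc Q.[E z] / 2) by rewrite mulr_gt0// divr_gt0.
have := poly_exp_cont P c z e1; have := poly_exp_cont Q c z (divr_gt0 Qz (ltr0Sn R 1)).
apply: filterS2 => w; rewrite /mkset -/(E z) -/(E w) Pz subr0 => hQ hP.
rewrite /sublevel /= -/(E w); apply: lt_le_trans hP _; rewrite ler_pM2l//.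
have := normc_dist Q.[E w] Q.[E z]; rewrite ler_norml => /andP[h _].
by move: h hQ; lra.
Qed.

Lemma sublevel_nonroot_ball (z : C) : P.[E z] != 0 ->
  exists2 tau : R, 0 < tau & exists2 e : R, 0 < e & forall w, normc (w - z) < e -> ~ sublevel tau w.
Proof.
move=> Pz; have N0 : 0 < normc P.[E z] by rewrite normc_gt0.
(* Near z, |P(E)| keeps at least half of its value and |Q(E)| gains at most 1. *)
pose tau := normc P.[E z] / 2 / (normc Q.[E z] + 1).
have q1 : 0 < normc Q.[E z] + 1 by rewrite ltr_wpDl// normc_ge0.
have t0 : 0 < tau by rewrite !divr_gt0.
exists tau => //; apply/nbhsCP.
have := poly_exp_cont P c z (divr_gt0 N0 (ltr0Sn R 1)); have := poly_exp_cont Q c z ltr01.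
apply: filterS2 => w; rewrite /mkset -/(E z) -/(E w) => hQ hP.
rewrite /sublevel /= -/(E w); apply/negP; rewrite -leNgt.
apply: (@le_trans _ _ (normc P.[E z] / 2)).
  apply: (@le_trans _ _ (tau * (normc Q.[E z] + 1))); last by rewrite /tau divfK// gt_eqF.
  rewrite ler_pM2l//.
  have := normc_dist Q.[E w] Q.[E z]; rewrite ler_norml => /andP[_ h].
  by move: h hQ; lra.
have := normc_dist P.[E w] P.[E z]; rewrite ler_norml => /andP[h _].
by move: h hP; lra.
Qed.

(* The lines [Re (c z) = +-M] and the translates by multiples of the period of a
   horizontal line on which [P] does not vanish form a grid which a connected
   subset of a small sublevel set cannot cross. *)
Lemma connected_sublevel_cases : exists2 M0 : R, 0 < M0 & forall M, M0 <= M ->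
  exists2 tau : R, 0 < tau & forall U : set C, connected U -> U `<=` sublevel tau ->
    [\/ forall z, U z -> Re (c * z) < - M,
        forall z, U z -> M < Re (c * z) |
        exists B : R, forall z, U z -> normc z <= B].
Proof.
have [M0 [theta [M00 HM Hth]]] := root_free_grid P0.
exists M0 => // M MM; have Mp : 0 < M by exact: lt_le_trans MM.
have vline (x : R) t : clim (nbhs t) (fun t : R => cexp (Complex x t)) (cexp (Complex x t)).
  apply: clim_comp; last exact: is_deriveC_cvg (is_derive_cexp _).
  by apply: clim_Complex; [exact: cvg_cst|exact: cvg_id].
have hline (y : R) t : clim (nbhs t) (fun t : R => cexp (Complex t y)) (cexp (Complex t y)).
  apply: clim_comp; last exact: is_deriveC_cvg (is_derive_cexp _).
  by apply: clim_Complex; [exact: cvg_id|exact: cvg_cst].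
have p0 : 0 <= 2 * pi :> R by rewrite mulr_ge0// pi_ge0.
have [t1 t10 H1] := @curve_bound _ P Q _ 0 (2 * pi) p0 (vline (- M))
  (fun t _ => HM (Complex (- M) t) ltac:(by rewrite /= normrN gtr0_norm)).
have [t2 t20 H2] := @curve_bound _ P Q _ 0 (2 * pi) p0 (vline M)
  (fun t _ => HM (Complex M t) ltac:(by rewrite /= gtr0_norm)).
have MNM : - M <= M by lra.
have [t3 t30 H3] := @curve_bound _ P Q _ (- M) M MNM (hline theta) (fun t _ => Hth t).
exists (Num.min (Num.min t1 t2) t3); first by rewrite !lt_min t10 t20 t30.
move=> U Uc US.
have circle (x : R) t : 0 < t ->
    (forall u, 0 <= u <= 2 * pi -> t * normc Q.[cexp (Complex x u)] < normc P.[cexp (Complex x u)]) ->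
    U `<=` sublevel t -> forall z, U z -> Re (c * z) != x.
  move=> tp Ht UT z Uz; apply/eqP => xz.
  (* The circle was bounded over one turn [0, 2 pi] only, so the imaginary part is reduced modulo 2
     pi. *)
  have [k /andP[k1 k2]] := floor_mod (Im (c * z)).
  have e : E z = cexp (Complex x (Im (c * z) - k%:~R * (2 * pi))).
    by rewrite -xz; apply: (@cexp_ray _ _ k); rewrite subrK.
  have := UT z Uz; rewrite /sublevel /= -/(E z) e ltNge => /negP; apply; apply/ltW/Ht.
  by move: k2; rewrite intrD mulrDl mul1r subr_ge0 k1 /=; lra.
have sub1 : U `<=` sublevel t1.
  by apply: subset_trans US _; apply: sublevel_mono; rewrite !ge_min lexx.
have sub2 : U `<=` sublevel t2.
  by apply: subset_trans US _; apply: sublevel_mono; rewrite !ge_min lexx orbT.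
have sub3 : U `<=` sublevel t3.
  by apply: subset_trans US _; apply: sublevel_mono; rewrite !ge_min lexx orbT.
have [L|L] := @connected_avoid R U _ (- M) Uc (@continuous_Re_lin c) (circle _ _ t10 H1 sub1).
  by constructor 1.
have [G|G] := @connected_avoid R U _ M Uc (@continuous_Re_lin c) (circle _ _ t20 H2 sub2); last first.
  by constructor 2.
constructor 3.
have ray z k : U z -> Im (c * z) != theta + k%:~R * (2 * pi).
  move=> Uz; apply/eqP => /cexp_ray e.
  have := sub3 z Uz; rewrite /sublevel /= e ltNge => /negP; apply; apply/ltW/H3.
  by rewrite (ltW (L z Uz)) (ltW (G z Uz)).
have [->|/set0P[z0 Uz0]] := eqVneq U set0; first by exists 0.
(* The integer k selects the strip between consecutive horizontal lines that contains z0; U cannot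
   leave it, and with both vertical lines it is boxed in. *)
have [k /andP[k1 k2]] := floor_mod (Im (c * z0) - theta).
have [S1|S1] := @connected_avoid R U _ _ Uc (@continuous_Im_lin c) (fun z => @ray z k).
  by exfalso; have := S1 z0 Uz0; move: k1; lra.
have [S2|S2] := @connected_avoid R U _ _ Uc (@continuous_Im_lin c) (fun z => @ray z (k + 1)); last first.
  by exfalso; have := S2 z0 Uz0; move: k2; lra.
exists ((M + (`|theta + k%:~R * (2 * pi)| + `|theta + (k + 1)%:~R * (2 * pi)|)) / normc c) => z Uz.
rewrite ler_pdivlMr ?normc_gt0// mulrC -normcM.
apply: le_trans (normc_le_Re_Im _) _; apply: lerD.
  by rewrite ler_norml (ltW (L z Uz)) (ltW (G z Uz)).
move: (S1 z Uz) (S2 z Uz); rewrite ler_norml => a1 a2.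
have := ler_norm (theta + (k + 1)%:~R * (2 * pi)).
have := ler_norm (- (theta + k%:~R * (2 * pi))); rewrite normrN.
have := normr_ge0 (theta + (k + 1)%:~R * (2 * pi)).
have := normr_ge0 (theta + k%:~R * (2 * pi)).
by move=> *; apply/andP; split; lra.
Qed.

Variable A : R -> set C.
Hypothesis Amono : forall r1 r2, r1 <= r2 -> A r1 `<=` A r2.
Hypothesis Asub : forall tau : R, 0 < tau -> exists2 rho : R, 0 < rho & A rho `<=` sublevel tau.
Hypothesis subA : forall rho : R, 0 < rho -> exists2 tau : R, 0 < tau & sublevel tau `<=` A rho.

(** Points taken in smaller and smaller members cluster at some z. If P(E) did not vanish at z,
    small sublevel sets would avoid a ball about z. So P(E) vanishes at z, and for every rho a ball
    about z lies in A(rho) and meets U(rho); hence z belongs to every member, against the empty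
    intersection. *)
Lemma nested_bounded (U : R -> set C) (rho0 B : R) :
  nested_components A U -> 0 < rho0 -> (forall z, U rho0 z -> normc z <= B) -> False.
Proof.
move=> [Uc Um U0] r0 UB.
(* The denominators start at 2 because monotonicity is available only for strictly smaller radii. *)
have rn n : 0 < rho0 / n.+2%:R by rewrite divr_gt0.
have rl n : rho0 / n.+2%:R < rho0.
  by rewrite ltr_pdivrMr// ltr_pMr// ltr1n.
have [x Hx] := choice (fun n => component_nonempty (Uc _ (rn n))).
have xB n : normc (x n) <= B by apply: UB; exact: Um (rn n) (rl n) _ (Hx n).
have [z Hz] := bounded_cluster xB.
have small (rho : R) : 0 < rho -> exists N, forall n, (N <= n)%N -> U rho (x n).
  move=> rp; exists (Num.truncn (rho0 / rho)) => n Nn.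
  apply: (Um (rho0 / n.+2%:R)) (Hx n) => //.
  rewrite ltr_pdivrMr// mulrC -ltr_pdivrMr//.
  have /andP[_ h] := truncn_itv (ltW (divr_gt0 r0 rp)).
  by apply: lt_le_trans h _; rewrite ler_nat; apply: leq_trans Nn _.
have Pz : P.[E z] = 0.
  apply/eqP/negPn/negP => /sublevel_nonroot_ball[tau t0 [e e0 H]].
  have [rho rp HA] := Asub t0; have [N HN] := small _ rp.
  have [n Nn hn] := Hz e e0 N; apply: (H _ hn); apply: HA.
  exact: component_sub (Uc _ rp) _ (HN n Nn).
suff : \bigcap_(rho in [set rho | 0 < rho]) U rho = set0 -> False by apply.
move/seteqP => [+ _]; apply => rho /= rp.
have [tau t0 HA] := subA rp; have [e e0 H] := sublevel_root_ball t0 Pz.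
have [N HN] := small _ rp; have [n Nn hn] := Hz e e0 N.
have HB : [set w | normc (w - z) < e] `<=` A rho by move=> w /H /HA.
have zB : [set w | normc (w - z) < e] z by rewrite /mkset subrr normc0.
exact: (@component_absorb _ _ [set w | normc (w - z) < e] (x n) (Uc _ rp) (@ball_connected R z e) HB hn (HN n Nn) _ zB).
Qed.

(** The bound 0 merely names a side: by [left_end_deep], a nested family on this side enters every
    half-plane Re (c z) < M for small rho. *)
Definition left_end (U : R -> set C) : Prop :=
  exists2 rho, 0 < rho & forall z, U rho z -> Re (c * z) < 0.

Definition right_end (U : R -> set C) : Prop :=
  exists2 rho, 0 < rho & forall z, U rho z -> 0 < Re (c * z).

Lemma nested_ends (U : R -> set C) : nested_components A U ->
  exists2 M0 : R, 0 < M0 & forall M, M0 <= M -> exists2 rho, 0 < rho &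
    (forall z, U rho z -> Re (c * z) < - M) \/
    (forall z, U rho z -> M < Re (c * z)).
Proof.
move=> NU; have [Uc _ _] := NU; have [M0 M00 H] := connected_sublevel_cases.
exists M0 => // M /H[tau t0 HU]; have [rho rp HA] := Asub t0.
exists rho => //.
have [] := HU (U rho) (component_conn (Uc _ rp)).
- exact: subset_trans (component_sub (Uc _ rp)) HA.
- by left.
- by right.
by move=> [B HB]; exfalso; exact: nested_bounded NU rp HB.
Qed.

Lemma left_or_right (U : R -> set C) : nested_components A U -> left_end U \/ right_end U.
Proof.
move=> /nested_ends[M0 M00 /(_ M0 (lexx _))[rho rp [h|h]]]; [left|right]; exists rho => // z /h.
  by move=> h1; apply: lt_trans h1 _; rewrite oppr_lt0.
exact: lt_trans.
Qed.

Lemma nested_meet (U : R -> set C) r1 r2 : nested_components A U -> 0 < r1 -> 0 < r2 ->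
  exists z, U r1 z /\ U r2 z.
Proof.
move=> [Uc Um _] r10 r20.
have m0 : 0 < Num.min r1 r2 / 2 by rewrite divr_gt0// lt_min r10.
have ml : Num.min r1 r2 / 2 < Num.min r1 r2.
  by rewrite ltr_pdivrMr// ltr_pMr ?ltr1n// lt_min r10.
have [z Uz] := component_nonempty (Uc _ m0).
exists z; split; apply: Um _ Uz => //; apply: lt_le_trans ml _; rewrite ge_min lexx ?orbT//.
Qed.

(** The alternative to going far left is going far right, but any two members of a nested family
    meet. *)
Lemma left_end_deep (U : R -> set C) : nested_components A U -> left_end U ->
  forall M, exists2 rho, 0 < rho & forall z, U rho z -> Re (c * z) < M.
Proof.
move=> NU [r0 r00 H0] M; have [M0 M00 H] := nested_ends NU.
have [rho rp [h|h]] := H (Num.max M0 (- M)) ltac:(by rewrite le_max lexx).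
  exists rho => // z /h h1; apply: lt_le_trans h1 _; rewrite lerNl le_max lexx orbT//.
have [z [z1 z2]] := nested_meet NU r00 rp; exfalso.
have := lt_trans (h z z2) (H0 z z1); rewrite lt_neqAle => /andP[_].
by rewrite ge_max leNgt M00.
Qed.

(** Far to the left the exponential is close to 0; if P(0) were nonzero, |P / Q| would stay above
    some tau there, and the family could not remain in the sublevel set of tau. *)
Lemma left_end_root (U : R -> set C) : nested_components A U -> left_end U -> P.[0] = 0.
Proof.
move=> NU LU; apply/eqP/negPn/negP => Pz; have [Uc _ _] := NU.
have N0 : 0 < normc P.[0] by rewrite normc_gt0.
pose tau := normc P.[0] / 2 / (normc Q.[0] + 1).
have q1 : 0 < normc Q.[0] + 1 by rewrite ltr_wpDl// normc_ge0.
have t0 : 0 < tau by rewrite !divr_gt0.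
have polyc (S : {poly C}) : clim (nbhs (0:C)) (horner S) S.[0].
  exact: is_deriveC_cvg (is_deriveC_poly _ _).
have [h Hh] : exists h : R, forall z, Re z < h ->
   tau * normc Q.[cexp z] <= normc P.[cexp z].
  apply: (@near0_ball _ (fun w => tau * normc Q.[w] <= normc P.[w])).
  have := polyc P _ (divr_gt0 N0 (ltr0Sn R 1)); have := polyc Q _ ltr01.
  apply: filterS2 => w; rewrite /mkset => hQ hP.
  apply: (@le_trans _ _ (normc P.[0] / 2)).
    apply: (@le_trans _ _ (tau * (normc Q.[0] + 1))); last by rewrite /tau divfK// gt_eqF.
    rewrite ler_pM2l//.
    have := normc_dist Q.[w] Q.[0]; rewrite ler_norml => /andP[_ h].
    by move: h hQ; lra.
  have := normc_dist P.[w] P.[0]; rewrite ler_norml => /andP[h _].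
  by move: h hP; lra.
have [r1 r10 H1] := left_end_deep NU LU h.
have [r2 r20 H2] := Asub t0.
have [z [z1 z2]] := nested_meet NU r10 r20.
have := H2 _ (component_sub (Uc _ r20) z2); rewrite /sublevel /= ltNge => /negP; apply.
by apply: Hh; exact: H1.
Qed.

Lemma halfplane_connected (h : R) : connected [set z | Re (c * z) < h].
Proof.
apply: convex_connected => x y t /= hx hy /andP[t0 t1].
have -> : c * (x + t%:C%C * (y - x)) = (1 - t)%:C%C * (c * x) + t%:C%C * (c * y).
  by rewrite rmorphB rmorph1; ring.
rewrite ReD !ReZ.
have [->|tn1] := eqVneq t 1; first by rewrite subrr mul0r add0r mul1r.
have : (1 - t) * Re (c * x) < (1 - t) * h by rewrite ltr_pM2l// subr_gt0 lt_neqAle tn1.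
have : t * Re (c * y) <= t * h by rewrite ler_wpM2l// ltW.
by lra.
Qed.

Lemma halfplane_point (h : R) : Re (c * ((h - 1)%:C%C / c)) < h.
Proof. by rewrite mulrC divfK//= gtrDl oppr_lt0. Qed.

Lemma halfplane_in_sublevel (tau : R) : P.[0] = 0 -> 0 < tau ->
  exists h : R, [set z | Re (c * z) < h] `<=` sublevel tau.
Proof.
move=> Pz t0.
have Qz : 0 < normc Q.[0].
  by rewrite normc_gt0; apply: coprimep_root PQ _; rewrite /root Pz.
have polyc (S : {poly C}) : clim (nbhs (0:C)) (horner S) S.[0].
  exact: is_deriveC_cvg (is_deriveC_poly _ _).
have [h Hh] : exists h : R, forall z, Re z < h ->
   normc P.[cexp z] < tau * normc Q.[cexp z].
  apply: (@near0_ball _ (fun w => normc P.[w] < tau * normc Q.[w])).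
  have e1 : 0 < tau * (normc Q.[0] / 2) by rewrite mulr_gt0// divr_gt0.
  have := polyc P _ e1; have := polyc Q _ (divr_gt0 Qz (ltr0Sn R 1)).
  apply: filterS2 => w; rewrite /mkset Pz subr0 => hQ hP.
  apply: lt_le_trans hP _; rewrite ler_pM2l//.
  have := normc_dist Q.[w] Q.[0]; rewrite ler_norml => /andP[hh _].
  by move: hh hQ; lra.
by exists h => z /= hz; exact: Hh.
Qed.

(** U(rho) is the component containing a left half-plane inside A(rho). Two left half-planes always
    meet, whence the nesting. A set containing one is neither bounded nor far to the right, so
    [connected_sublevel_cases] pushes it left and the intersection is empty. *)
Lemma left_end_exists : P.[0] = 0 -> exists U, nested_components A U /\ left_end U.
Proof.
move=> Pz.
have Hh (rho : R) : exists h : R, 0 < rho -> [set z | Re (c * z) < h] `<=` A rho.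
  have [rp|rp] := ltP 0 rho; last by exists 0.
  have [tau t0 H] := subA rp; have [h hh] := halfplane_in_sublevel Pz t0.
  by exists h => _; exact: subset_trans hh H.
have [h hP] := choice Hh.
pose pt rho : C := (h rho - 1)%:C%C / c.
have ptP rho : Re (c * pt rho) < h rho by exact: halfplane_point.
pose U rho := connected_component (A rho) (pt rho).
have Ac rho : 0 < rho -> is_component (A rho) (U rho).
  by move=> rp; exists (pt rho) => //; apply: hP => //; exact: ptP.
have HU rho : 0 < rho -> [set z | Re (c * z) < h rho] `<=` U rho.
  move=> rp; apply: connected_component_max; [exact: ptP|exact: hP|exact: halfplane_connected].
have Um r1 r2 : 0 < r1 -> r1 < r2 -> U r1 `<=` U r2.
  move=> r10 r12; have r20 := lt_trans r10 r12.
  pose m := Num.min (h r1) (h r2); pose z : C := (m - 1)%:C%C / c.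
  have zm : Re (c * z) < m by exact: halfplane_point.
  have UA : U r1 `<=` A r2.
    by apply: subset_trans (component_sub (Ac _ r10)) _; apply: Amono; exact: ltW.
  have z1 : U r1 z by apply: HU => //=; apply: lt_le_trans zm _; rewrite ge_min lexx.
  have z2 : U r2 z by apply: HU => //=; apply: lt_le_trans zm _; rewrite ge_min lexx orbT.
  exact: component_absorb (Ac _ r20) (component_conn (Ac _ r10)) UA z1 z2.
have [M0 M00 HM] := connected_sublevel_cases.
have deep M : M0 <= M -> exists2 rho, 0 < rho & forall z, U rho z -> Re (c * z) < - M.
  move=> MM; have [tau t0 H] := HM M MM; have [rho rp HA] := Asub t0.
  exists rho => //.
  have [|//|K|[B HB]] := H (U rho) (component_conn (Ac _ rp)).
  - exact: subset_trans (component_sub (Ac _ rp)) HA.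
  - exfalso; pose m := Num.min (h rho) 0; pose z : C := (m - 1)%:C%C / c.
    have zm : Re (c * z) < m by exact: halfplane_point.
    have zh : Re (c * z) < h rho by apply: lt_le_trans zm _; rewrite ge_min lexx.
    have := K z (HU _ rp z zh).
    have : Re (c * z) < 0 by apply: lt_le_trans zm _; rewrite ge_min lexx orbT.
    by move: M00 MM; lra.
  exfalso; pose m := Num.min (h rho) (- (normc c * B)); pose z : C := (m - 1)%:C%C / c.
  have zm : Re (c * z) < m by exact: halfplane_point.
  have zh : Re (c * z) < h rho by apply: lt_le_trans zm _; rewrite ge_min lexx.
  have := HB z (HU _ rp z zh).
  rewrite -(ler_pM2l (_ : 0 < normc c)) ?normc_gt0// -normcM => h1.
  have : Re (c * z) < - (normc c * B) by apply: lt_le_trans zm _; rewrite ge_min lexx orbT.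
  by have := le_trans (Re_le_normc _) h1; rewrite ler_norml => /andP[h2 _]; rewrite ltNge h2.
exists U; split; last first.
  have [rho rp H] := deep M0 (lexx _); exists rho => // z /H h1.
  by apply: lt_trans h1 _; rewrite oppr_lt0.
split=> //; apply/seteqP; split=> // z Hz.
have [rho rp H] := deep (Num.max M0 (- Re (c * z))) ltac:(by rewrite le_max lexx).
have := H z (Hz rho rp); rewrite ltrNr => h1.
by have := lt_le_trans h1 (_ : _ <= Num.max M0 (- Re (c * z))); rewrite ltxx le_max lexx orbT => /(_ isT).
Qed.

(* Both the component and the model tract live in the far left half-plane,
   where the sublevel set is the preimage of a half-plane under the chart. *)
Lemma left_end_tract (U : R -> set C) L M h1 h0 m B (tau : R -> R) :
  tract_chart P Q c L M h1 h0 m B -> nested_components A U -> left_end U ->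
  (\forall rho \near 0^'+, 0 < tau rho /\ A rho = sublevel (tau rho)) ->
  tau rho @[rho --> 0^'+] --> 0 ->
  \forall rho \near 0^'+,
    U rho = [set z | Re (c * z) < h1 /\ Re (L z) < ln (tau rho)] /\
    ln (tau rho) < h0.
Proof.
move=> tc NU LU HA tau0; have [Uc Um _] := NU.
have [r1 r10 H1] := left_end_deep NU LU h1.
have near1 : \forall rho \near (0 : R)^'+, 0 < rho < r1.
  by near=> rho; apply/andP; split; near: rho; [exact: nbhs_right_gt|exact: nbhs_right_lt].
have near2 : \forall rho \near (0 : R)^'+, tau rho < expR h0.
  move/cvgrPdist_lt: tau0 => /(_ _ (expR_gt0 h0)); apply: filterS => rho.
  by rewrite sub0r normrN; apply: le_lt_trans; exact: ler_norm.
apply: filterS3 HA near1 near2 => rho [t0 Ar] /andP[rp rr1] th.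
have lt0 : ln (tau rho) < h0 by rewrite -ltr_expR lnK ?posrE.
split=> //; set W := [set z | _].
have WA : W `<=` A rho.
  move=> z [zh zl]; rewrite Ar /sublevel /=.
  have Qz : 0 < normc Q.[cexp (c * z)] by rewrite normc_gt0; exact: (tc_den tc).
  rewrite -ltr_pdivrMr// -normcV -normcM -(tc_exp tc zh) normc_cexp.
  by rewrite -[ltRHS]lnK ?posrE// ltr_expR.
apply: component_eq (Uc _ rp) _ WA _; last first.
  move=> z Uz; have zh : Re (c * z) < h1 by apply: H1; exact: Um rp rr1 _ Uz.
  split => //; have := component_sub (Uc _ rp) Uz; rewrite Ar /sublevel /=.
  have Qz : 0 < normc Q.[cexp (c * z)] by rewrite normc_gt0; exact: (tc_den tc).
  rewrite -ltr_pdivrMr// -normcV -normcM -(tc_exp tc zh) normc_cexp.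
  by rewrite -{1}[tau rho]lnK ?posrE// ltr_expR.
have -> : W = M @` [set s | Re (1 * s) < ln (tau rho)].
  apply/seteqP; split=> [z [zh zl]|z [s /= sl <-]].
    by exists (L z); rewrite /= ?mul1r//; apply: (tc_MK tc) => //; exact: lt_trans zl lt0.
  rewrite mul1r in sl; have sl0 := lt_trans sl lt0.
  by split; [exact: (tc_dom tc)|rewrite (tc_LK tc)].
apply: connected_continuous_connected.
  apply: convex_connected => x y t /=; rewrite !mul1r => hx hy /andP[q0 q1].
  have -> : x + t%:C%C * (y - x) = (1 - t)%:C%C * x + t%:C%C * y.
    by rewrite rmorphB rmorph1; ring.
  rewrite ReD !ReZ.
  have [->|tn1] := eqVneq t 1; first by rewrite subrr mul0r add0r mul1r.
  have : (1 - t) * Re x < (1 - t) * ln (tau rho) by rewrite ltr_pM2l// subr_gt0 lt_neqAle tn1.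
  have : t * Re y <= t * ln (tau rho) by rewrite ler_wpM2l// ltW.
  by lra.
apply: continuous_in_subspaceT => s; rewrite inE /= mul1r => sl.
have [d hd] := tc_derive_inv tc (lt_trans sl lt0).
by apply/continuousCP; exact: is_deriveC_cvg hd.
Unshelve. all: by end_near.
Qed.

End Sublevel.

End NestedComponents.

(** * Spherical disks as sublevel sets, after a rotation of the sphere *)

Section SphericalDisks.
Variable R : realType.
Local Notation C := R[i].

(* [loc_num a p q / loc_den a p q] is [p / q] followed by the rotation of the
   sphere that moves [a] to [0]. *)
Definition loc_num (a : sphere R) (p q : {poly C}) : {poly C} :=
  match a with Some x => p - x *: q | None => q end.

Definition loc_den (a : sphere R) (p q : {poly C}) : {poly C} :=
  match a with Some x => q + x^*%C *: p | None => p end.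

Lemma conj_mul_self (x : C) : x * x^*%C = (normc x ^+ 2)%:C%C.
Proof. by rewrite mulrC normc_conjM. Qed.

Lemma normc_sqrC (x : C) : (normc x ^+ 2)%:C%C = x * x^*%C.
Proof. by rewrite conj_mul_self. Qed.

(** The matrix of the rotation is a unitary matrix times sqrt (1 + |x|^2). *)
Lemma loc_norm (x u v : C) :
  normc (u - x * v) ^+ 2 + normc (v + x^*%C * u) ^+ 2 =
  (1 + normc x ^+ 2) * (normc u ^+ 2 + normc v ^+ 2).
Proof.
apply: (@complexI R).
rewrite rmorphM !rmorphD /= rmorph1 !normc_sqrC !rmorphD !rmorphN !rmorphM /= conjcK.
by ring.
Qed.

Lemma loc_horner_norm (a : sphere R) (p q : {poly C}) (w : C) :
  normc (loc_num a p q).[w] ^+ 2 + normc (loc_den a p q).[w] ^+ 2 =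
  (if a is Some x then 1 + normc x ^+ 2 else 1) * (normc p.[w] ^+ 2 + normc q.[w] ^+ 2).
Proof.
case: a => [x|] /=; last by rewrite mul1r addrC.
by rewrite !hornerE loc_norm.
Qed.

(** The rotation preserves chords and moves a to 0; homogeneous coordinates treat poles and finite
    values alike. *)
Lemma half_chord_ratfun (a : sphere R) (p q : {poly C}) (w : C) : coprimep p q ->
  half_chord a (ratfun p q (fin w)) =
  normc (loc_num a p q).[w] /
    Num.sqrt (normc (loc_num a p q).[w] ^+ 2 + normc (loc_den a p q).[w] ^+ 2).
Proof.
move=> pq; rewrite loc_horner_norm /ratfun.
have [qw|qw] := eqVneq q.[w] 0.
  have pw : 0 < normc p.[w].
    by rewrite normc_gt0; apply: coprimep_root (_ : coprimep q p) _; rewrite 1?coprimep_sym// /root qw.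
  rewrite qw normc0 expr0n addr0.
  case: a => [x|] /=; last by rewrite qw eqxx normc0 mul0r.
  have -> : Num.sqrt ((1 + normc x ^+ 2) * normc p.[w] ^+ 2) = Num.sqrt (1 + normc x ^+ 2) * normc p.[w].
    by rewrite sqrtrM ?addr_ge0 ?sqr_ge0// sqrtr_sqr ger0_norm ?normc_ge0.
  rewrite qw eqxx hornerD hornerN hornerZ qw mulr0 subr0.
  by rewrite invfM mulrC mulfVK ?gt_eqF.
have q0 : 0 < normc q.[w] by rewrite normc_gt0.
have E : normc p.[w] ^+ 2 + normc q.[w] ^+ 2 =
    normc q.[w] ^+ 2 * (1 + normc (p.[w] / q.[w]) ^+ 2).
  by rewrite normcM normcV mulrDr mulr1 -exprMn mulrCA divff ?gt_eqF// mulr1 addrC.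
case: a => [x|] /=; rewrite E (negbTE qw).
  rewrite hornerD hornerN hornerZ; have -> : p.[w] - x * q.[w] = - (x - p.[w] / q.[w]) * q.[w] by field.
  set y := p.[w] / q.[w].
  have -> : Num.sqrt ((1 + normc x ^+ 2) * (normc q.[w] ^+ 2 * (1 + normc y ^+ 2))) =
      Num.sqrt (1 + normc x ^+ 2) * Num.sqrt (1 + normc y ^+ 2) * normc q.[w].
    by rewrite mulrCA mulrC 2?sqrtrM ?mulr_ge0 ?addr_ge0 ?sqr_ge0// sqrtr_sqr ger0_norm ?normc_ge0.
  by rewrite (normcM (- _)) normcN -mulf_div divff ?mulr1// gt_eqF.
by rewrite mul1r sqrtrM ?sqr_ge0// sqrtr_sqr ger0_norm ?normc_ge0// invfM mulrA divff ?mul1r// gt_eqF.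
Qed.

Lemma spherical_dist_lt (a b : sphere R) (rho : R) : 0 < rho < pi ->
  0 <= half_chord a b <= 1 ->
  (spherical_dist a b < rho) = (half_chord a b < sin (rho / 2)).
Proof.
move=> /andP[r0 rpi] /andP[h0 h1].
have hN1 : -1 <= half_chord a b by apply: le_trans h0; rewrite lerN10.
rewrite /spherical_dist mulrC -ltr_pdivlMr//.
rewrite -[in RHS](asinK (x := half_chord a b)) ?in_itv /= ?hN1//.
rewrite ltr_sin// in_itv/= ?asin_geNpi2 ?asin_lepi2 ?hN1//.
by apply/andP; split; rewrite ltW// ?ltr_pM2r ?invr_gt0//; lra.
Qed.

Lemma tan_half_gt0 (rho : R) : 0 < rho < pi -> 0 < tan (rho / 2).
Proof.
move=> /andP[r0 rpi]; rewrite /tan divr_gt0 ?sin_gt0_pihalf ?cos_gt0_pihalf//.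
  by apply/andP; split; lra.
by apply/andP; split; have := pi_gt0 R; lra.
Qed.

(** The half chord is the sine of the angle whose tangent is |num| / |den|; a spherical radius rho
    thus becomes the threshold tan (rho / 2). *)
Lemma disk_ratfun (a : sphere R) (p q : {poly C}) (w : C) (rho : R) : coprimep p q ->
  0 < rho < pi ->
  spherical_disk a rho (ratfun p q (fin w)) <->
  normc (loc_num a p q).[w] < tan (rho / 2) * normc (loc_den a p q).[w].
Proof.
move=> pq rr; rewrite /spherical_disk /=.
set x := normc (loc_num a p q).[w]; set y := normc (loc_den a p q).[w].
have x0 : 0 <= x by exact: normc_ge0.
have y0 : 0 <= y by exact: normc_ge0.
have xy : 0 < x ^+ 2 + y ^+ 2.
  rewrite /x /y loc_horner_norm mulr_gt0//.
    by case: (a) => [b|]//; rewrite ltr_pwDl// sqr_ge0.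
  have [p0|p0] := eqVneq p.[w] 0.
    by rewrite ltr_wpDl ?sqr_ge0// exprn_gt0// normc_gt0; apply: coprimep_root pq _; rewrite /root p0.
  by rewrite ltr_pwDl ?sqr_ge0// exprn_gt0// normc_gt0.
have s0 : 0 < Num.sqrt (x ^+ 2 + y ^+ 2) by rewrite sqrtr_gt0.
have hc : half_chord a (ratfun p q (fin w)) = x / Num.sqrt (x ^+ 2 + y ^+ 2).
  exact: half_chord_ratfun.
rewrite spherical_dist_lt// hc; last first.
  apply/andP; split; first by apply: divr_ge0 => //; exact: ltW.
  by rewrite ler_pdivrMr// mul1r -[leLHS](ger0_norm x0) -sqrtr_sqr ler_wsqrtr// lerDl sqr_ge0.
case/andP: rr => r0 rpi.
have sg : 0 < sin (rho / 2) by rewrite sin_gt0_pihalf//; apply/andP; split; lra.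
have cg : 0 < cos (rho / 2) by rewrite cos_gt0_pihalf//; apply/andP; split; have := pi_gt0 R; lra.
have sc := cos2Dsin2 (rho / 2).
rewrite ltr_pdivrMr// /tan.
rewrite -(ltr_pXn2r (ltn0Sn 1)) ?nnegrE ?mulr_ge0 ?(ltW s0) ?(ltW sg)// exprMn sqr_sqrtr ?(ltW xy)//.
have -> : (x < sin (rho / 2) / cos (rho / 2) * y) = (cos (rho / 2) * x < sin (rho / 2) * y).
  by rewrite mulrAC ltr_pdivlMr// mulrC.
rewrite -(ltr_pXn2r (ltn0Sn 1) (x := cos (rho / 2) * x)) ?nnegrE ?mulr_ge0 ?(ltW cg) ?(ltW sg)//.
rewrite !exprMn; have -> : cos (rho / 2) ^+ 2 = 1 - sin (rho / 2) ^+ 2 by rewrite cos2sin2.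
by split; nra.
Qed.

Lemma spherical_disk_mono (a : sphere R) (r1 r2 : R) : r1 <= r2 ->
  spherical_disk a r1 `<=` spherical_disk a r2.
Proof. by move=> r12 b /= h; exact: lt_le_trans h r12. Qed.

(** By [loc_norm], a common root of the rotated pair is a common root of p and q. *)
Lemma loc_coprime (a : sphere R) (p q : {poly C}) : coprimep p q ->
  coprimep (loc_num a p q) (loc_den a p q).
Proof.
case: a => [x|] pq /=; last by rewrite coprimep_sym.
apply: Pdiv.ClosedField.root_coprimep => w /rootP; rewrite !hornerE => h1; apply/eqP => h2.
have := loc_norm x p.[w] q.[w]; rewrite h1 h2 normc0 expr0n addr0 => /esym/eqP.
rewrite mulf_eq0 gt_eqF ?ltr_pwDl ?sqr_ge0//= paddr_eq0 ?sqr_ge0// !sqrf_eq0 !normc_eq0.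
move=> /andP[/eqP p0 /eqP q0]; have := coprimep_root pq (_ : root p w).
by rewrite /root p0 eqxx => /(_ isT); rewrite q0 eqxx.
Qed.

Lemma loc_num_neq0 (a : sphere R) (p q : {poly C}) (r : nat) : (1 <= r)%N -> degree_pair r p q ->
  loc_num a p q != 0.
Proof.
move=> r1 [pq sz]; apply/eqP => n0.
have := loc_coprime a pq; rewrite n0 coprime0p => /eqp_size; rewrite size_poly1 => sd.
have szc (s : {poly C}) (x : C) : (size s <= 1)%N -> (size (x *: s) <= 1)%N.
  by apply: leq_trans; exact: size_scale_leq.
suff : (maxn (size p) (size q) <= 1)%N by rewrite sz ltnS leqn0 => /eqP r0; rewrite r0 in r1.
case: a n0 sd => [x|] /= n0 sd; last by rewrite n0 size_poly0 sd.
have e : p = x *: q by apply/eqP; rewrite -subr_eq0 n0.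
have qq : q + x^*%C *: p = (1 + normc x ^+ 2)%:C%C *: q.
  by rewrite e scalerA -{1}[q]scale1r -scalerDl mulrC conj_mul_self rmorphD rmorph1.
move: sd; rewrite qq size_scale; last first.
  by rewrite -normc_eq0 normc_real normr_eq0 gt_eqF// ltr_pwDl// sqr_ge0.
by move=> sq; rewrite geq_max e szc ?sq.
Qed.

Lemma loc_num_root0 (a : sphere R) (p q : {poly C}) (w : C) : coprimep p q ->
  (loc_num a p q).[w] = 0 <-> ratfun p q (fin w) = a.
Proof.
move=> pq; rewrite /ratfun; case: a => [x|] /=.
  rewrite !hornerE; case: eqVneq => [q0|q0].
    rewrite q0 mulr0 subr0; split=> // p0.
    have := coprimep_root pq (_ : root p w).
    by rewrite /root p0 eqxx q0 eqxx => /(_ isT).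
  split=> [/eqP|[<-]]; last by rewrite divfK// subrr.
  by rewrite subr_eq0 => /eqP ->; rewrite mulfK.
by case: eqVneq => [->|q0]; split=> // q0'; move: q0; rewrite q0' eqxx.
Qed.

End SphericalDisks.

(** * The exponential model of a tract as a universal covering *)

Section LogarithmicCovering.
Variable R : realType.
Local Notation C := R[i].

Lemma continuous_fin (f : C -> C) (z : C) : clim (nbhs z) f (f z) ->
  {for z, continuous (fun w => fin (f w) : sphere R)}.
Proof.
move=> /continuousCP fc; exact: (@continuous_comp _ _ _ f (@fin R)).
Qed.

Lemma continuous_from_fin (g : sphere R -> C) (b : C) :
  clim (nbhs b) (fun w => g (fin w)) (g (fin b)) -> {for (fin b), continuous g}.
Proof. by move=> h; apply/climP => e /h. Qed.

Lemma fin_open (S : set C) : open S -> open (@fin R @` S : set (sphere R)).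
Proof. exact: one_point_compactification_open_some. Qed.

Lemma halfplane_segment (x y : C) (l t : R) : Re x < l -> Re y < l ->
  0 <= t <= 1 -> Re ((1 - t)%:C%C * x + t%:C%C * y) < l.
Proof.
move=> hx hy /andP[t0 t1]; rewrite ReD !ReZ.
have [->|tn1] := eqVneq t 1; first by rewrite subrr mul0r add0r mul1r.
have : (1 - t) * Re x < (1 - t) * l by rewrite ltr_pM2l// subr_gt0 lt_neqAle tn1.
have : t * Re y <= t * l by rewrite ler_wpM2l// ltW.
by lra.
Qed.

Lemma clim_realC (T : Type) (F : set_system T) {FF : Filter F} (f : T -> R) (a : R) :
  f x @[x --> F] --> a -> clim F (fun x => (f x)%:C%C) a%:C%C.
Proof. by move=> fa; apply: clim_Complex fa _; exact: cvg_cst. Qed.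

Section Covering.
(** L identifies W with the half-plane Re s < l, with inverse M; mu identifies D with the punctured
    disk 0 < |m| < exp l, with inverse nu; between these models Psi is the exponential. *)
Variables (W : set C) (L M mu nu : C -> C) (l : R) (D : set (sphere R)) (Psi : C -> sphere R).
Hypothesis WL : forall z, W z -> Re (L z) < l /\ M (L z) = z.
Hypothesis MW : forall s, Re s < l -> W (M s) /\ L (M s) = s.
Hypothesis Lc : forall z, W z -> clim (nbhs z) L (L z).
Hypothesis Mc : forall s, Re s < l -> clim (nbhs s) M (M s).
Hypothesis nuD : forall m, 0 < normc m < expR l ->
  [/\ D (fin (nu m)), mu (nu m) = m & clim (nbhs m) nu (nu m)].
Hypothesis Dmu : forall b, D b -> exists x, [/\ b = fin x, 0 < normc (mu x) < expR l,
  nu (mu x) = x & clim (nbhs x) mu (mu x)].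
Hypothesis PsiE : forall z, W z -> Psi z = fin (nu (cexp (L z))).

Lemma cexp_range (s : C) : Re s < l -> 0 < normc (cexp s) < expR l.
Proof. by move=> sl; rewrite normc_cexp expR_gt0 ltr_expR. Qed.

(** In the coordinate L the tract is convex: paths and homotopies are straight segments there,
    carried back by M. *)
Lemma tract_simply_connected : simply_connected R W.
Proof.
have conj_cont (T : topologicalType) (A : set T) (u : T -> R) (x y : T -> C) :
    {within A, continuous u} -> {within A, continuous x} -> {within A, continuous y} ->
    (forall p, A p -> Re ((1 - u p)%:C%C * x p + (u p)%:C%C * y p) < l) ->
    {within A, continuous (fun p => M ((1 - u p)%:C%C * x p + (u p)%:C%C * y p))}.
  move=> uc xc yc H; apply/subspace_continuousP => p Ap; apply/climP.
  move/subspace_continuousP : uc => /(_ p Ap) uc.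
  move/subspace_continuousP : xc => /(_ p Ap) /climP xc.
  move/subspace_continuousP : yc => /(_ p Ap) /climP yc.
  apply: (@clim_comp _ _ _ _ _ M _ _ _ (Mc (H p Ap))).
  apply: climD; apply: climM => //; apply: clim_realC => //.
  by apply: cvgB => //; exact: cvg_cst.
split.
- by exists (M (l - 1)%:C%C); apply: (MW _).1; rewrite /= gtrDl oppr_lt0.
- move=> x y Wx Wy; have [lx Mx] := WL Wx; have [ly My] := WL Wy.
  have H (t : R) : 0 <= t <= 1 -> Re ((1 - t)%:C%C * L x + t%:C%C * L y) < l.
    exact: halfplane_segment.
  exists (fun t => M ((1 - t)%:C%C * L x + t%:C%C * L y)); split.
  + have cc := conj_cont R `[0, 1]%classic (fun t => t) (fun=> L x) (fun=> L y).
    apply: cc.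
    * by apply: continuous_subspaceT => ?; exact: cvg_id.
    * by apply: continuous_subspaceT => ?; exact: cvg_cst.
    * by apply: continuous_subspaceT => ?; exact: cvg_cst.
    * by move=> t; rewrite /= in_itv /=; exact: H.
  + by move=> t; rewrite /= in_itv /= => /H /MW[].
  + by rewrite subr0 mul1r mul0r addr0.
  + by rewrite subrr mul0r add0r mul1r.
move=> g gc gW g01.
have gW' t : 0 <= t <= 1 -> W (g t) by move=> t01; apply: gW; rewrite /= in_itv.
have lg t : 0 <= t <= 1 -> Re (L (g t)) < l by move=> /gW' /WL[].
have l0 : Re (L (g 0)) < l by apply: lg; rewrite lexx ler01.
exists (fun st => M ((1 - st.2)%:C%C * L (g st.1) + (st.2)%:C%C * L (g 0))).
have st01 (st : R * R) : (`[0, 1] `*` `[0, 1])%classic st -> 0 <= st.1 <= 1 /\ 0 <= st.2 <= 1.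
  by case: st => s t [] /=; rewrite !in_itv /=.
have H (st : R * R) : (`[0, 1] `*` `[0, 1])%classic st ->
    Re ((1 - st.2)%:C%C * L (g st.1) + (st.2)%:C%C * L (g 0)) < l.
  by move=> /st01[h1 h2]; apply: halfplane_segment => //; exact: lg.
split.
- have cc := conj_cont (R * R)%type (`[0, 1] `*` `[0, 1])%classic (fun st => st.2)
    (fun st => L (g st.1)) (fun=> L (g 0)).
  apply: cc => //.
  + by apply: continuous_subspaceT => ?; exact: cvg_snd.
  + apply/subspace_continuousP => st hst; apply/climP.
    have [h1 h2] := st01 _ hst.
    apply: (@clim_comp _ _ _ _ (fun st => g st.1) L _ _ _ (Lc (gW' _ h1))).
    apply/climP; move/subspace_continuousP : gc => /(_ st.1) gc.
    have := gc ltac:(by rewrite /= in_itv) => gcs.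
    apply: (@cvg_comp _ _ _ fst g _ _ _ _ gcs) => B HB.
    exists ([set x | `[0, 1]%classic x -> B x], setT); first by split; [exact: HB|exact: filterT].
    by move=> [a b] /= [h _] [Ia _]; exact: h.
  + by apply: continuous_subspaceT => ?; exact: cvg_cst.
- by move=> st /H /MW[].
- move=> s; rewrite in_itv /= => s01; rewrite subr0 mul1r mul0r addr0.
  by have [_ ->] := WL (gW' _ s01).
- move=> s; rewrite in_itv /= => s01; rewrite subrr mul0r add0r mul1r.
  by have [_ ->] := WL (gW' 0 ltac:(by rewrite lexx ler01)).
move=> t; rewrite in_itv /= => t01; rewrite -g01 -mulrDl -rmorphD subrK mul1r.
by have [_ ->] := WL (gW' 0 ltac:(by rewrite lexx ler01)).
Qed.

Lemma tract_psi_continuous : {within W, continuous Psi}.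
Proof.
apply: (@subspace_eq_continuous _ _ _ (fun z => fin (nu (cexp (L z)))) Psi).
  by move=> z; rewrite inE => Wz; rewrite PsiE.
apply: continuous_in_subspaceT => z; rewrite inE => Wz.
have [zl _] := WL Wz; have [_ _ nc] := nuD (cexp_range zl).
apply: (@continuous_fin (fun z => nu (cexp (L z)))).
apply: (@clim_comp _ _ _ _ (fun z => cexp (L z)) nu _ _ _ nc).
apply: (@clim_comp _ _ _ _ L (@cexp R) _ _ (Lc Wz)).
exact: is_deriveC_cvg (is_derive_cexp _).
Qed.

Lemma tract_covering : covering_map W D Psi.
Proof.
split; first exact: tract_psi_continuous.
  apply/seteqP; split=> [_ [z Wz <-]|b /Dmu[x [-> mx nx _]]].
    have [zl _] := WL Wz; rewrite PsiE//.
    by have [] := nuD (cexp_range zl).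
  case/andP: mx => m0 ml; have mx0 : mu x != 0 by rewrite -normc_gt0.
  have [s sx] := cexp_surj mx0.
  have sl : Re s < l by rewrite -ltr_expR -normc_cexp sx.
  have [WM LM] := MW sl.
  by exists (M s) => //; rewrite PsiE// LM sx nx.
move=> b0 /[dup] Db0 /Dmu[x0 [e0 /andP[m0 ml] nx0 _]].
have mx0 : mu x0 != 0 by rewrite -normc_gt0.
have [s0 sx0] := cexp_surj mx0.
(* The evenly covered set is a half-plane in the coordinate mu: there [clog] of the quotient is
   defined and supplies the inverse on every sheet. *)
pose S := [set x : C | 0 < Re (mu x / mu x0)].
have Sint x : D (fin x) -> S x -> (S°)%classic x.
  move=> /Dmu[x' [[<-] _ _ mc]] Sx.
  have h : clim (nbhs x) (fun y => mu y / mu x0) (mu x / mu x0).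
    by apply: climM mc _; exact: clim_cst.
  exact: near_Re_gt0_clim h Sx.
(* Continuity of mu is known only on D, so S need not be open; on D it agrees with its interior. *)
pose N := D `&` (@fin R @` (S°)%classic).
have NS x : N (fin x) <-> D (fin x) /\ S x.
  split=> [[Dx [y Sy [yx]]]|[Dx Sx]]; last by split => //; exists x => //; exact: Sint.
  by split => //; rewrite -yx; exact: (@interior_subset _ S _ Sy).
(* In the coordinate L the sheets are strips of height pi whose centre lines are 2 pi apart, hence
   disjoint. *)
pose V (k : int) := [set z | W z /\ - (pi / 2) < Im (L z - s0 - tpi R *~ k) < pi / 2].
exists N, (range V); split.
- by exists (@fin R @` (S°)%classic) => //; apply: fin_open; exact: open_interior.
- rewrite e0; apply/NS; rewrite -e0; split => //.
  by rewrite /S /= divff// ltr01.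
- apply/seteqP; split=> [z [Wz]|z [_ [k _ <-]] [Wz Hz]]; last first.
    split => //; rewrite /preimage /= PsiE//; have [zl _] := WL Wz.
    have [Dn mn _] := nuD (cexp_range zl); apply/NS; split => //.
    rewrite /S /= mn -sx0 -cexpB -[X in cexp X](subrK (tpi R *~ k)) cexpD cexp_tpiz mulr1.
    exact: Re_cexp_gt0.
  rewrite /preimage /= PsiE// => /NS[Dn Sn]; have [zl _] := WL Wz.
  have [_ mn _] := nuD (cexp_range zl); move: Sn; rewrite /S /= mn -sx0 -cexpB => h.
  have /cexp_inj[k ek] : cexp (L z - s0) = cexp (clog (cexp (L z - s0))) by rewrite clogK.
  by exists (V k); [exists k|split => //; rewrite ek addrK; exact: Im_clog].
- move=> _ _ [j _ <-] [k _ <-] [z [[Wz h1] [_ h2]]]; congr V.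
  have e : Im (L z - s0 - tpi R *~ j) - Im (L z - s0 - tpi R *~ k) =
      (k - j)%:~R * (2 * pi).
    rewrite -ImN -ImD; have -> : L z - s0 - tpi R *~ j - (L z - s0 - tpi R *~ k) = tpi R *~ (k - j).
      by rewrite mulrzBr; ring.
    by rewrite tpi_mulz.
  have [//|kj] := eqVneq j k; exfalso.
  have k1 : 1 <= `|(k - j)%:~R| :> R by rewrite -intr_norm ler1z -gtz0_ge1 normr_gt0 subr_eq0 eq_sym.
  have p0 := pi_gt0 R.
  have : `|(k - j)%:~R * (2 * pi)| < pi :> R.
    by rewrite -e ltr_norml; case/andP: h1 => a1 a2; case/andP: h2 => a3 a4; apply/andP; split; lra.
  by rewrite normrM (gtr0_norm (_ : 0 < 2 * pi)) ?mulr_gt0//; nra.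
move=> _ [k _ <-].
have range_s (x : C) : D (fin x) -> S x ->
    [/\ Re (clog (mu x / mu x0) + s0 + tpi R *~ k) < l,
      cexp (clog (mu x / mu x0) + s0 + tpi R *~ k) = mu x &
      nu (mu x) = x].
  move=> /Dmu[x' [[<-] /andP[_ ml'] nx _]] Sx.
  have e : cexp (clog (mu x / mu x0) + s0 + tpi R *~ k) = mu x.
    by rewrite !cexpD cexp_tpiz mulr1 sx0 clogK// divfK.
  by split => //; rewrite -ltr_expR -normc_cexp e.
split.
  pose O := [set z : C | - (pi / 2) < Im (L z - s0 - tpi R *~ k) < pi / 2].
  exists (O°)%classic; first exact: open_interior.
  apply/seteqP; split=> [z [Wz Hz]|z [Wz Oz]]; last by split => //; exact: (@interior_subset _ O _ Oz).
  split => //; have h : clim (nbhs z) (fun y => L y - s0 - tpi R *~ k) (L z - s0 - tpi R *~ k).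
    exact: climD (climD (Lc Wz) (clim_cst (F := nbhs z) (- s0))) (clim_cst (F := nbhs z) _).
  case/andP: Hz => a1 a2; set v := L z - s0 - tpi R *~ k in h a1 a2 *.
  have e0' : 0 < Num.min (Im v + pi / 2) (pi / 2 - Im v).
    by rewrite lt_min; apply/andP; split; lra.
  apply: filterS (h _ e0') => y; rewrite /mkset lt_min => /andP[b1 b2].
  have c1 := le_lt_trans (Im_le_normc _) b1; have c2 := le_lt_trans (Im_le_normc _) b2.
  move: c1 c2; rewrite ImD ImN !ltr_norml => /andP[d1 _] /andP[_ d2].
  by rewrite /O /=; apply/andP; split; lra.
exists (fun b => if b is Some x then M (clog (mu x / mu x0) + s0 + tpi R *~ k) else 0).
split.
- by apply: continuous_subspaceW tract_psi_continuous => z [].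
- apply: continuous_in_subspaceT => b; rewrite inE => -[/[dup] Db /Dmu[x [bx _ _ mc]]] [y Sy yb].
  rewrite bx in Db yb *; case: yb => yx; rewrite yx in Sy; have Sx := @interior_subset _ S _ Sy.
  apply: continuous_from_fin => /=.
  have [h1 h2 h3] := range_s x Db Sx.
  apply: (@clim_comp _ _ _ _ _ M _ _ _ (Mc h1)).
  do 2 (apply: climD; last exact: clim_cst).
  apply: (@clim_comp _ _ _ _ (fun y => mu y / mu x0) (@clog R) _ _ _ (clim_clog Sx)).
  by apply: climM mc _; exact: clim_cst.
- move=> z [Wz Hz]; rewrite PsiE//; have [zl _] := WL Wz.
  have [Dn mn _] := nuD (cexp_range zl); apply/NS; split => //.
  rewrite /S /= mn -sx0 -cexpB -[X in cexp X](subrK (tpi R *~ k)) cexpD cexp_tpiz mulr1.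
  exact: Re_cexp_gt0.
- move=> b Nb; have [/Dmu[x [bx _ _ _]] _] := Nb; rewrite bx in Nb *.
  have [Dx Sx] := (NS x).1 Nb; have [h1 h2 h3] := range_s x Dx Sx.
  have [WM LM] := MW h1; split => //; rewrite LM.
  have -> : clog (mu x / mu x0) + s0 + tpi R *~ k - s0 - tpi R *~ k = clog (mu x / mu x0) by ring.
  exact: Im_clog.
split=> [z|b]; rewrite inE.
  move=> [Wz Hz]; rewrite PsiE//; have [zl Mz] := WL Wz.
  have [_ mn _] := nuD (cexp_range zl); rewrite /fin mn -sx0 -cexpB.
  have -> : cexp (L z - s0) = cexp (L z - s0 - tpi R *~ k).
    by rewrite [in RHS]cexpB cexp_tpiz divr1.
  rewrite cexpK//; have -> : L z - s0 - tpi R *~ k + s0 + tpi R *~ k = L z by ring.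
  by [].
move=> Nb; have [/Dmu[x [bx _ _ _]] _] := Nb; rewrite bx in Nb *.
have [Dx Sx] := (NS x).1 Nb; have [h1 h2 h3] := range_s x Dx Sx.
by have [WM LM] := MW h1; rewrite /= PsiE// LM h2 h3.
Qed.

Lemma tract_universal_covering : universal_covering R W D Psi.
Proof. by split; [exact: tract_covering|exact: tract_simply_connected]. Qed.

End Covering.

End LogarithmicCovering.

(** * The singularity at the left end: value, uniqueness, covering and tract *)

Section Ends.
Variable R : realType.
Local Notation C := R[i].

Lemma ratfun_fin (p q : {poly C}) (w : C) :
  ratfun p q (fin w) = if q.[w] == 0 then infty R else fin (p.[w] / q.[w]).
Proof. by []. Qed.

Lemma near_right (P : R -> Prop) (e : R) : 0 < e -> (forall rho, 0 < rho < e -> P rho) ->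
  \forall rho \near 0^'+, P rho.
Proof.
move=> e0 H; near=> rho; apply: H; apply/andP; split; near: rho.
  exact: nbhs_right_gt.
exact: nbhs_right_lt.
Unshelve. all: by end_near.
Qed.

Lemma tan_half_cvg : tan (rho / 2) @[rho --> (0 : R)^'+] --> (0 : R).
Proof.
apply: cvg_at_right_filter; rewrite -[X in _ --> X](@tan0 R) -{2}(mul0r (2^-1 : R)).
apply: (@continuous_cvg _ _ _ _ _ (fun rho : R => rho / 2) (@tan R)).
  by apply: continuous_tan; rewrite mul0r cos0 oner_neq0.
by apply: cvgM; [exact: cvg_id|exact: cvg_cst].
Qed.

(** Re (L z) and m Re (c z) differ by at most B, so they tend to -oo together; m >= 1 lets one bound
    serve both directions. This is how two charts of the same end are compared. *)
Lemma chart_comparison (P Q : {poly C}) c L M h1 h0 m B (K : R) :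
  tract_chart P Q c L M h1 h0 m B ->
  exists K' : R, forall z, Re (c * z) < h1 ->
    (Re (L z) < K' -> Re (c * z) < K) /\
    (Re (c * z) < K' -> Re (L z) < K).
Proof.
move=> tc; have m1 : 1 <= m%:R :> R by rewrite ler1n (tc_mult tc).
have B0 z : Re (c * z) < h1 -> `|Re (L z) - m%:R * Re (c * z)| <= B.
  move=> /(tc_asymp tc) h; apply: le_trans (le_trans (Re_le_normc _) h).
  by rewrite ReD ReN -(rmorph_nat (real_complex R)) ReZ.
exists (- (m%:R * `|K|) - `|B|) => z /B0; rewrite ler_norml => /andP[b1 b2].
have KK := ler_norm K; have KN := ler_norm (- K); rewrite normrN in KN.
have BB := ler_norm B; have K0 := normr_ge0 K; have B00 := normr_ge0 B.
have mp : 0 < m%:R :> R by apply: lt_le_trans m1.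
split=> h.
  have : m%:R * Re (c * z) < m%:R * (- `|K|) by lra.
  by rewrite ltr_pM2l//; lra.
have mK : `|K| <= m%:R * `|K| by rewrite ler_peMl.
have : m%:R * Re (c * z) <= Re (c * z).
  have cn : Re (c * z) <= 0 by nra.
  by rewrite -[X in _ <= X]mul1r ler_wnM2r.
by lra.
Qed.

Lemma chart_log_derive (P Q : {poly C}) c L M h1 h0 m B (z d : C) :
  tract_chart P Q c L M h1 h0 m B -> Re (c * z) < h1 -> is_derive z 1 L d ->
  let w := cexp (c * z) in
  d * (P.[w] / Q.[w]) = c * w * (wronskian P Q).[w] / Q.[w] ^+ 2.
Proof.
move=> tc zh dL w.
have H1 := is_derive_ratio_exp P (tc_den tc zh).
have H2 := is_deriveC_comp dL (is_derive_cexp (L z)).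
have near_h : \forall y \near z, Re (c * y) < h1.
  have := (@continuous_Re_lin R c z) => /cvgr_lt; exact.
have H3 : is_derive z 1 (fun x => cexp (L x)) (c * w * (wronskian P Q).[w] / Q.[w] ^+ 2).
  by apply: is_deriveC_near H1; apply: filterS near_h => y /(tc_exp tc).
rewrite (is_deriveC_uniq H3 H2) (tc_exp tc zh); exact: mulrC.
Qed.

Section LeftEnd.
Variables (T c : C) (p q : {poly C}) (r : nat).
Hypotheses (T0 : T != 0) (cE : c = period_coef T) (r1 : (1 <= r)%N) (pq : degree_pair r p q).
Let Psi := exp_pullback T (ratfun p q).
Let X := vfield Psi.
Let A (a : sphere R) (rho : R) : set C := Psi @^-1` spherical_disk a rho.
Let cop : coprimep p q. Proof. by case: pq. Qed.
Let c0 : c != 0. Proof. exact: c_neq0 T0 cE. Qed.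

Lemma PsiE z : Psi z = ratfun p q (fin (cexp (c * z))).
Proof. by rewrite /Psi exp_pullbackE cE. Qed.

Lemma preimage_disk (a : sphere R) (rho : R) : 0 < rho < pi ->
  A a rho = sublevel (loc_num a p q) (loc_den a p q) c (tan (rho / 2)).
Proof.
move=> rr; apply/seteqP; split=> z; rewrite /A /preimage /sublevel /= PsiE.
  by move=> /(disk_ratfun a _ cop rr).
by move=> h; apply/(disk_ratfun a _ cop rr).
Qed.

Lemma preimage_disk_mono (a : sphere R) (s t : R) : s <= t -> A a s `<=` A a t.
Proof. by move=> st z; exact: spherical_disk_mono. Qed.

Lemma preimage_disk_near (a : sphere R) : \forall rho \near 0^'+, 0 < tan (rho / 2) /\
  A a rho = sublevel (loc_num a p q) (loc_den a p q) c (tan (rho / 2)).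
Proof.
apply: (near_right (pi_gt0 R)) => rho rr; split; first exact: tan_half_gt0.
exact: preimage_disk.
Qed.

Lemma preimage_disk_small (a : sphere R) (tau : R) : 0 < tau ->
  exists2 rho : R, 0 < rho & A a rho `<=` sublevel (loc_num a p q) (loc_den a p q) c tau.
Proof.
move=> t0; have p2 : 0 < 2 :> R by [].
have a0 : 0 < atan tau.
  rewrite ltNge; apply/negP => h; have : tan (atan tau) <= 0.
    rewrite /tan pmulr_lle0 ?invr_gt0 ?cos_gt0_pihalf ?atan_gtNpi2 ?atan_ltpi2//.
    by rewrite -oppr_ge0 -sinN sin_ge0_pi// oppr_ge0 h /= lerNl; have := atan_gtNpi2 tau; have := pi_gt0 R; lra.
  by rewrite atanK leNgt t0.
exists (2 * atan tau); first by rewrite mulr_gt0.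
rewrite preimage_disk; last first.
  by rewrite mulr_gt0//=; have := atan_ltpi2 tau; lra.
have -> : 2 * atan tau / 2 = atan tau by field.
by rewrite atanK.
Qed.

Lemma sublevel_preimage_disk (a : sphere R) (rho : R) : 0 < rho ->
  exists2 tau : R, 0 < tau & sublevel (loc_num a p q) (loc_den a p q) c tau `<=` A a rho.
Proof.
move=> rp; pose s := Num.min rho 1.
have s0 : 0 < s < pi.
  rewrite lt_min rp ltr01 /=; apply: le_lt_trans (_ : 1 < pi); first by rewrite ge_min lexx orbT.
  by have := pi_ge2 R; lra.
exists (tan (s / 2)); first exact: tan_half_gt0.
by rewrite -preimage_disk//; apply: preimage_disk_mono; rewrite ge_min lexx.
Qed.

Lemma num_neq0 (a : sphere R) : loc_num a p q != 0.
Proof. exact: loc_num_neq0 r1 pq. Qed.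

Lemma num_den_coprime (a : sphere R) : coprimep (loc_num a p q) (loc_den a p q).
Proof. exact: loc_coprime. Qed.

Lemma singularity_ends (a : sphere R) U : transcendental_singularity Psi a U ->
  left_end c U \/ right_end c U.
Proof.
apply: left_or_right c0 (num_neq0 a) (num_den_coprime a) _ _ _ _.
- exact: preimage_disk_small.
- exact: sublevel_preimage_disk.
Qed.

Lemma left_end_value (a : sphere R) U : transcendental_singularity Psi a U ->
  left_end c U -> a = ratfun p q (fin 0).
Proof.
move=> tU lU; apply/esym/(loc_num_root0 a 0 cop).
exact: (@left_end_root _ _ _ _ c0 (num_neq0 a) (num_den_coprime a) (A a) (@preimage_disk_small a)
  (@sublevel_preimage_disk a) U tU lU).
Qed.

Lemma left_singularity_exists : exists U,
  transcendental_singularity Psi (ratfun p q (fin 0)) U /\ left_end c U.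
Proof.
set a := ratfun p q (fin 0).
apply: (@left_end_exists _ _ _ _ c0 (num_neq0 a) (num_den_coprime a) (A a)
  (@preimage_disk_mono a) (@preimage_disk_small a) (@sublevel_preimage_disk a)).
exact/(loc_num_root0 a 0 cop).
Qed.

Lemma left_tract (a : sphere R) U : transcendental_singularity Psi a U -> left_end c U ->
  exists L M h1 h0 m B, tract_chart (loc_num a p q) (loc_den a p q) c L M h1 h0 m B /\
   \forall rho \near 0^'+,
    U rho = [set z | Re (c * z) < h1 /\ Re (L z) < ln (tan (rho / 2))] /\
    ln (tan (rho / 2)) < h0.
Proof.
move=> tU lU; have av := left_end_value tU lU.
have n0 : (loc_num a p q).[0] = 0 by apply/(loc_num_root0 a 0 cop).
have d0 : (loc_den a p q).[0] != 0.
  by apply: coprimep_root (num_den_coprime a) _; rewrite /root n0.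
have [L [M [h1 [h0 [m [B tc]]]]]] := tract_chart_exists c0 (num_neq0 a) n0 d0.
exists L, M, h1, h0, m, B; split => //.
exact: (left_end_tract c0 (num_neq0 a) (num_den_coprime a) (A := A a) (@preimage_disk_small a)
  (@sublevel_preimage_disk a) tc tU lU (preimage_disk_near a) tan_half_cvg).
Qed.

(** Both families equal the same explicit set for small rho. The chart has to be fixed before the
    families, since the one given by [left_tract] may depend on the family. *)
Lemma left_unique (a : sphere R) U V :
  transcendental_singularity Psi a U -> left_end c U ->
  transcendental_singularity Psi a V -> left_end c V -> same_germ U V.
Proof.
move=> tU lU tV lV; have av := left_end_value tU lU.
have n0 : (loc_num a p q).[0] = 0 by apply/(loc_num_root0 a 0 cop).
have d0 : (loc_den a p q).[0] != 0.
  by apply: coprimep_root (num_den_coprime a) _; rewrite /root n0.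
have [L [M [h1 [h0 [m [B tc]]]]]] := tract_chart_exists c0 (num_neq0 a) n0 d0.
have H W (tW : transcendental_singularity Psi a W) (lW : left_end c W) :=
  left_end_tract c0 (num_neq0 a) (num_den_coprime a) (A := A a) (@preimage_disk_small a)
  (@sublevel_preimage_disk a) tc tW lW (preimage_disk_near a) tan_half_cvg.
by apply: filterS2 (H U tU lU) (H V tV lV) => rho [-> _] [-> _].
Qed.

(** The affine form of the rotation behind [loc_num] and [loc_den]; with its inverse it provides
    [mu] and [nu] for the covering. *)
Definition rotation (a : sphere R) (x : C) : C :=
  match a with Some y => (x - y) / (1 + y^*%C * x) | None => x^-1 end.

Definition rotation_inv (a : sphere R) (m : C) : C :=
  match a with Some y => (m + y) / (1 - y^*%C * m) | None => m^-1 end.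

Lemma conj_neqN1 (y : C) : 1 + y^*%C * y != 0.
Proof.
rewrite normc_conjM -(rmorph1 (real_complex R)) -rmorphD -normc_eq0 normc_real normr_eq0.
by rewrite gt_eqF// ltr_pwDl// sqr_ge0.
Qed.

Lemma rotation_invK (y u v : C) : v != 0 -> v + y^*%C * u != 0 ->
  rotation_inv (Some y) ((u - y * v) / (v + y^*%C * u)) = u / v.
Proof.
move=> v0 d0; have y0 := conj_neqN1 y; rewrite /=.
have -> : 1 - y^*%C * ((u - y * v) / (v + y^*%C * u)) =
  (1 + y^*%C * y) * v / (v + y^*%C * u) by field.
by field; rewrite d0 v0 y0.
Qed.

Lemma disk_fin (a : sphere R) (x : C) (rho : R) : 0 < rho < pi ->
  spherical_disk a rho (fin x) <->
  match a with Some y => normc (x - y) < tan (rho / 2) * normc (1 + y^*%C * x)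
  | None => 1 < tan (rho / 2) * normc x end.
Proof.
move=> rr; have cp : coprimep ('X : {poly C}) 1 by exact: coprimep1.
have := disk_ratfun a x cp rr; rewrite ratfun_fin hornerC oner_eq0 hornerX divr1.
by case: a => [y|] /=; rewrite !hornerE ?normc1.
Qed.

Lemma disk_infty (y : C) (rho : R) : 0 < rho < pi -> spherical_disk (fin y) rho (infty R) ->
  1 < tan (rho / 2) * normc y.
Proof.
move=> rr; have cp : coprimep (1 : {poly C}) 'X by rewrite coprimep_sym coprimep1.
have := disk_ratfun (fin y) 0 cp rr; rewrite ratfun_fin hornerX eqxx => -[+ _] => /[apply] /=.
by rewrite !hornerE ?mulr0 ?subr0 ?add0r ?mulr1 normc1 normc_conj.
Qed.

Lemma rotation_lt1 (y m : C) (tau : R) : 0 < normc m < tau -> tau * normc y < 1 ->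
  1 - y^*%C * m != 0.
Proof.
move=> /andP[m0 mt] ty; rewrite subr_eq0; apply/eqP => e.
have : normc (y^*%C * m) < 1.
  rewrite normcM normc_conj mulrC; apply: le_lt_trans ty.
  by rewrite ler_wpM2r ?normc_ge0// ltW.
by rewrite -e normc1 ltxx.
Qed.

Lemma left_logarithmic (a : sphere R) U : transcendental_singularity Psi a U ->
  left_end c U -> logarithmic Psi a U.
Proof.
move=> tU lU; have [L [M [h1 [h0 [m [B [tc HU]]]]]]] := left_tract tU lU.
(* This bound keeps oo out of the disk about a finite value, and the pole of [rotation_inv] out of
   the disk of radius tan (rho / 2). *)
have small : \forall rho \near (0 : R)^'+,
    match a with Some y => is_true (tan (rho / 2) * normc y < 1) | None => True end.
  case: (a) => [y|]; last exact: filterE.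
  have e0 : 0 < (1 + normc y)^-1 by rewrite invr_gt0 ltr_pwDl// normc_ge0.
  move/cvgrPdist_lt : tan_half_cvg => /(_ _ e0); apply: filterS => rho.
  rewrite sub0r normrN => h.
  have := le_lt_trans (ler_norm _) h; rewrite -[ltRHS]mul1r ltr_pdivlMr ?ltr_pwDl ?normc_ge0//.
  move=> h2; have [tp|tn] := ltP 0 (tan (rho / 2)); first by move: h2; rewrite mulrDr mulr1; lra.
  by apply: le_lt_trans ltr01; rewrite mulr_le0_ge0 ?normc_ge0.
have rng : \forall rho \near (0 : R)^'+, 0 < rho < pi by apply: (near_right (pi_gt0 R)).
apply: filterS3 HU small rng => rho [Ue lh] sm rr.
set tau := tan (rho / 2) in Ue lh sm; have t0 : 0 < tau by exact: tan_half_gt0.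
have et : expR (ln tau) = tau by rewrite lnK// posrE.
rewrite /logarithmic; apply: (@tract_universal_covering _ _ L M (rotation a) (rotation_inv a) (ln tau)).
- move=> z; rewrite Ue => -[zh zl]; split => //.
  by apply: (tc_MK tc) => //; exact: lt_trans zl lh.
- move=> s sl; have sh := lt_trans sl lh; rewrite Ue; split; last exact: (tc_LK tc).
  by split; [exact: (tc_dom tc)|rewrite (tc_LK tc)].
- move=> z; rewrite Ue => -[zh zl]; have [d hd _] := tc_derive tc zh.
  exact: is_deriveC_cvg hd.
- move=> s sl; have [d hd] := tc_derive_inv tc (lt_trans sl lh).
  exact: is_deriveC_cvg hd.
- move=> x; rewrite et => xr; have x0 : x != 0 by case/andP: xr => + _; rewrite normc_gt0.
  case: a sm {tU tc Ue lh} => [y|] sm.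
    have d0 := rotation_lt1 xr sm; have y0 := conj_neqN1 y.
    have e1 : 1 + y^*%C * ((x + y) / (1 - y^*%C * x)) = (1 + y^*%C * y) / (1 - y^*%C * x) by field.
    have e2 : (x + y) / (1 - y^*%C * x) - y = x * ((1 + y^*%C * y) / (1 - y^*%C * x)) by field.
    split.
    + split.
        apply/(disk_fin (Some y) _ rr); rewrite e1 e2 (normcM x) ltr_pM2r; last first.
          by rewrite normc_gt0 mulf_neq0// invr_eq0.
        by case/andP: xr.
      move=> [] /eqP; rewrite -subr_eq0 e2 => /eqP; apply/eqP.
      by rewrite !mulf_neq0// ?invr_eq0.
    + by rewrite /= e1 e2; field; rewrite d0 y0.
    + apply: climM; first by apply: climD; [exact: clim_id|exact: clim_cst].
      apply: climV => //; apply: climD; first exact: clim_cst.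
      rewrite -mulNr; apply: (clim_near (f := fun u => - y^*%C * u)).
        by apply: nearCW => u; rewrite mulNr.
      by apply: climM; [exact: clim_cst|exact: clim_id].
  split.
  + split; last by [].
    apply/(disk_fin None _ rr) => /=; rewrite normcV ltr_pdivlMr ?normc_gt0// mul1r.
    by case/andP: xr.
  + by rewrite /= invrK.
  + by apply: climV => //; exact: clim_id.
- move=> b [Db ba]; rewrite et.
  case: b Db ba => [x|] Db ba; last first.
    case: a sm Db ba {tU tc Ue lh} => [y|] sm Db ba; last by exfalso; apply: ba.
    by have := disk_infty rr Db; rewrite ltNge (ltW sm).
  exists x.
  case: a sm Db ba {tU tc Ue lh} => [y|] sm Db ba.
    have := (disk_fin (Some y) x rr).1 Db; rewrite -/tau => h.
    have d0 : 1 + y^*%C * x != 0.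
      by rewrite -normc_gt0 -(pmulr_rgt0 _ t0); apply: le_lt_trans h; exact: normc_ge0.
    have xy : x - y != 0 by rewrite subr_eq0; apply/eqP => e; apply: ba; rewrite e.
    have y0 := conj_neqN1 y.
    have e1 : 1 - y^*%C * ((x - y) / (1 + y^*%C * x)) = (1 + y^*%C * y) / (1 + y^*%C * x) by field.
    split => //.
    + rewrite normc_gt0 mulf_neq0 ?invr_eq0//= normcM normcV ltr_pdivrMr// normc_gt0//.
    + by rewrite /= e1; field; rewrite d0 y0.
    + apply: climM; first by apply: climD; [exact: clim_id|exact: clim_cst].
      apply: climV => //; apply: climD; first exact: clim_cst.
      by apply: climM; [exact: clim_cst|exact: clim_id].
  have := (disk_fin None x rr).1 Db; rewrite -/tau => h.
  have x0 : x != 0 by rewrite -normc_gt0 -(pmulr_rgt0 _ t0); apply: lt_trans h.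
  split => //; last by apply: climV => //; exact: clim_id.
    by rewrite normc_gt0 invr_eq0 x0 /= normcV -[ltLHS]mul1r ltr_pdivrMr// normc_gt0.
  by rewrite /= invrK.
move=> z; rewrite Ue => -[zh zl]; rewrite PsiE.
have dn := tc_den tc zh; have le := tc_exp tc zh.
have lt : normc (cexp (L z)) < tau by rewrite normc_cexp -et ltr_expR.
have ln0 := cexp_neq0 (L z).
set w := cexp (c * z) in dn le *; rewrite le in lt ln0 *.
case: a sm tc Ue dn le lt ln0 {tU} => [y|] sm tc Ue /= dn le lt ln0.
  rewrite !(hornerD, hornerN, hornerZ) in dn lt ln0 le *.
  (* At a pole of p / q the rotated value has modulus 1 / |y|, which exceeds tan (rho / 2). *)
  have qw : q.[w] != 0.
    apply/eqP => q0; move: dn lt; rewrite q0 mulr0 subr0 add0r => dn.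
    have pw : p.[w] != 0 by apply: contra_neq dn => ->; rewrite mulr0.
    have yc : y^*%C != 0 by apply: contra_neq dn => ->; rewrite mul0r.
    have -> : p.[w] / (y^*%C * p.[w]) = (y^*%C)^-1 by field; rewrite pw yc.
    rewrite normcV normc_conj; have y0 : 0 < normc y by rewrite -normc_conj normc_gt0.
    by rewrite -[ltLHS]mul1r ltr_pdivrMr// ltNge (ltW sm).
  rewrite (negbTE qw); congr fin; have y0 := conj_neqN1 y.
  by rewrite -[LHS](rotation_invK qw dn).
have qw : q.[w] != 0 by apply: contra_neq ln0 => ->; rewrite mul0r.
by rewrite (negbTE qw) invf_div.
Qed.

(** With L' a logarithm of Psi - a, the map phi = i pi - L' satisfies exp phi = -1 / (Psi - a), and
    also phi' X = -1 / (Psi - a) because X = 1 / Psi'. The set V is a half-plane for L', interlaced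
    with the half-planes of the rotated chart L that describe U. *)
Lemma left_hyperbolic (a : sphere R) U : transcendental_singularity Psi a U ->
  left_end c U -> a <> infty R -> hyperbolic_tract U X.
Proof.
case: a => [y|] // tU lU _.
have [L [M [h1 [h0 [m [B [tc HU]]]]]]] := left_tract tU lU.
have av := left_end_value tU lU.
have n0 : (loc_num (Some y) p q).[0] = 0 by apply/(loc_num_root0 (Some y) 0 cop).
have q0 : q.[0] != 0.
  by apply/eqP => q0; move: av; rewrite ratfun_fin q0 eqxx.
have [L' [M' [h1' [h0' [m' [B' tc']]]]]] := tract_chart_exists c0 (num_neq0 (Some y)) n0 q0.
apply: filterS HU => rho [Ue lh].
have [K1 HK1] := chart_comparison (ln (tan (rho / 2))) tc.
have [K2 HK2] := chart_comparison (Num.min K1 h1) tc'.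
(* Of the two bounds on - h, [K2] puts the half-plane of L' inside U(rho) and [h0'] puts it inside
   the domain of M'. *)
pose h := Num.max (- K2) (- h0').
have hK2 : - h <= K2 by rewrite /h oppr_max !opprK ge_min lexx.
have hh0 : - h <= h0' by rewrite /h oppr_max !opprK ge_min lexx orbT.
exists h, [set z | Re (c * z) < h1' /\ Re (L' z) < - h]; split.
- move=> z [zh zl]; rewrite Ue.
  have := (HK2 z zh).1 (lt_le_trans zl hK2); rewrite lt_min => /andP[zk zh1].
  by split => //; exact: (HK1 z zh1).2.
- have [K3 HK3] := chart_comparison (- h) tc'.
  have [K4 HK4] := chart_comparison (Num.min K3 h1') tc.
  have nt : \forall rho' \near (0 : R)^'+, tan (rho' / 2) < expR K4.
    move/cvgrPdist_lt: tan_half_cvg => /(_ _ (expR_gt0 K4)); apply: filterS => rho'.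
    by rewrite sub0r normrN; apply: le_lt_trans; exact: ler_norm.
  have rng : \forall rho' \near (0 : R)^'+, 0 < rho' < pi by apply: (near_right (pi_gt0 R)).
  have [L2 [M2 [h12 [h02 [m2 [B2 [tc2 HU2]]]]]]] := left_tract tU lU.
  have HU1 := left_end_tract c0 (num_neq0 (Some y)) (num_den_coprime (Some y)) (A := A (Some y))
    (@preimage_disk_small (Some y)) (@sublevel_preimage_disk (Some y)) tc tU lU (preimage_disk_near (Some y)) tan_half_cvg.
  apply: filterS3 HU1 nt rng => rho' [Ue' _] tk rr z; rewrite Ue' => -[zh zl].
  have lk : Re (L z) < K4.
    by apply: lt_trans zl _; rewrite -ltr_expR lnK// posrE tan_half_gt0.
  have := (HK4 z zh).1 lk; rewrite lt_min => /andP[zk zh1].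
  by split => //; exact: (HK3 z zh1).2.
exists (fun z => Complex 0 pi - L' z), (fun s => M' (Complex 0 pi - s)); split.
- move=> z [zh _]; have [d hd _] := tc_derive tc' zh; apply/derivableC_ex.
  exists (0 + -1 * d).
  apply: is_deriveC_near (is_deriveC_D (is_deriveC_cst z (Complex 0 pi)) (is_deriveC_Z (-1) hd)).
  by apply: nearCW => x; rewrite mulN1r.
- move=> s /= sh; apply/derivableC_ex.
  have sl : Re (Complex 0 pi - s) < h0'.
    by rewrite ReD ReN /= add0r; apply: lt_le_trans hh0; rewrite ltrN2.
  have [d hd] := tc_derive_inv tc' sl.
  have D1 : is_derive s 1 (fun x : C => Complex 0 pi - x) (0 + -1 * 1).
    apply: is_deriveC_near (is_deriveC_D (is_deriveC_cst s (Complex 0 pi)) (is_deriveC_Z (-1) (is_deriveC_id s))).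
    by apply: nearCW => x; rewrite mulN1r.
  by exists (d * (0 + -1 * 1)); exact: (@is_deriveC_comp _ (fun x : C => Complex 0 pi - x) M').
- by move=> z [zh zl]; rewrite /= ReD ReN /= add0r ltrNr.
- move=> s /= sh.
  have sl : Re (Complex 0 pi - s) < - h by rewrite ReD ReN /= add0r ltrN2.
  have sl0 := lt_le_trans sl hh0.
  by split; [exact: (tc_dom tc')|rewrite (tc_LK tc')].
split.
- move=> z; rewrite inE => -[zh zl]; rewrite opprB addrC subrK.
  by apply: (tc_MK tc') => //; exact: lt_le_trans hh0.
- move=> s; rewrite inE /= => sh; rewrite (tc_LK tc'); first by rewrite opprB addrC subrK.
  by rewrite ReD ReN /= add0r; apply: lt_le_trans hh0; rewrite ltrN2.
move=> z [zh zl]; have [d hd d0] := tc_derive tc' zh.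
have D1 : is_derive z 1 (fun x => Complex 0 pi - L' x) (0 + -1 * d).
  apply: is_deriveC_near (is_deriveC_D (is_deriveC_cst z (Complex 0 pi)) (is_deriveC_Z (-1) hd)).
  by apply: nearCW => x; rewrite mulN1r.
have qz := tc_den tc' zh; have ez := tc_exp tc' zh; have := chart_log_derive tc' zh hd.
have -> : derive1 (fun x => Complex 0 pi - L' x) z = 0 + -1 * d by exact: is_derive1C.
rewrite cexpB ez /X (vfieldE p cE qz).
have -> : wronskian (loc_num (Some y) p q) q = wronskian p q.
  by rewrite /wronskian /= derivB derivZ -!mul_polyC; ring.
set w := cexp (c * z) in qz ez *; set N := (loc_num (Some y) p q).[w] in ez *.
have N0 : N != 0.
  by apply/eqP => N0; have := cexp_neq0 (L' z); rewrite ez N0 mul0r eqxx.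
move=> e; have W0 : (wronskian p q).[w] != 0.
  apply/eqP => W0; move: e; rewrite W0 mulr0 mul0r => /eqP.
  by rewrite !mulf_eq0 invr_eq0 (negbTE d0) (negbTE N0) (negbTE qz).
have w0 : w != 0 by exact: cexp_neq0.
have -> : cexp (Complex 0 pi) = -1 :> C.
  by rewrite /cexp /= expR0 cospi sinpi; apply/eqP; rewrite eq_complex /= !mul1r oppr0 !eqxx.
have -> : d = c * w * (wronskian p q).[w] / q.[w] ^+ 2 / (N / q.[w]).
  by rewrite -e mulfK// mulf_neq0// invr_eq0.
by field; rewrite qz N0 W0 w0 c0.
Qed.

(** At oo the rotated function is 1 / Psi, so L is a logarithm of 1 / Psi and phi = i pi + L
    satisfies phi' X = -1 / Psi = exp phi. One chart serves for both the component and X, so U(rho)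
    itself is a half-plane for phi. *)
Lemma left_elliptic (a : sphere R) U : transcendental_singularity Psi a U ->
  left_end c U -> a = infty R -> elliptic_tract U X.
Proof.
move=> tU lU ai; rewrite ai in tU.
have [L [M [h1 [h0 [m [B [tc HU]]]]]]] := left_tract tU lU.
apply: filterS HU => rho [-> lh].
set h := ln (tan (rho / 2)) in lh *; exists h.
exists (fun z => Complex 0 pi + L z), (fun s => M (s - Complex 0 pi)); split.
- move=> z [zh _]; have [d hd _] := tc_derive tc zh; apply/derivableC_ex.
  by exists (0 + d); exact: is_deriveC_D (is_deriveC_cst z (Complex 0 pi)) hd.
- move=> s /= sh; apply/derivableC_ex.
  have sl : Re (s - Complex 0 pi) < h0.
    by rewrite ReD ReN /= subr0; exact: lt_trans lh.
  have [d hd] := tc_derive_inv tc sl.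
  have D1 := is_deriveC_D (is_deriveC_id s) (is_deriveC_cst s (- Complex 0 pi)).
  by exists (d * (1 + 0)); exact: (@is_deriveC_comp _ (fun x : C => x - Complex 0 pi) M).
- by move=> z [zh zl]; rewrite /= ReD /= add0r.
- move=> s /= sh.
  have sl : Re (s - Complex 0 pi) < h by rewrite ReD ReN /= subr0.
  have sl0 := lt_trans sl lh.
  by split; [exact: (tc_dom tc)|rewrite (tc_LK tc)].
split.
- move=> z; rewrite inE => -[zh zl]; rewrite addrC addKr.
  by apply: (tc_MK tc) => //; exact: lt_trans lh.
- move=> s; rewrite inE /= => sh; rewrite (tc_LK tc); first by rewrite addrC subrK.
  by rewrite ReD ReN /= subr0; exact: lt_trans lh.
move=> z [zh zl]; have [d hd d0] := tc_derive tc zh.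
have D1 : is_derive z 1 (fun x => Complex 0 pi + L x) (0 + d).
  exact: is_deriveC_D (is_deriveC_cst z (Complex 0 pi)) hd.
have pz := tc_den tc zh; have ez := tc_exp tc zh; have := chart_log_derive tc zh hd.
have -> : derive1 (fun x => Complex 0 pi + L x) z = 0 + d by exact: is_derive1C.
rewrite cexpD ez /= in pz *; set w := cexp (c * z) in pz ez *.
have qz : q.[w] != 0.
  by apply/eqP => qz; have := cexp_neq0 (L z); rewrite ez /= qz mul0r eqxx.
rewrite /X (vfieldE p cE qz) -/w.
have -> : (wronskian q p).[w] = - (wronskian p q).[w].
  by rewrite -hornerN; congr (horner _ _); rewrite /wronskian; ring.
move=> e; have W0 : (wronskian p q).[w] != 0.
  apply/eqP => W0; move: e; rewrite W0 oppr0 mulr0 mul0r => /eqP.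
  by rewrite !mulf_eq0 invr_eq0 (negbTE d0) (negbTE pz) (negbTE qz).
have w0 : w != 0 by exact: cexp_neq0.
have -> : cexp (Complex 0 pi) = -1 :> C.
  by rewrite /cexp /= expR0 cospi sinpi; apply/eqP; rewrite eq_complex /= !mul1r oppr0 !eqxx.
have -> : d = c * w * - (wronskian p q).[w] / p.[w] ^+ 2 / (q.[w] / p.[w]).
  by rewrite -e mulfK// mulf_neq0// invr_eq0.
by field; rewrite qz pz W0 w0 c0.
Qed.

End LeftEnd.

End Ends.

(** * Exchange of 0 and oo *)

Section Reversal.
Variable R : realType.
Local Notation C := R[i].

(** Coefficients are reversed relative to r, not to the degree of p: numerator and denominator then
    acquire the same factor x^r, which cancels in the quotient. *)
Definition revp (r : nat) (p : {poly C}) : {poly C} := \poly_(i < r.+1) p`_(r - i).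

Lemma revpE (r : nat) (p : {poly C}) (x : C) : (size p <= r.+1)%N -> x != 0 ->
  (revp r p).[x] = x ^+ r * p.[x^-1].
Proof.
move=> sp x0; rewrite /revp horner_poly (horner_coef_wide _ sp) mulr_sumr.
rewrite (reindex_inj rev_ord_inj) /=; apply: eq_bigr => i _.
rewrite subSS; have ir : (i <= r)%N by rewrite -ltnS.
rewrite subKn// mulrCA; congr (_ * _).
have aux (n k : nat) : (k <= n)%N -> x ^+ (n - k) = x ^+ n * x^-1 ^+ k.
  by move=> kn; rewrite -{2}(subnK kn) exprD exprVn mulfK// expf_neq0.
exact: aux.
Qed.

Lemma revp0 (r : nat) (p : {poly C}) : (revp r p).[0] = p`_r.
Proof. by rewrite horner_coef0 /revp coef_poly subn0. Qed.

Lemma revp_top (r : nat) (p : {poly C}) : (revp r p)`_r = p.[0].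
Proof. by rewrite /revp coef_poly ltnS leqnn subnn horner_coef0. Qed.

Lemma degree_pair_sizes (r : nat) (p q : {poly C}) : degree_pair r p q ->
  (size p <= r.+1)%N /\ (size q <= r.+1)%N.
Proof. by move=> [_ <-]; rewrite leq_maxl leq_maxr. Qed.

Lemma top_neq0 (r : nat) (p q : {poly C}) : degree_pair r p q -> p`_r = 0 -> q`_r != 0.
Proof.
move=> /[dup] /degree_pair_sizes[sp sq] [_ sz] pr; apply/eqP => qr.
have H (s : {poly C}) : (size s <= r.+1)%N -> s`_r = 0 -> (size s <= r)%N.
  move=> ss sr; rewrite leqNgt; apply/negP => rs.
  have e : size s = r.+1 by apply/eqP; rewrite eqn_leq ss.
  have : lead_coef s = 0 by rewrite lead_coefE e.
  by move/eqP; rewrite lead_coef_eq0 => /eqP s0; rewrite s0 size_poly0 in rs.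
have : (maxn (size p) (size q) <= r)%N by rewrite geq_max !H.
by rewrite sz ltnn.
Qed.

Lemma bottom_neq0 (r : nat) (p q : {poly C}) : degree_pair r p q -> p.[0] = 0 -> q.[0] != 0.
Proof. by move=> [pq _] p0; apply: coprimep_root pq _; rewrite /root p0. Qed.

Lemma degree_pair_revp (r : nat) (p q : {poly C}) : degree_pair r p q ->
  degree_pair r (revp r p) (revp r q).
Proof.
move=> /[dup] pq /degree_pair_sizes[sp sq]; have [cop _] := pq; split.
  apply: Pdiv.ClosedField.root_coprimep => x /rootP; have [->|x0] := eqVneq x 0.
    by rewrite !revp0; exact: top_neq0.
  rewrite !revpE// => /eqP; rewrite mulf_eq0 expf_eq0 (negbTE x0) andbF /= => px.
  by rewrite mulf_neq0 ?expf_neq0//; exact: coprimep_root cop px.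
apply/eqP; rewrite eqn_leq geq_max !size_poly/=.
have H (s : {poly C}) : s.[0] != 0 -> (r < size (revp r s))%N.
  move=> s0; rewrite ltnNge; apply/negP => h.
  by move: s0; rewrite -(revp_top r) (nth_default _ h) eqxx.
rewrite leq_max; have [p0|p0] := eqVneq p.[0] 0; last by rewrite H.
by rewrite (H q) ?orbT//; exact: bottom_neq0 pq p0.
Qed.

Lemma ratfun_infty (r : nat) (p q : {poly C}) : degree_pair r p q ->
  ratfun p q (infty R) = if q`_r == 0 then infty R else fin (p`_r / q`_r).
Proof. by move=> [_ sz]; rewrite /ratfun sz. Qed.

Lemma ratfun_revp0 (r : nat) (p q : {poly C}) : degree_pair r p q ->
  ratfun (revp r p) (revp r q) (fin 0) = ratfun p q (infty R).
Proof. by move=> pq; rewrite (ratfun_infty pq) ratfun_fin !revp0. Qed.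

Lemma ratfun_revp (r : nat) (p q : {poly C}) (w : C) : degree_pair r p q -> w != 0 ->
  ratfun (revp r p) (revp r q) (fin w) = ratfun p q (fin w^-1).
Proof.
move=> /degree_pair_sizes[sp sq] w0; rewrite !ratfun_fin !revpE//.
rewrite mulf_eq0 expf_eq0 (negbTE w0) andbF /=; case: eqVneq => // qw.
by congr fin; rewrite -mulf_div divff ?mul1r// expf_neq0.
Qed.

Lemma period_coefN (T : C) : period_coef (- T) = - period_coef T.
Proof. by rewrite /period_coef invrN mulrN. Qed.

(** As exp (- c z) = 1 / exp (c z), exchanging 0 and oo amounts to replacing T by - T: results at
    the left end for - T are results at the right end for T. *)
Lemma exp_pullback_revp (T : C) (r : nat) (p q : {poly C}) : degree_pair r p q ->
  exp_pullback (- T) (ratfun (revp r p) (revp r q)) = exp_pullback T (ratfun p q).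
Proof.
move=> pq; apply: funext => z; rewrite !exp_pullbackE period_coefN mulNr cexpN.
by rewrite (ratfun_revp pq) ?invrK// invr_eq0 cexp_neq0.
Qed.

Lemma left_end_opp (c : C) (U : R -> set C) : left_end (- c) U <-> right_end c U.
Proof.
by split=> -[rho rp H]; exists rho => // z /H; rewrite mulNr ReN oppr_lt0.
Qed.

End Reversal.

(** * The essential singularity at oo *)

Section EssentialSingularity.
Variable R : realType.
Local Notation C := R[i].

Lemma mup_count (p : {poly C}) (s : seq C) (x : C) : p != 0 ->
  p = lead_coef p *: \prod_(z <- s) ('X - z%:P) -> mup x p = count_mem x s.
Proof.
move=> p0 ->; by rewrite -mul_polyC mupMr ?mu_prod_XsubC// rootC lead_coef_eq0.
Qed.

Lemma mup_factor (p p1 : {poly C}) (x : C) (m : nat) :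
  p = ('X - x%:P) ^+ m * p1 -> p1.[x] != 0 -> mup x p = m.
Proof.
move=> -> p1x; rewrite mupMl; last by rewrite /root.
by rewrite mup_XsubCX eqxx.
Qed.

Lemma size_le_mup (p q : {poly C}) : p != 0 -> q != 0 ->
  (forall x, (mup x p <= mup x q)%N) -> (size p <= size q)%N.
Proof.
move=> p0 q0 H.
have [s es] := closed_field_poly_normal p; have [t et] := closed_field_poly_normal q.
rewrite es et !size_scale ?lead_coef_eq0// !size_prod_XsubC ltnS.
have /count_subseqP[u ut su] : forall x, (count_mem x s <= count_mem x t)%N.
  by move=> x; rewrite -(mup_count x p0 es) -(mup_count x q0 et).
by rewrite (perm_size su); exact: size_subseq.
Qed.

(* Up to lower-order terms [p' q - p q'] has leading coefficient
   [(deg p - deg q) lc(p) lc(q)]. *)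
Lemma size_wronskian (p q : {poly C}) : p != 0 -> q != 0 -> (size q < size p)%N ->
  (size p + size q <= (size (wronskian p q)).+2)%N.
Proof.
move=> p0 q0 sqp.
(* The operator deg(s) s - X s' cancels the leading term of s. Multiplying the Wronskian by X turns
   it into (deg p - deg q) p q plus products involving such tails. *)
pose tail (s : {poly C}) : {poly C} := s *+ (size s).-1 - 'X * s^`().
have tl (s : {poly C}) : s != 0 -> (size (tail s) < size s)%N.
  move=> s0; rewrite -(prednK (_ : 0 < size s)%N) ?size_poly_gt0// ltnS.
  apply/leq_sizeP => j hj; rewrite coefB coefMn coefXM.
  have [j0|j0] := eqVneq j 0%N.
    rewrite j0 leqn0 in hj *; rewrite (eqP hj) mulr0n subrr//.
  rewrite coef_deriv prednK ?lt0n//.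
  move: hj; rewrite leq_eqVlt => /orP[/eqP->|hj]; first by rewrite subrr.
  by rewrite nth_default ?mul0rn ?subrr//; rewrite -(prednK (_ : 0 < size s)%N) ?size_poly_gt0.
have e : 'X * wronskian p q =
    p * q *+ ((size p).-1 - (size q).-1) + (p * tail q - tail p * q).
  have sub : ((size q).-1 <= (size p).-1)%N by move: sqp; lia.
  rewrite mulrnBr// /tail /wronskian !mulrBr !mulrBl mulrnAl mulrnAr.
  by ring.
have sm : size (p * q) = (size p + size q).-1 by exact: size_mul.
have k0 : ((size p).-1 - (size q).-1)%N != 0%N.
  by move: sqp q0; rewrite -size_poly_gt0; lia.
have sz : size (p * q *+ ((size p).-1 - (size q).-1)) = (size p + size q).-1.
  by rewrite -mulr_natl -polyC_natr mul_polyC size_scale// pnatr_eq0.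
have small : (size (p * tail q - tail p * q)%R < (size p + size q).-1)%N.
  have [ps qs] : (0 < size p)%N /\ (0 < size q)%N by rewrite !size_poly_gt0.
  apply: leq_ltn_trans (size_polyD _ _) _; rewrite size_polyN gtn_max; apply/andP; split.
    have [t0|t0] := eqVneq (tail q) 0; first by rewrite t0 mulr0 size_poly0; lia.
    rewrite size_mul//; have := tl q q0; have : (0 < size (tail q))%N by rewrite size_poly_gt0.
    by move: ps; move: (size p) (size q) (size (tail q)) => a b d; lia.
  have [t0|t0] := eqVneq (tail p) 0; first by rewrite t0 mul0r size_poly0; lia.
  rewrite size_mul//; have := tl p p0; have : (0 < size (tail p))%N by rewrite size_poly_gt0.
  by move: qs; move: (size p) (size q) (size (tail p)) => a b d; lia.
have : size ('X * wronskian p q) = (size p + size q).-1.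
  by rewrite e size_polyDl ?sz.
have [->|W0] := eqVneq (wronskian p q) 0; first by rewrite mulr0 size_poly0; lia.
by rewrite mulrC size_mulX//; lia.
Qed.

(** Otherwise every root of the Wronskian is a root of q, where its order is one less than that of
    q, so its size is at most that of q; [size_wronskian] then gives r <= 1. But q has the root 0
    and degree less than r, so r >= 2. *)
Lemma critical_point_exists (p q : {poly C}) (r : nat) : (1 <= r)%N -> degree_pair r p q ->
  q.[0] = 0 -> q`_r = 0 -> exists w, [/\ w != 0, q.[w] != 0 & (wronskian p q).[w] = 0].
Proof.
move=> r1 pq q0 qr; have qn0 := deg_neq0 r1 pq.
have W0 := wronskian_neq0 r1 pq.
have sq : (size q <= r)%N.
  have [_ ss] := degree_pair_sizes pq; rewrite leqNgt; apply/negP => rs.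
  have e : size q = r.+1 by apply/eqP; rewrite eqn_leq ss.
  have : lead_coef q = 0 by rewrite lead_coefE e.
  by move/eqP; rewrite lead_coef_eq0 (negbTE qn0).
have sp : size p = r.+1.
  case: pq => _ sz; apply/eqP; rewrite -sz eq_sym; apply/eqP/maxn_idPl.
  by move: sz; rewrite /maxn; case: ltnP => // _ e; rewrite e ltnn in sq.
have pn0 : p != 0 by rewrite -size_poly_gt0 sp.
apply: contrapT => /forallNP H.
have Hroot x : (wronskian p q).[x] = 0 -> q.[x] = 0.
  move=> Wx; apply/eqP/negPn/negP => qx; apply: (H x); split => //.
  by apply: contra_neq qx => ->.
have : (size (wronskian p q) <= size q)%N.
  apply: size_le_mup => // x.
  have [Wx|Wx] := eqVneq (wronskian p q).[x] 0; last by rewrite mupNroot.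
  have qx := Hroot x Wx; have [m [q1 [qe q1x]]] := root_factor x qn0.
  have px : p.[x] != 0.
    by case: pq => cop _; apply: (@coprimep_root _ q); rewrite 1?coprimep_sym// /root qx.
  case: m qe => [|m] qe; first by move: q1x; rewrite -qx qe expr0 mul1r eqxx.
  have [W1 [We W1x]] := wronskian_factor qe px q1x.
  by rewrite (mup_factor We W1x) (mup_factor qe q1x).
have := size_wronskian pn0 qn0 (_ : (size q < size p)%N); rewrite sp ltnS => /(_ sq).
have : (1 < size q)%N.
  by apply: (@root_size_gt1 _ 0); rewrite ?/root ?q0.
by lia.
Qed.

Lemma meromorphic_infty_growth (X : C -> C) :
  meromorphic_at (local_coef X (infty R)) 0 ->
  exists (B rho : R) (N : nat), [/\ 0 < B, 1 <= rho &
    forall z, rho <= normc z -> normc (X z) <= B * normc z ^+ N].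
Proof.
move=> [n [h [/nbhs_singleton/derivableC_ex[d hd] H]]].
have hc := is_deriveC_cvg hd.
have /nbhsCP[e1 e10 H1] := hc 1 ltr01.
have /near_dnbhsCP[e2 e20 H2] := H.
pose B := normc (h 0) + 1; have B0 : 0 < B by rewrite ltr_wpDl// normc_ge0.
pose rho := 1 + e1^-1 + e2^-1.
have [i1 i2] : 0 < e1^-1 /\ 0 < e2^-1 by rewrite !invr_gt0.
have key z : rho <= normc z -> [/\ 1 <= normc z, normc (h z^-1) <= B &
    - z ^- 2 * X z = z^-1 ^ n * h z^-1].
  move=> hz; have z1 : 1 <= normc z by rewrite /rho in hz; lra.
  have z0 : 0 < normc z by exact: lt_le_trans z1.
  have zn0 : z != 0 by rewrite -normc_gt0.
  have ne1 : normc z^-1 < e1.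
    by rewrite normcV -(invrK e1) ltf_pV2 ?posrE//; rewrite /rho in hz; lra.
  have ne2 : normc z^-1 < e2.
    by rewrite normcV -(invrK e2) ltf_pV2 ?posrE//; rewrite /rho in hz; lra.
  split => //.
    have := H1 z^-1; rewrite subr0 => /(_ ne1) /= hh.
    rewrite -(subrK (h 0) (h z^-1)); apply: le_trans (normcD _ _) _.
    by rewrite /B addrC lerD2l ltW.
  have := H2 z^-1; rewrite invr_eq0 subr0 => /(_ zn0 ne2).
  by rewrite /= invrK exprVn mulNr.
have Xn z : rho <= normc z -> normc (X z) = normc z ^+ 2 * normc (z^-1 ^ n * h z^-1).
  move=> hz; have [z1 _ <-] := key z hz.
  rewrite mulNr normcN normcM normcV normcX mulrA divff ?mul1r// expf_neq0// gt_eqF//.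
  exact: lt_le_trans z1.
(* X(z) is - z^2 z^-n h(1/z) with h bounded: for n >= 0 the exponent 2 suffices, for negative n it
   is 2 + |n|. *)
case: n {H H2} key Xn => n key Xn; exists B, rho.
  exists 2%N; split => //; first by rewrite /rho; lra.
  move=> z hz; have [z1 hb _] := key z hz; rewrite Xn// mulrC ler_wpM2r ?sqr_ge0//.
  rewrite normcM -exprnP normcX normcV -[leRHS]mul1r.
  apply: ler_pM => //; rewrite ?exprn_ge0 ?invr_ge0 ?normc_ge0//.
  by rewrite exprn_ile1 ?invr_ge0 ?normc_ge0// invf_le1// (lt_le_trans ltr01).
exists (n.+1 + 2)%N; split => //; first by rewrite /rho; lra.
move=> z hz; have [z1 hb _] := key z hz; rewrite Xn//.
rewrite NegzE -exprnN exprVn invrK normcM normcX exprD mulrCA mulrA mulrC.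
have zz : 0 <= normc z ^+ n.+1 * normc z ^+ 2 by rewrite mulr_ge0// exprn_ge0 ?normc_ge0.
by rewrite ler_wpM2r.
Qed.

Lemma exp_beats_power (K A : R) (N : nat) (t0 : R) : 0 < K ->
  exists t : R, t0 <= t /\ A * t ^+ N < K * expR t.
Proof.
move=> K0; pose t := Num.max (Num.max t0 1) (`|A| * (N.+1)`!%:R / K + 1).
(* For this t the single term t^(N+1) / (N+1)! of the exponential series is already large enough. *)
exists t; split; first by rewrite /t !le_max lexx.
have t1 : 1 <= t by rewrite /t !le_max lexx orbT.
have tp : 0 < t by exact: lt_le_trans t1.
have f0 : 0 < (N.+1)`!%:R :> R by rewrite ltr0n fact_gt0.
have tA : `|A| * (N.+1)`!%:R / K < t.
  by apply: (@lt_le_trans _ _ (`|A| * (N.+1)`!%:R / K + 1)); rewrite ?ltrDl// /t le_max lexx orbT.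
have h := expR_ge1Dxn N (ltW tp).
have h2 : K * (t ^+ N.+1 / (N.+1)`!%:R) < K * expR t.
  by rewrite ltr_pM2l//; apply: lt_le_trans h; rewrite ltrDr.
apply: le_lt_trans h2; rewrite exprS.
apply: (@le_trans _ _ (`|A| * t ^+ N)).
  by rewrite ler_wpM2r ?exprn_ge0 ?(ltW tp)// ler_norm.
have -> : K * (t * t ^+ N / (N.+1)`!%:R) = (K * t / (N.+1)`!%:R) * t ^+ N by ring.
rewrite ler_wpM2r ?exprn_ge0 ?(ltW tp)// ler_pdivlMr//.
by move: tA; rewrite ltr_pdivrMr// (mulrC t) => /ltW.
Qed.

Section Infinity.
Variables (T c : C) (p q : {poly C}) (r : nat).
Hypotheses (T0 : T != 0) (cE : c = period_coef T) (r1 : (1 <= r)%N) (pq : degree_pair r p q).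
Let X := vfield (exp_pullback T (ratfun p q)).

(** On the ray c z = - t the exponential E equals exp (- t). In X = q^2 / (c E W), q(E) stays away
    from 0 and W(E) stays bounded, so the factor 1 / E forces the growth. *)
Lemma growth_left : q.[0] != 0 -> exists K t0 : R, 0 < K /\ forall t, t0 <= t ->
  K * expR t <= normc (X (- (t%:C%C / c))).
Proof.
move=> q0; have c0 := c_neq0 T0 cE.
have W0 := wronskian_neq0 r1 pq.
(* W may vanish at 0 but W1 does not, so W(E) has no zero far to the left and the quotient defining
   X is genuine there. *)
have [l [W1 [We W10]]] := root_factor 0 W0.
have polyc (S : {poly C}) : clim (nbhs (0:C)) (horner S) S.[0].
  exact: is_deriveC_cvg (is_deriveC_poly _ _).
have N0 : 0 < normc q.[0] by rewrite normc_gt0.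
pose Wb := normc (wronskian p q).[0] + 1.
have Wb0 : 0 < Wb by rewrite ltr_wpDl// normc_ge0.
have [h Hh] : exists h : R, forall z, Re z < h ->
   [/\ normc q.[0] / 2 <= normc q.[cexp z], normc (wronskian p q).[cexp z] <= Wb &
       W1.[cexp z] != 0].
  apply: (@near0_ball _ (fun w => [/\ normc q.[0] / 2 <= normc q.[w],
     normc (wronskian p q).[w] <= Wb & W1.[w] != 0])).
  apply: filterS3 (polyc q _ (divr_gt0 N0 (ltr0Sn R 1))) (polyc (wronskian p q) _ ltr01)
    (clim_neq0 (polyc W1) W10) => w; rewrite /mkset => h1 h2 h3; split => //.
    have := normc_dist q.[w] q.[0]; rewrite ler_norml => /andP[g _].
    by move: g h1; lra.
  rewrite -(subrK (wronskian p q).[0] (wronskian p q).[w]); apply: le_trans (normcD _ _) _.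
  by rewrite /Wb addrC lerD2l ltW.
pose K := (normc q.[0] / 2) ^+ 2 / (normc c * Wb).
exists K, (- h + 1); split.
  by rewrite /K divr_gt0 ?exprn_gt0 ?divr_gt0// mulr_gt0// normc_gt0.
move=> t ht; set z := - _.
have cz : c * z = (- t)%:C%C by rewrite /z mulrN mulrC divfK// rmorphN.
have zh : Re (c * z) < h by rewrite cz /=; lra.
have [a1 a2 a3] := Hh _ zh.
have w0 := cexp_neq0 (c * z).
have qz : q.[cexp (c * z)] != 0.
  by rewrite -normc_gt0; apply: lt_le_trans a1; rewrite divr_gt0.
have Wz : (wronskian p q).[cexp (c * z)] != 0.
  by rewrite We hornerM horner_exp hornerXsubC subr0 mulf_neq0// expf_neq0.
rewrite /X (vfieldE p cE qz) (normcM (q.[_] ^+ 2)) normcV normcX (normcM (c * _)) (normcM c) normc_cexp.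
have -> : expR (Re (c * z)) = (expR t)^-1 by rewrite cz /= expRN.
rewrite ler_pdivlMr; last by rewrite !mulr_gt0 ?normc_gt0// invr_gt0 expR_gt0.
have Wn : 0 < normc (wronskian p q).[cexp (c * z)] by rewrite normc_gt0.
have cn : 0 < normc c by rewrite normc_gt0.
have e1 : K * expR t * (normc c * (expR t)^-1 * normc (wronskian p q).[cexp (c * z)]) =
    (normc q.[0] / 2) ^+ 2 * (normc (wronskian p q).[cexp (c * z)] / Wb).
  have [n1 n2 n3] : [/\ normc c != 0, Wb != 0 & expR t != 0] by rewrite !gt_eqF// expR_gt0.
  by rewrite /K; field; rewrite ?n1 ?n2 ?n3.
rewrite e1; apply: le_trans (_ : (normc q.[0] / 2) ^+ 2 <= _).
  by rewrite ler_piMr ?sqr_ge0// ler_pdivrMr// mul1r.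
by rewrite lerXn2r ?nnegrE ?divr_ge0 ?normc_ge0.
Qed.

Lemma essential_infty_left : q.[0] != 0 -> essential_singularity X (infty R).
Proof.
move=> q0 /meromorphic_infty_growth[B [rho [N [B0 rho1 H]]]].
have [K [t0 [K0 HK]]] := growth_left q0; have c0 := c_neq0 T0 cE.
have cn : 0 < normc c by rewrite normc_gt0.
have [t [tt ht]] := exp_beats_power (B / normc c ^+ N) N
  (Num.max (Num.max t0 0) (rho * normc c)) K0.
move: tt; rewrite !ge_max => /andP[/andP[tt0 t_0] trho].
have nz : normc (- (t%:C%C / c)) = t / normc c by rewrite normcN normcM normcV normc_real ger0_norm.
have := H (- (t%:C%C / c)); rewrite nz ler_pdivlMr// => /(_ trho).
have := HK t tt0 => h1 h2; have := le_trans h1 h2.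
rewrite leNgt => /negP; apply; apply: le_lt_trans ht.
by rewrite exprMn exprVn mulrCA -mulrA (mulrC (t ^+ N)) -mulrA lexx.
Qed.

Lemma pole_unbounded (z0 : C) (l : nat) : (0 < l)%N -> order_at X z0 (- l%:Z) ->
  forall B : R, exists2 z, normc (z - z0) < 1 & B < normc (X z).
Proof.
move=> l0 [h [/nbhs_singleton/derivableC_ex[d hd] h0 /near_dnbhsCP[e e0 H]]] B.
have hc := is_deriveC_cvg hd; have N0 : 0 < normc (h z0) by rewrite normc_gt0.
have /nbhsCP[e1 e10 H1] := hc _ (divr_gt0 N0 (ltr0Sn R 1)).
pose B1 := normc (h z0) / 2 / (`|B| + 1).
have b1 : 0 < `|B| + 1 by rewrite ltr_wpDl.
have B10 : 0 < B1 by rewrite !divr_gt0.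
pose s := Num.min (Num.min e e1) (Num.min 1 B1) / 2.
have s0 : 0 < s by rewrite divr_gt0// !lt_min e0 e10 ltr01 B10.
have sl : s < Num.min (Num.min e e1) (Num.min 1 B1).
  by rewrite /s ltr_pdivrMr// ltr_pMr ?ltr1n// !lt_min e0 e10 ltr01 B10.
move: sl; rewrite !lt_min => /andP[/andP[se se1] /andP[s1 sB]].
have nz : normc (z0 + s%:C%C - z0) = s by rewrite addrC addKr normc_real gtr0_norm.
exists (z0 + s%:C%C); first by rewrite nz.
have zz : z0 + s%:C%C != z0.
  by rewrite -subr_eq0 -normc_eq0 nz gt_eqF.
rewrite H ?nz// normcM -exprnN normcV normcX nz.
have hb : normc (h z0) / 2 < normc (h (z0 + s%:C%C)).
  have := H1 (z0 + s%:C%C); rewrite nz => /(_ se1) /= g.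
  have := normc_dist (h (z0 + s%:C%C)) (h z0); rewrite ler_norml => /andP[g2 _].
  by move: g g2; lra.
have sle' k : (0 < k)%N -> s ^+ k <= s.
  by case: k => // k _; rewrite exprS ler_piMr ?(ltW s0)// exprn_ile1 ?(ltW s0)// ltW.
have sle := sle' l l0.
have sp : 0 < s ^+ l by rewrite exprn_gt0.
rewrite mulrC ltr_pdivlMr//; apply: le_lt_trans hb.
apply: (@le_trans _ _ ((`|B| + 1) * B1)); last by rewrite /B1 mulrC divfK// gt_eqF.
apply: (@le_trans _ _ ((`|B| + 1) * s ^+ l)).
  by rewrite ler_wpM2r ?(ltW sp)//; have := ler_norm B; lra.
by rewrite ler_pM2l//; apply: le_trans sle (ltW sB).
Qed.

Lemma translate_far (z0 : C) (rho : R) : exists n : nat, rho <= normc (z0 + T *~ n%:Z).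
Proof.
have Tn : 0 < normc T by rewrite normc_gt0.
have [n hn] : exists n : nat, (rho + normc z0) / normc T <= n%:R.
  exists (Num.truncn `|(rho + normc z0) / normc T|).+1.
  have /andP[_ h] := truncn_itv (normr_ge0 ((rho + normc z0) / normc T)).
  by apply: le_trans (ltW h); exact: ler_norm.
exists n; move: hn; rewrite ler_pdivrMr// => hn.
have : normc (T *~ n%:Z) = n%:R * normc T.
  have -> : T *~ n%:Z = (n%:R : R)%:C%C * T by rewrite -pmulrn rmorph_nat mulr_natl.
  by rewrite normcM normc_real normr_nat.
have := normcD (z0 + T *~ n%:Z) (- z0); rewrite addrAC subrr add0r normcN.
by move=> h1 h2; move: h1; rewrite h2; lra.
Qed.

Lemma essential_infty_pole (w : C) : w != 0 -> q.[w] != 0 -> (wronskian p q).[w] = 0 ->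
  essential_singularity X (infty R).
Proof.
move=> w0 qw Ww /meromorphic_infty_growth[B [rho [N [B0 rho1 H]]]].
have [l [l0 Hl]] := pole_vfield T0 cE r1 pq w0 qw Ww.
have [s sw] := cexp_surj w0; have c0 := c_neq0 T0 cE.
have [n hn] := translate_far (s / c) (rho + 1).
set z0 := s / c + _ in hn.
have Ez : cexp (c * z0) = w by rewrite /z0 cE cexp_period// -cE mulrC divfK.
(* As |z0| >= rho + 1, the unit disk about z0 lies where the growth bound holds, and there that
   bound is at most B (|z0| + 1)^N. *)
have [z zz hz] := pole_unbounded l0 (Hl z0 Ez) (B * (normc z0 + 1) ^+ N).
have := normc_dist z z0; rewrite ler_norml => /andP[g1 g2].
have := H z ltac:(by move: g1 zz hn; lra).
rewrite leNgt => /negP; apply; apply: le_lt_trans hz.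
rewrite ler_wpM2l ?(ltW B0)// lerXn2r ?nnegrE ?addr_ge0 ?normc_ge0//.
by move: g2 zz; lra.
Qed.

End Infinity.

Lemma essential_infty (T : C) (p q : {poly C}) (r : nat) : T != 0 -> (1 <= r)%N ->
  degree_pair r p q -> essential_singularity (vfield (exp_pullback T (ratfun p q))) (infty R).
Proof.
move=> T0 r1 pq.
have [q0|q0] := eqVneq q.[0] 0; last exact: essential_infty_left T0 erefl r1 pq q0.
have [qr|qr] := eqVneq q`_r 0.
  have [w [w0 qw Ww]] := critical_point_exists r1 pq q0 qr.
  exact: (@essential_infty_pole T _ p q r T0 erefl r1 pq w w0 qw Ww).
rewrite -(exp_pullback_revp T pq).
have TN : - T != 0 by rewrite oppr_eq0.
apply: (essential_infty_left TN erefl r1 (degree_pair_revp pq)).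
by rewrite revp0.
Qed.

End EssentialSingularity.



(** * Recovering the configuration from Psi *)

Section Subfamilies.
Variable R : realType.
Local Notation C := R[i].

(** R(0) is the value over which any left-end singularity of Psi lies, so it depends on Psi alone;
    this separates the subfamilies. *)
Lemma pullback_value0 (T : C) (p q p' q' : {poly C}) (r : nat) : T != 0 -> (1 <= r)%N ->
  degree_pair r p q -> degree_pair r p' q' ->
  exp_pullback T (ratfun p q) = exp_pullback T (ratfun p' q') ->
  ratfun p q (fin 0) = ratfun p' q' (fin 0).
Proof.
move=> T0 r1 pq pq' e.
have [U [tU lU]] := left_singularity_exists T0 erefl r1 pq.
rewrite e in tU; exact: (left_end_value T0 erefl r1 pq' tU lU).
Qed.

Lemma pullback_value_infty (T : C) (p q p' q' : {poly C}) (r : nat) : T != 0 -> (1 <= r)%N ->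
  degree_pair r p q -> degree_pair r p' q' ->
  exp_pullback T (ratfun p q) = exp_pullback T (ratfun p' q') ->
  ratfun p q (infty R) = ratfun p' q' (infty R).
Proof.
move=> T0 r1 pq pq' e; rewrite -(ratfun_revp0 pq) -(ratfun_revp0 pq').
have TN : - T != 0 by rewrite oppr_eq0.
apply: (pullback_value0 TN r1 (degree_pair_revp pq) (degree_pair_revp pq')).
by rewrite !exp_pullback_revp.
Qed.

Lemma subfamily_trivIset (T : C) (r : nat) : T != 0 -> (1 <= r)%N ->
  trivIset [set: configuration] (@subfamily R r T).
Proof.
move=> T0 r1 i j _ _ [Psi [[F [[p [q [pq ->]]] -> hi]] [F' [[p' [q' [pq' ->]]] e hj]]]].
move: hi; rewrite (pullback_value0 T0 r1 pq pq' e) (pullback_value_infty T0 r1 pq pq' e).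
move: hj; set a := ratfun p' q' (fin 0); set b := ratfun p' q' (infty R).
by case: i; case: j => //=; move=> h1 h2; exfalso; case: h1; case: h2; intuition congruence.
Qed.

Lemma subfamily_cover (T : C) (r : nat) :
  exp_family r T = \bigcup_c @subfamily R r T c.
Proof.
apply/seteqP; split=> [Psi [F hF ->]|Psi [k _ [F [hF -> _]]]]; last by exists F.
have [e1|n1] := pselect (F (fin 0) = infty R); have [e2|n2] := pselect (F (infty R) = infty R).
- by exists BothInfinite => //; exists F.
- by exists OneInfinite => //; exists F; split => //; right.
- by exists OneInfinite => //; exists F; split => //; left.
have [e|n] := pselect (F (fin 0) = F (infty R)).
  by exists EqualFinite => //; exists F.
by exists ThreePoints => //; exists F.
Qed.

Lemma near_poly_neq0 (g : {poly C}) : g != 0 -> \forall t \near (0 : C)^', g.[t] != 0.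
Proof.
move=> g0; have [m [g1 [ge g10]]] := root_factor 0 g0.
have [e e0 H] := proj1 (nbhsCP _ _) (clim_neq0 (is_deriveC_cvg (is_deriveC_poly g1 (0 : C))) g10).
apply/near_dnbhsCP; exists e => // t t0 te.
rewrite ge hornerM horner_exp hornerXsubC subr0 mulf_neq0 ?expf_neq0//.
exact: H.
Qed.

Lemma punctured_ex (P Q : C -> Prop) : (\forall t \near (0 : C)^', P t) ->
  (\forall t \near (0 : C), Q t) -> exists t, P t /\ Q t.
Proof.
move=> /near_dnbhsCP[e1 e10 H1] /nbhsCP[e2 e20 H2].
pose s := Num.min e1 e2 / 2; have s0 : 0 < s by rewrite divr_gt0// lt_min e10.
have sl : s < Num.min e1 e2 by rewrite ltr_pdivrMr// ltr_pMr ?ltr1n// lt_min e10.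
move: sl; rewrite lt_min => /andP[s1 s2].
have n : normc (s%:C%C - 0) = s by rewrite subr0 normc_real gtr0_norm.
exists s%:C%C; split; first by apply: H1; rewrite ?n// -normc_eq0 -[X in normc X]subr0 n gt_eqF.
by apply: H2; rewrite n.
Qed.

Lemma clim_comp_poly (p : {poly C}) (i : nat) :
  clim (nbhs (0 : C)) (fun t => (p \Po ('X + t%:P))`_i) p`_i.
Proof.
elim/poly_ind: p i => [|p a IH] i.
  by apply: clim_near (clim_cst (F := nbhs (0:C)) _); apply: nearCW => t; rewrite comp_poly0.
have E t j : ((p * 'X + a%:P) \Po ('X + t%:P))`_j =
    (if j is k.+1 then (p \Po ('X + t%:P))`_k else 0) + t * (p \Po ('X + t%:P))`_j +
    (if j == 0%N then a else 0).
  rewrite comp_polyD comp_polyM comp_polyX comp_polyC mulrDr !coefD coefC coefMX mulrC coefCM.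
  by case: j.
have -> : (p * 'X + a%:P)`_i = (if i is k.+1 then p`_k else 0) + 0 * p`_i + (if i == 0%N then a else 0).
  by rewrite coefD coefMX coefC mul0r addr0; case: (i).
apply: (clim_near (F := nbhs (0 : C)) (f := fun t => (if i is k.+1 then (p \Po ('X + t%:P))`_k else 0) +
   t * (p \Po ('X + t%:P))`_i + (if i == 0%N then a else 0))).
  by apply: nearCW => t; rewrite E.
apply: climD; last exact: clim_cst.
apply: climD; last by apply: climM; [exact: clim_id|exact: IH].
by case: (i) => [|k]; [exact: clim_cst|exact: IH].
Qed.

Lemma clim_row (n : nat) (f : C -> 'rV[C]_n) (v : 'rV[C]_n) (G : set 'rV[C]_n) :
  (forall i, clim (nbhs (0 : C)) (fun t => f t 0 i) (v 0 i)) -> open G -> G v ->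
  \forall t \near (0 : C), G (f t).
Proof.
move=> H oG Gv; have [P HP sP] : nbhs v G by exact: open_nbhs_nbhs.
have : \forall t \near (0 : C), forall i, P 0 i (f t 0 i).
  apply: (@filter_forall C _ _ (nbhs (0 : C))) => i; have /nbhsCP[e e0 he] := HP 0 i.
  by apply: filterS (H i e e0) => t; exact: he.
by apply: filterS => t ht; apply: sP => i j; rewrite ord1; exact: ht.
Qed.

(** * Openness and density of the three-point configuration *)

Section Generic.
Local Open Scope quotient_scope.
Variable r : nat.
Hypothesis r1 : (1 <= r)%N.
Local Notation PS := (projective_space R (r.+1 + r.+1)).
Local Notation row := 'rV[C]_(r.+1 + r.+1).

Lemma numeratorE (v : row) (i : 'I_r.+1) : (numerator v)`_i = v 0 (lshift r.+1 i).
Proof. by rewrite /numerator coef_rVpoly_ord mxE. Qed.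

Lemma denominatorE (v : row) (i : 'I_r.+1) : (denominator v)`_i = v 0 (rshift r.+1 i).
Proof. by rewrite /denominator coef_rVpoly_ord mxE. Qed.

Lemma numeratorZ (k : C) (v : row) : numerator (k *: v) = k *: numerator v.
Proof. by rewrite /numerator !linearZ. Qed.

Lemma denominatorZ (k : C) (v : row) : denominator (k *: v) = k *: denominator v.
Proof. by rewrite /denominator !linearZ. Qed.

(** Three distinct points, stated as nonvanishing of homogeneous polynomials in the coefficients: an
    open condition, stable under scaling of the row. *)
Definition separated (v : row) : Prop :=
  [/\ (denominator v).[0] != 0, (denominator v)`_r != 0 &
      (numerator v).[0] * (denominator v)`_r - (numerator v)`_r * (denominator v).[0] != 0].

Lemma separatedP (v : row) : degree_pair r (numerator v) (denominator v) ->
  let F := ratfun (numerator v) (denominator v) in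
  has_configuration ThreePoints (F (fin 0)) (F (infty R)) <-> separated v.
Proof.
move=> pq F; rewrite /F (ratfun_infty pq) ratfun_fin /separated /=.
set a := (numerator v).[0]; set b := (denominator v).[0].
set a' := (numerator v)`_r; set b' := (denominator v)`_r.
have [b0|b0] := eqVneq b 0; first by split=> [[_ []]|[]].
have [b0'|b0'] := eqVneq b' 0; first by split=> [[_ _ []]|[]].
have E : (a * b' - a' * b == 0) = (a / b == a' / b').
  by rewrite subr_eq0 eqr_div.
split=> [[n _ _]|[_ _ n]]; split => //.
  by rewrite E; apply/eqP => e; apply: n; rewrite e.
by case=> /eqP; rewrite -E; apply/negP.
Qed.

Lemma separatedZ (k : C) (v : row) : k != 0 -> separated v -> separated (k *: v).
Proof.
move=> k0 [h1 h2 h3]; rewrite /separated numeratorZ denominatorZ !hornerZ !coefZ.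
split; rewrite ?mulf_neq0//.
have -> : k * (numerator v).[0] * (k * (denominator v)`_r) -
   k * (numerator v)`_r * (k * (denominator v).[0]) =
   k * k * ((numerator v).[0] * (denominator v)`_r - (numerator v)`_r * (denominator v).[0]) by ring.
by rewrite !mulf_neq0.
Qed.

Lemma degree_pairZ (k : C) (v : row) : k != 0 ->
  degree_pair r (numerator v) (denominator v) ->
  degree_pair r (numerator (k *: v)) (denominator (k *: v)).
Proof.
move=> k0 [h1 h2]; rewrite numeratorZ denominatorZ; split.
  by rewrite coprimepZl// coprimepZr.
by rewrite !size_scale.
Qed.

Lemma repr_proportional (u : nonzero_row R (r.+1 + r.+1)) :
  exists2 k : C, k != 0 & \val (repr (\pi_PS u : PS)) = k *: \val u.
Proof.
have /eqmodP : repr (\pi_PS u : PS) = u %[mod PS] by rewrite reprK.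
rewrite /= /proportional => /andP[/sub_rVP[k hk] _].
exists k => //; apply/eqP => k0; have := set_valP (repr (\pi_PS u : PS)).
by rewrite /= hk k0 scale0r eqxx.
Qed.

Lemma proportional_repr (u : nonzero_row R (r.+1 + r.+1)) :
  exists2 k : C, k != 0 & \val u = k *: \val (repr (\pi_PS u : PS)).
Proof.
have [k k0 hk] := repr_proportional u.
by exists k^-1; rewrite ?invr_eq0// hk scalerA mulVf// scale1r.
Qed.

Lemma entry_lshift (v : row) : (numerator v).[0] = v 0 (lshift r.+1 ord0) /\
  (numerator v)`_r = v 0 (lshift r.+1 ord_max).
Proof. by rewrite horner_coef0 -!numeratorE. Qed.

Lemma entry_rshift (v : row) : (denominator v).[0] = v 0 (rshift r.+1 ord0) /\
  (denominator v)`_r = v 0 (rshift r.+1 ord_max).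
Proof. by rewrite horner_coef0 -!denominatorE. Qed.

Lemma open_separated : open [set v : row | separated v].
Proof.
rewrite openE => v [h1 h2 h3]; rewrite /interior.
have cc i : clim (nbhs v) (fun u : row => u 0 i) (v 0 i).
  by apply/climP; exact: (@coord_continuous _ _ _ 0 i v).
have [n0 nr] := entry_lshift v; have [d0 dr] := entry_rshift v.
rewrite n0 nr d0 dr in h1 h2 h3.
have c3 : clim (nbhs v) (fun u : row => u 0 (lshift r.+1 ord0) * u 0 (rshift r.+1 ord_max) +
    (-1) * (u 0 (lshift r.+1 ord_max) * u 0 (rshift r.+1 ord0)))
   (v 0 (lshift r.+1 ord0) * v 0 (rshift r.+1 ord_max) +
    (-1) * (v 0 (lshift r.+1 ord_max) * v 0 (rshift r.+1 ord0))).
  by apply: climD; apply: climM => //; [exact: clim_cst|apply: climM].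
rewrite -mulN1r in h3.
apply: filterS3 (clim_neq0 (cc _) h1) (clim_neq0 (cc _) h2) (clim_neq0 c3 h3) => u g1 g2 g3.
have [m0 mr] := entry_lshift u; have [e0 er] := entry_rshift u.
by rewrite /= /separated m0 mr e0 er -mulN1r.
Qed.

Lemma generic_open : exists2 O : set PS, open O &
  parameters r (fun F => has_configuration ThreePoints (F (fin 0)) (F (infty R))) =
  parameters r (fun _ => True) `&` O.
Proof.
exists [set x : PS | separated (\val (repr x))].
  (* The two sides are convertible: openness in the quotient topology is openness of the
     preimage. *)
  have -> : open [set x : PS | separated (\val (repr x))] =
     open (\pi_PS @^-1` [set x : PS | separated (\val (repr x))]) by [].
  exists [set v : row | separated v]; first exact: open_separated.
  apply/seteqP; split=> u /=.
    by move=> su; have [k k0 ->] := repr_proportional u; exact: separatedZ.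
  by move=> su; have [k k0 e] := proportional_repr u; have := separatedZ k0 su; rewrite -e.
apply/seteqP; split=> x /=; rewrite /parameters /=.
  by move=> [pq hc]; split => //; apply/(separatedP pq).
by move=> [[pq _] sx]; split => //; apply/(separatedP pq).
Qed.

Definition pair_row (p q : {poly C}) : row := row_mx (poly_rV p) (poly_rV q).

Lemma numerator_pair (p q : {poly C}) : (size p <= r.+1)%N -> numerator (pair_row p q) = p.
Proof. by move=> sp; rewrite /numerator /pair_row row_mxKl poly_rV_K. Qed.

Lemma denominator_pair (p q : {poly C}) : (size q <= r.+1)%N -> denominator (pair_row p q) = q.
Proof. by move=> sq; rewrite /denominator /pair_row row_mxKr poly_rV_K. Qed.

Lemma pair_rowK (v : row) : pair_row (numerator v) (denominator v) = v.
Proof. by rewrite /pair_row /numerator /denominator !rVpolyK hsubmxK. Qed.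

Lemma clim_pair_row (p q : C -> {poly C}) (p0 q0 : {poly C}) (G : set row) :
  (forall i, clim (nbhs (0 : C)) (fun t => (p t)`_i) p0`_i) ->
  (forall i, clim (nbhs (0 : C)) (fun t => (q t)`_i) q0`_i) ->
  open G -> G (pair_row p0 q0) -> \forall t \near (0 : C), G (pair_row (p t) (q t)).
Proof.
move=> hp hq oG Gv; apply: (clim_row (v := pair_row p0 q0)) => // i.
rewrite /pair_row -(splitK i); case: (fintype.split i) => j /=.
  rewrite row_mxEl mxE; apply: clim_near (hp j).
  by apply: nearCW => t; rewrite row_mxEl mxE.
rewrite row_mxEr mxE; apply: clim_near (hq j).
by apply: nearCW => t; rewrite row_mxEr mxE.
Qed.

(** Where R(t) and R(oo) are finite, the value of this polynomial at t is q_r q(t) (R(t) - R(oo)).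
    Were it zero, p and q would be proportional, and by coprimality constant. *)
Lemma cross_neq0 (p q : {poly C}) : degree_pair r p q -> q`_r *: p - p`_r *: q != 0.
Proof.
move=> pq; apply/eqP => e; have [cop sz] := pq.
have H (s : {poly C}) : coprimep s s -> (size s <= 1)%N.
  by rewrite coprimep_def gcdpp => /eqP ->.
have eq : q`_r *: p = p`_r *: q by apply/eqP; rewrite -subr_eq0 e.
have sc (s : {poly C}) : (size s <= 1)%N -> s`_r = 0.
  by move=> ss; rewrite nth_default// (leq_trans ss).
have [p0|p0] := eqVneq p`_r 0.
  have q0 := top_neq0 pq p0.
  have pz : p = 0 by apply/eqP; move: eq; rewrite p0 scale0r => /eqP; rewrite scaler_eq0 (negbTE q0).
  move: cop; rewrite pz coprime0p => /eqp_size; rewrite size_poly1 => sq.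
  by move: q0; rewrite sc ?eqxx// sq.
have q_e : q = ((p`_r)^-1 * q`_r) *: p by rewrite -scalerA eq scalerA mulVf// scale1r.
have [q0|q0] := eqVneq q`_r 0.
  have qz : q = 0 by rewrite q_e q0 mulr0 scale0r.
  move: cop; rewrite qz coprimep0 => /eqp_size; rewrite size_poly1 => sp.
  by move: p0; rewrite sc ?eqxx// sp.
have : (size p <= 1)%N.
  by apply: H; move: cop; rewrite q_e coprimepZr// mulf_neq0// invr_eq0.
by move=> /sc pr; rewrite pr eqxx in p0.
Qed.

(* Replacing [(p, q)] by [(p(w + t), q(w + t))], then by [(p, q + s p)], for small
   [t] and [s] separates the values at [0] and [oo] and makes them finite. *)
Lemma separated_dense (v : row) (G : set row) : open G -> G v ->
  degree_pair r (numerator v) (denominator v) ->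
  exists u, [/\ G u, degree_pair r (numerator u) (denominator u) & separated u].
Proof.
move=> oG Gv; set p := numerator v; set q := denominator v => pq.
have [sp sq] := degree_pair_sizes pq; have [cop sz] := pq.
pose sh (t : C) (s : {poly C}) := s \Po ('X + t%:P).
have sX (t : C) : size ('X + t%:P) = 2%N by rewrite size_XaddC.
have ssh t s : size (sh t s) = size s by exact: size_comp_poly2.
have topsh (t : C) (s : {poly C}) : (size s <= r.+1)%N -> (sh t s)`_r = s`_r.
  rewrite leq_eqVlt => /orP[/eqP ss|ss]; last first.
    by rewrite !nth_default ?ssh// -ltnS.
  have e1 : s`_r = lead_coef s by rewrite lead_coefE ss.
  have -> : (sh t s)`_r = lead_coef (sh t s) by rewrite lead_coefE ssh ss.
  rewrite e1 /sh lead_coef_comp ?sX//.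
  have -> : lead_coef ('X + t%:P) = 1 by rewrite -(opprK t) polyCN lead_coefXsubC.
  by rewrite expr1n mulr1.
have sh0 (t : C) (s : {poly C}) : (sh t s).[0] = s.[t] by rewrite horner_comp !hornerE.
have nearG : \forall t \near (0 : C), G (pair_row (sh t p) (sh t q)).
  apply: (clim_pair_row (p0 := p) (q0 := q)) => //; last by rewrite pair_rowK.
    by move=> i; exact: clim_comp_poly.
  by move=> i; exact: clim_comp_poly.
(* Translation by t makes R(t) the value at 0 and leaves the coefficients of index r, hence the
   value at oo, unchanged. *)
have [t [ht Gt]] := punctured_ex (near_poly_neq0 (cross_neq0 pq)) nearG.
pose p1 : {poly C} := sh t p; pose q1 : {poly C} := sh t q.
have cop1 : coprimep p1 q1 by exact: coprimep_comp_poly.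
(* Replacing q by q + s p turns R into R / (1 + s R): distinct values stay distinct, and all but
   finitely many s make both of them finite. *)
have nearG2 : \forall s \near (0 : C), G (pair_row p1 (q1 + s *: p1)).
  apply: (clim_pair_row (p0 := p1) (q0 := q1)) => // i; first exact: clim_cst.
  have -> : q1`_i = q1`_i + 0 * p1`_i by rewrite mul0r addr0.
  apply: (clim_near (F := nbhs (0 : C)) (f := fun s => q1`_i + s * p1`_i)).
    by apply: nearCW => s; rewrite coefD coefZ.
  by apply: climD; [exact: clim_cst|apply: climM; [exact: clim_id|exact: clim_cst]].
have lin_neq0 (a b : C) : (a != 0) || (b != 0) -> \forall s \near (0 : C)^', b + s * a != 0.
  move=> ab; have : a *: 'X + b%:P != 0 :> {poly C}.
    apply/eqP => e; have := congr1 (fun s : {poly C} => s`_0) e; have := congr1 (fun s : {poly C} => s`_1) e.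
    rewrite !coefD !coefZ !coefX !coefC /= !mulr1 mulr0 addr0 add0r => a0 b0.
    by move: ab; rewrite a0 b0 eqxx.
  by move=> /near_poly_neq0; apply: filterS => s; rewrite !hornerE addrC mulrC.
have h1 : \forall s \near (0 : C)^', q.[t] + s * p.[t] != 0.
  apply: lin_neq0; have [pt|//] := eqVneq p.[t] 0.
  by apply: coprimep_root cop _; rewrite /root pt.
have h2 : \forall s \near (0 : C)^', q`_r + s * p`_r != 0.
  by apply: lin_neq0; have [pr|//] := eqVneq p`_r 0; exact: top_neq0 pq pr.
have [s [[s1 s2] Gs]] := punctured_ex (filterI h1 h2) nearG2.
have sp1 : (size p1 <= r.+1)%N by rewrite ssh.
have sq1 : (size (q1 + s *: p1)%R <= r.+1)%N.
  apply: leq_trans (size_polyD _ _) _; rewrite geq_max ssh sq /=.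
  by apply: leq_trans (size_scale_leq _ _) _.
exists (pair_row p1 (q1 + s *: p1)); split => //.
  rewrite numerator_pair// denominator_pair//; split.
    by rewrite addrC -mul_polyC coprimep_addl_mul.
  apply/eqP; rewrite eqn_leq geq_max sp1 sq1 /=.
  move: sz; rewrite -(ssh t p) -/p1 => sz.
  have [pr|pr] := ltnP r (size p1); first by rewrite leq_max pr.
  have qr : size q = r.+1.
    by move: sz; rewrite /maxn; case: ltnP => // h e; rewrite e ltnn in pr.
  rewrite leq_max size_polyDl ?ssh ?qr ?leqnn ?orbT//.
  by apply: leq_ltn_trans (size_scale_leq _ _) _; rewrite ltnS.
rewrite /separated numerator_pair// denominator_pair//.
rewrite !hornerD !hornerZ !coefD !coefZ /p1 /q1 !sh0 !topsh//; split => //.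
move: ht; rewrite hornerD hornerN !hornerZ.
have -> : p.[t] * (q`_r + s * p`_r) - p`_r * (q.[t] + s * p.[t]) =
  q`_r * p.[t] - p`_r * q.[t] by ring.
by [].
Qed.

Lemma degree_pair_row_neq0 (u : row) : degree_pair r (numerator u) (denominator u) -> u != 0.
Proof.
move=> [cop sz]; apply/eqP => u0; move: sz.
have -> : numerator u = 0 by rewrite u0 /numerator !linear0.
have -> : denominator u = 0 by rewrite u0 /denominator !linear0.
by rewrite size_poly0.
Qed.

Lemma generic_dense : parameters r (fun _ : sphere R -> sphere R => True) `<=`
  closure (parameters r (fun F => has_configuration ThreePoints (F (fin 0)) (F (infty R)))).
Proof.
move=> x [pq _] B; rewrite nbhsE => -[B' [oB' B'x] BB].
have [G oG GE] : open (\pi_PS @^-1` B') by exact: oB'.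
have Gx : G (\val (repr x)).
  have : (\pi_PS @^-1` B') (repr x) by rewrite /preimage /= reprK.
  by rewrite -GE.
have [u [Gu pqu su]] := separated_dense oG Gx pq.
pose u' : nonzero_row R (r.+1 + r.+1) := exist _ u (mem_set (degree_pair_row_neq0 pqu)).
exists (\pi_PS u' : PS); split; last first.
  by apply: BB; have : (\pi_PS @^-1` B') u' by rewrite -GE.
have [k k0 hk] := repr_proportional u'.
have pq' : degree_pair r (numerator (\val (repr (\pi_PS u' : PS))))
    (denominator (\val (repr (\pi_PS u' : PS)))).
  by rewrite hk; exact: degree_pairZ.
split => //; apply/(separatedP pq'); rewrite hk; exact: separatedZ.
Qed.

Lemma three_points_generic :
  generic r (fun F : sphere R -> sphere R => has_configuration ThreePoints (F (fin 0)) (F (infty R))).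
Proof. by split; [exact: generic_open|exact: generic_dense]. Qed.

End Generic.

End Subfamilies.

(** * Both ends together, and the assertions *)

Section Theorem5.
Variable R : realType.
Local Notation C := R[i].

Lemma left_right_disjoint (c : C) (Psi : C -> sphere R) (a b : sphere R) (U V : R -> set C) :
  transcendental_singularity Psi a U -> left_end c U ->
  transcendental_singularity Psi b V -> right_end c V -> ~ same_germ U V.
Proof.
move=> [cU mU _] [r1 r10 h1] [cV mV _] [r2 r20 h2] UV.
have n1 : \forall rho \near (0 : R)^'+, rho < r1 by apply: nbhs_right_lt.
have n2 : \forall rho \near (0 : R)^'+, rho < r2 by apply: nbhs_right_lt.
have n0 : \forall rho \near (0 : R)^'+, 0 < rho by exact: nbhs_right_gt.
have [rho [[e l1] [l2 rho0]]] : exists rho, (U rho = V rho /\ rho < r1) /\ (rho < r2 /\ 0 < rho).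
  by apply: (@filter_ex _ (0 : R)^'+); apply: filterI; exact: filterI.
have [z Uz] := component_nonempty (cU rho rho0).
have := h1 z (mU _ _ rho0 l1 z Uz); rewrite e in Uz.
have := h2 z (mV _ _ rho0 l2 z Uz); lra.
Qed.

Lemma is_derive_shift (f : C -> C) (w d : C) :
  is_derive (0 : C) (1 : C) (fun s => f (w + s)) d <-> is_derive w (1 : C) f d.
Proof.
split=> [h|h].
  have g : is_derive w (1 : C) (fun z : C => z - w) 1.
    apply: is_deriveC_eq (is_deriveC_D (is_deriveC_id w) (is_deriveC_cst w (- w))) _.
    by rewrite addr0.
  have h' : is_derive (w - w) (1 : C) (fun s => f (w + s)) d by rewrite subrr.
  have := is_deriveC_comp g h'; rewrite mulr1; apply: is_deriveC_near.
  by apply: nearCW => z; rewrite addrC subrK.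
have g : is_derive (0 : C) (1 : C) (fun s : C => w + s) 1.
  apply: is_deriveC_eq (is_deriveC_D (is_deriveC_cst 0 w) (is_deriveC_id 0)) _.
  by rewrite add0r.
have h' : is_derive (w + 0) (1 : C) f d by rewrite addr0.
by have := is_deriveC_comp g h'; rewrite mulr1.
Qed.

Lemma critical_regular (p q : {poly C}) (w : C) : q.[w] != 0 ->
  critical_points (ratfun p q) (fin w) -> (wronskian p q).[w] = 0.
Proof.
move=> qw; rewrite /critical_points /= (negbTE qw) => h.
have {}h : is_derive w (1 : C) (fun x => p.[x] / q.[x]) 0.
  apply/is_derive_shift; apply: is_deriveC_near h; apply: nearCW => s /=.
  exact: chart_ratfun.
have /eqP := is_deriveC_uniq (is_derive_ratio p qw) h.
by rewrite mulf_eq0 invr_eq0 expf_eq0 (negbTE qw) andbF orbF => /eqP.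
Qed.

(** In the chart at oo the map is q / p, with derivative - W / p^2, and W vanishes at a multiple
    root of q. In contrapositive form: a noncritical pole is simple. *)
Lemma critical_multiple_pole (p q q1 : {poly C}) (w : C) (m : nat) :
  q = ('X - w%:P) ^+ m.+2 * q1 -> p.[w] != 0 -> q1.[w] != 0 ->
  critical_points (ratfun p q) (fin w).
Proof.
move=> qE pw q1w; have qw : q.[w] = 0.
  by rewrite qE hornerM horner_exp hornerXsubC subrr expr0n mul0r.
rewrite /critical_points /= qw eqxx.
apply: (@is_deriveC_near _ (fun s => q.[w + s] / p.[w + s])).
  by apply: nearCW => s; rewrite -chart_infty_ratfun.
apply/(is_derive_shift (fun x => q.[x] / p.[x])).
apply: is_deriveC_eq (is_derive_ratio q pw) _.
have [W1 [WE _]] := wronskian_factor qE pw q1w.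
have -> : wronskian q p = - wronskian p q by rewrite /wronskian opprB [p * _]mulrC [_ * q]mulrC.
by rewrite WE hornerN hornerM horner_exp hornerXsubC subrr expr0n mul0r oppr0 mul0r.
Qed.

Lemma accumulating_fiber (T w : C) (S : set C) : T != 0 -> w != 0 ->
  (forall z, cexp (period_coef T * z) = w -> S z) ->
  infinitely_many_accumulating_at S (infty R).
Proof.
move=> T0 w0 H; have [s sw] := cexp_surj w0.
apply: (@accumulating_at_infty _ T (s / period_coef T)) => // n.
by apply: H; rewrite cexp_period// mulrC divfK// period_coef_neq0.
Qed.

Section Assertions.
Variables (T : C) (r : nat) (p q : {poly C}).
Hypotheses (T0 : T != 0) (r1 : (1 <= r)%N) (pq : degree_pair r p q).
Local Notation F := (ratfun p q).
Local Notation Psi := (exp_pullback T F).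
Local Notation X := (vfield Psi).
Local Notation c := (period_coef T).

Let TN : - T != 0. Proof. by rewrite oppr_eq0. Qed.
Let pqN := degree_pair_revp pq.
Let cN : - c = period_coef (- T). Proof. by rewrite period_coefN. Qed.

Lemma right_singularity_exists : exists U,
  transcendental_singularity Psi (F (infty R)) U /\ right_end c U.
Proof.
have [U [tU lU]] := left_singularity_exists TN cN r1 pqN.
exists U; rewrite -(ratfun_revp0 pq) -(exp_pullback_revp T pq); split => //.
exact/left_end_opp.
Qed.

Lemma right_end_value (a : sphere R) U : transcendental_singularity Psi a U ->
  right_end c U -> a = F (infty R).
Proof.
rewrite -(exp_pullback_revp T pq) -(ratfun_revp0 pq) => tU /left_end_opp lU.
exact: (left_end_value TN cN r1 pqN tU lU).
Qed.

Lemma right_unique (a : sphere R) U V : transcendental_singularity Psi a U -> right_end c U ->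
  transcendental_singularity Psi a V -> right_end c V -> same_germ U V.
Proof.
rewrite -(exp_pullback_revp T pq) => tU /left_end_opp lU tV /left_end_opp lV.
exact: (left_unique TN cN r1 pqN tU lU tV lV).
Qed.

Lemma period_and_essential : (forall z, X (z + T) = X z) /\
  (forall x : sphere R, essential_singularity X x <-> x = infty R).
Proof.
split=> [z|x]; first exact: (vfield_periodic p q T0 erefl z 1).
split=> [|->]; last exact: essential_infty T0 r1 pq.
case: x => // z h; exfalso; apply: h.
exact: (vfield_meromorphic T0 erefl r1 pq z).
Qed.

Lemma two_singularities : exists U1 U2 : R -> set C,
  [/\ transcendental_singularity Psi (F (fin 0)) U1,
      transcendental_singularity Psi (F (infty R)) U2,
      ~ (F (fin 0) = F (infty R) /\ same_germ U1 U2) &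
      forall a U, transcendental_singularity Psi a U ->
        (a = F (fin 0) /\ same_germ U U1) \/ (a = F (infty R) /\ same_germ U U2)].
Proof.
have [U1 [t1 l1]] := left_singularity_exists T0 erefl r1 pq.
have [U2 [t2 l2]] := right_singularity_exists.
exists U1, U2; split => // [[_ sg]|a U tU].
  exact: (left_right_disjoint t1 l1 t2 l2 sg).
case: (singularity_ends T0 erefl r1 pq tU) => [lU|lU]; [left|right].
  have e := left_end_value T0 erefl r1 pq tU lU; split => //; rewrite e in tU.
  exact: (left_unique T0 erefl r1 pq tU lU t1 l1).
have e := right_end_value tU lU; split => //; rewrite e in tU.
exact: (right_unique tU lU t2 l2).
Qed.

Lemma singularity_type (a : sphere R) U : transcendental_singularity Psi a U ->
  [/\ logarithmic Psi a U, a <> infty R -> hyperbolic_tract U X &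
      a = infty R -> elliptic_tract U X].
Proof.
move=> tU; case: (singularity_ends T0 erefl r1 pq tU) => lU.
  by split; [exact: (left_logarithmic T0 erefl r1 pq tU lU)|
    exact: (left_hyperbolic T0 erefl r1 pq tU lU)|exact: (left_elliptic T0 erefl r1 pq tU lU)].
move: tU lU; rewrite -(exp_pullback_revp T pq) => tU /left_end_opp lU.
by split; [exact: (left_logarithmic TN cN r1 pqN tU lU)|
  exact: (left_hyperbolic TN cN r1 pqN tU lU)|exact: (left_elliptic TN cN r1 pqN tU lU)].
Qed.

Lemma asymptotic_infty :
  asymptotic_value Psi (infty R) <-> F (fin 0) = infty R \/ F (infty R) = infty R.
Proof.
split=> [[U tU]|].
  have [U1 [U2 [_ _ _ H]]] := two_singularities.
  by case: (H _ _ tU) => -[e _]; [left|right].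
have [U1 [U2 [t1 t2 _ _]]] := two_singularities.
by case=> e; [exists U1|exists U2]; rewrite -e.
Qed.

Lemma poles_limit_infty :
  (exists w, [/\ critical_points F w, w <> fin 0, w <> infty R & F w <> infty R]) ->
  infinitely_many_accumulating_at (poles X) (infty R).
Proof.
case=> -[w|] [cw w0 wi Fw] //.
have {}w0 : w != 0 by apply/eqP => e; apply: w0; rewrite e.
have qw : q.[w] != 0 by apply/eqP => e; apply: Fw; rewrite /= e eqxx.
have [l [l0 H]] := pole_vfield T0 erefl r1 pq w0 qw (critical_regular qw cw).
by apply: (accumulating_fiber T0 w0) => z /H oz; exists l.
Qed.

Lemma pole_factor (w : C) : q != 0 -> q.[w] = 0 ->
  exists (m : nat) (q1 : {poly C}), q = ('X - w%:P) ^+ m.+1 * q1 /\ q1.[w] != 0.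
Proof.
move=> q0 qw; have [[|m] [q1 [qE q1w]]] := root_factor w q0; last by exists m, q1.
by move: q1w; rewrite -(mul1r q1) -(expr0 ('X - w%:P)) -qE qw eqxx.
Qed.

(** Finiteness of R at oo forces deg q = r >= 1, so q has a root; finiteness at 0 makes it nonzero,
    and its fibre under E carries the zeros. A noncritical pole is a simple root, which selects
    multiplicity 2. *)
Lemma zeros_limit_infty : ~ asymptotic_value Psi (infty R) ->
  infinitely_many_accumulating_at
    [set z | (exists2 k, (2 <= k)%N & zeros_of_mult X k z) /\
             residue_at (time_form Psi) z 0] (infty R) /\
  ((exists w, F w = infty R /\ ~ critical_points F w) ->
   infinitely_many_accumulating_at
     [set z | zeros_of_mult X 2 z /\ residue_at (time_form Psi) z 0] (infty R)).
Proof.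
move=> na; have q0 : q.[0] != 0.
  by apply/eqP => e; apply/na/asymptotic_infty; left; rewrite ratfun_fin e eqxx.
have qr : q`_r != 0.
  by apply/eqP => e; apply/na/asymptotic_infty; right; rewrite (ratfun_infty pq) e eqxx.
have qn0 : q != 0 by apply: contraNneq q0 => ->; rewrite horner0.
have nz w : q.[w] = 0 -> w != 0 by move=> qw; apply: contraNneq q0 => w0; rewrite -[X in q.[X]]w0 qw.
have res z : residue_at (time_form Psi) z 0 by exact: (time_form_residue T0 erefl r1 pq z).
split.
  have [w qw] : exists w, q.[w] = 0.
    have : (1 < size q)%N by apply: contraNltn qr => sq; rewrite nth_default// (leq_trans sq).
    by move=> sq; have /closed_rootP[w /rootP] : size q != 1%N by [rewrite gtn_eqF|]; exists w.
  have [m [q1 [qE q1w]]] := pole_factor qn0 qw.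
  apply: (accumulating_fiber T0 (nz w qw)) => z zw; split => //.
  exists m.+2 => //; split => //; exact: (zero_vfield T0 erefl pq qE q1w zw).
case=> -[w|] [Fw ncw]; last first.
  by move: Fw; rewrite (ratfun_infty pq) (negbTE qr).
have qw : q.[w] = 0 by apply: contraPeq Fw => qw; rewrite /= (negbTE qw).
have pw : p.[w] != 0.
  by have [cop _] := pq; apply/negP => pw; have := coprimep_root cop pw; rewrite qw eqxx.
have [[|m] [q1 [qE q1w]]] := pole_factor qn0 qw; last first.
  by case: ncw; exact: (critical_multiple_pole qE).
apply: (accumulating_fiber T0 (nz w qw)) => z zw; split => //; split => //.
exact: (zero_vfield T0 erefl pq qE q1w zw).
Qed.

End Assertions.
End Theorem5.

Theorem theorem5 (R : realType) (T : R[i]) (r : nat)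
    (hT : T != 0) (hr : (1 <= r)%N) :
  (forall (F : sphere R -> sphere R) (hF : rational_of_degree r F),
     let Psi := exp_pullback T F in
     let X := vfield Psi in
     let a1 := F (fin 0) in
     let a2 := F (infty R) in
     [/\
      (* 1 *)
      (forall z, X (z + T) = X z) /\
      (forall p : sphere R, essential_singularity X p <-> p = infty R),
      (* 2 *)
      (exists U1 U2 : R -> set R[i],
         [/\ transcendental_singularity Psi a1 U1,
             transcendental_singularity Psi a2 U2,
             ~ (a1 = a2 /\ same_germ U1 U2) &
             forall a U, transcendental_singularity Psi a U ->
               (a = a1 /\ same_germ U U1) \/ (a = a2 /\ same_germ U U2)]),
      (* 3 *)
      (forall a U, transcendental_singularity Psi a U ->
         [/\ logarithmic Psi a U,
             a <> infty R -> hyperbolic_tract U X &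
             a = infty R -> elliptic_tract U X]),
      (* 4 *)
      ((exists w, [/\ critical_points F w, w <> fin 0, w <> infty R &
                      F w <> infty R]) ->
       infinitely_many_accumulating_at (poles X) (infty R)) &
      (* 5 *)
      (~ asymptotic_value Psi (infty R) ->
       infinitely_many_accumulating_at
         [set p | (exists2 k, (2 <= k)%N & zeros_of_mult X k p) /\
                  residue_at (time_form Psi) p 0] (infty R) /\
       ((exists w, F w = infty R /\ ~ critical_points F w) ->
        infinitely_many_accumulating_at
          [set p | zeros_of_mult X 2 p /\ residue_at (time_form Psi) p 0]
          (infty R)))]) /\
  (* 6 *)
  [/\ exp_family r T = \bigcup_c subfamily r T c,
      trivIset [set: configuration] (subfamily r T),
      generic r (fun F => has_configuration ThreePoints (F (fin 0)) (F (infty R))) &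
      forall Psi, exp_family r T Psi ->
        (~ asymptotic_value Psi (infty R) <->
         subfamily r T ThreePoints Psi \/ subfamily r T EqualFinite Psi)].
Proof.
split=> [F [p [q [pq ->]]] /=|].
  split; [exact: period_and_essential pq|exact: two_singularities pq|
    exact: singularity_type pq|exact: poles_limit_infty pq|exact: zeros_limit_infty pq].
split; [exact: subfamily_cover|exact: subfamily_trivIset|exact: three_points_generic|].
move=> Psi [F hF ->]; have [p [q [pq FE]]] := hF; split=> [na|].
  have n1 : F (fin 0) <> infty R.
    by move=> e; apply: na; rewrite FE; apply/(asymptotic_infty hT hr pq); left; rewrite -FE.
  have n2 : F (infty R) <> infty R.
    by move=> e; apply: na; rewrite FE; apply/(asymptotic_infty hT hr pq); right; rewrite -FE.
  have [e|n] := pselect (F (fin 0) = F (infty R)).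
    by right; exists F.
  by left; exists F.
(* A subfamily supplies its own rational function F' with the same pullback, so the asymptotic
   values are read off F'. *)
have H F' : rational_of_degree r F' -> exp_pullback T F = exp_pullback T F' ->
    F' (fin 0) <> infty R -> F' (infty R) <> infty R ->
    ~ asymptotic_value (exp_pullback T F) (infty R).
  move=> [p' [q' [pq' ->]]] -> n1 n2 /(asymptotic_infty hT hr pq').
  by case.
case=> -[F' [hF' e hc]]; apply: (H _ hF' e).
- by case: hc.
- by case: hc.
- by case: hc.
- by case: hc => <-.
Qed.
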